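(* Let $V$ be a real separable Banach space with dual $V'$, and let $\mathcal{A}:D(\mathcal{A})\to 2^{V}$ be a densely defined m-accretive operator whose associated semigroup $T_{\mathcal{A}}$ is domain invariant and admits an infinitesimal generator $\mathcal{A}^{\circ}:V\to V$. Let $\mathcal{V}\subseteq V$ be a dense linear subspace and let $V^{\ast}\subseteq V'$ be a subset which separates points. Let $x\in\mathcal{M}(\Omega;V)$, $\eta\in\mathcal{M}((0,\infty)\times Z\times\Omega;V)$, and let $\mathbb{X}$ denote the process generated by $(x,\eta)$. Assume that $\mathcal{V}$ is invariant w.r.t. $T_{\mathcal{A}}$ and that $\langle\Psi,\mathcal{A}^{\circ}T_{\mathcal{A}}(\cdot)u\rangle_{V}\in L^{1}((0,t))$ for all $t>0$, $u\in\mathcal{V}$ and $\Psi\in V^{\ast}$. Then $\mathbb{X}$ is the unique (up to indistinguishability) mild solution of (ACPRM)$\{x,\eta,V^{\ast}\}$. Moreover, if in addition $(0,0)\in\mathcal{A}$, then with probability one $$\|\mathbb{X}(t)\|_{V}\le\|x\|_{V}+\int_{(0,t]\times Z}\|\eta(\tau,z)\|_{V}\,N_{\Theta}(d\tau\otimes z)\quad\text{for all }t\ge 0.$$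
   Context: **Point processes.** $(\Omega,\mathcal{F},\mathbb{P})$ is a complete probability space and $(Z,\mathcal{Z})$ a measurable space; $\mathfrak{B}(\cdot)$ denotes Borel $\sigma$-algebras. A point function is a map $\theta:D(\theta)\to Z$ with $D(\theta)\subseteq(0,\infty)$ countable; $\pi(Z)$ is the set of all point functions, with the $\sigma$-algebra $\Pi(Z)$ generated by the sets $\{\theta\in\pi(Z):\#\{t\in D(\theta):(t,\theta(t))\in U\}=k\}$, $k\in\mathbb{N}_{0}$, $U\in\mathfrak{B}((0,\infty))\otimes\mathcal{Z}$. A point process is an $\mathcal{F}$-$\Pi(Z)$-measurable map $\Theta:\Omega\to\pi(Z)$; its counting measure is $N_{\Theta}(U,\omega)=\#\{t\in D(\Theta(\omega)):(t,\Theta(\omega)(t))\in U\}$. $\Theta$ is finite if $\mathbb{E}N_{\Theta}((0,t]\times Z)<\infty$ for all $t>0$. A finite point process $\Theta$, with $D(\Theta(\omega))$ infinite for a.e. $\omega$, is fixed. Its hitting times are the a.s. unique measurable $\alpha_{m}:\Omega\to(0,\infty)$, $m\in\mathbb{N}$, with, almost surely, $D(\Theta)=\{\alpha_{1},\alpha_{2},\dots\}$ and $0<\alpha_{1}<\alpha_{2}<\cdots$ (then $\alpha_{m}\to\infty$ a.s.); $\alpha_{0}:=0$. Integrals against $N_{\Theta}$ are pathwise (for a.e. $\omega$) Lebesgue integrals w.r.t. $N_{\Theta}(\cdot,\omega)$. **Function spaces.** $\mathcal{M}(\Omega;V)$ is the set of $\mathcal{F}$-$\mathfrak{B}(V)$-measurable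 maps $\Omega\to V$; $\mathcal{M}((0,\infty)\times Z\times\Omega;V)$ is the set of $\mathfrak{B}((0,\infty))\otimes\mathcal{Z}\otimes\mathcal{F}$-$\mathfrak{B}(V)$-measurable maps. $\langle\cdot,\cdot\rangle_{V}$ is the duality between $V$ and $V'$. $V^{\ast}\subseteq V'$ separates points if $\langle\Phi,v\rangle_{V}=0$ for all $\Phi\in V^{\ast}$ implies $v=0$. $W^{1,1}([a,b];V)$ is the set of $f:[a,b]\to V$ that are absolutely continuous and differentiable a.e. **Operators and semigroups.** A multi-valued operator $\mathcal{A}:V\to 2^{V}$ has $D(\mathcal{A})=\{v:\mathcal{A}v\ne\emptyset\}$ and is identified with its graph $\{(v,\hat v):\hat v\in\mathcal{A}v\}$. It is accretive if $\|v_1-v_2\|_V\le\|v_1-v_2+\alpha(\hat v_1-\hat v_2)\|_V$ for all $\alpha>0$, $(v_i,\hat v_i)\in\mathcal{A}$; m-accretive if moreover $R(\mathrm{Id}+\alpha\mathcal{A})=V$ for all $\alpha>0$; densely defined if $\overline{D(\mathcal{A})}=V$. For $\mathcal{A}$ m-accretive and densely defined, $T_{\mathcal{A}}(\cdot)v:[0,\infty)\to V$ is the unique mild solution (in the usual sense of nonlinear semigroup theory, i.e. limit of implicit Euler schemes; equivalently $T_{\mathcal{A}}(t)v=\lim_{n}(\mathrm{Id}+\frac{t}{n}\mathcal{A})^{-n}v$) of $0\in u'(t)+\mathcal{A}u(t)$, $u(0)=v$; $(T_{\mathcal{A}}(t))_{t\ge0}$ is the semigroup associated to $\mathcal{A}$.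 A set $\tilde V\subseteq V$ is invariant w.r.t. $T_{\mathcal{A}}$ if $T_{\mathcal{A}}(t)\tilde v\in\tilde V$ for all $t\ge0$, $\tilde v\in\tilde V$. $T_{\mathcal{A}}$ is domain invariant if $T_{\mathcal{A}}(t)v\in D(\mathcal{A})$ for all $t>0$, $v\in V$. $T_{\mathcal{A}}$ admits the infinitesimal generator $\mathcal{A}^{\circ}:V\to V$ if $-\lim_{h\searrow0}\frac{T_{\mathcal{A}}(h)v-v}{h}=\mathcal{A}^{\circ}v\in\mathcal{A}v$ for all $v\in D(\mathcal{A})$, and $\mathcal{A}^{\circ}v=0$ for $v\notin D(\mathcal{A})$. **Solutions.** (ACPRM) is the formal inclusion $\eta(t,z)N_{\Theta}(dt\otimes z)\in dX(t)+\mathcal{A}X(t)dt$. A $\mathfrak{B}([0,\infty))\otimes\mathcal{F}$-$\mathfrak{B}(V)$-measurable process $X:[0,\infty)\times\Omega\to V$ is a strong solution of (ACPRM)$\{x,\eta,V^{\ast}\}$ if for $\mathbb{P}$-a.e. $\omega$: (i) $X(0,\omega)=x(\omega)$; (ii) $t\mapsto X(t,\omega)$ is càdlàg; (iii) $X(t,\omega)\in D(\mathcal{A})$ for all $t\in(0,\infty)\setminus\{\alpha_m(\omega):m\in\mathbb{N}\}$; (iv) for all $m\in\mathbb{N}_0$ and $[a,b]\subseteq(\alpha_m(\omega),\alpha_{m+1}(\omega))$, $X(\cdot,\omega)|_{[a,b]}\in W^{1,1}([a,b];V)$; (v) $\langle\Psi,\mathcal{A}^{\circ}X(\cdot,\omega)\rangle_V\in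 L^1(0,t)$ for all $t>0$, $\Psi\in V^{\ast}$; (vi) $\langle\Psi,X(t,\omega)-x(\omega)\rangle_V+\int_0^t\langle\Psi,\mathcal{A}^{\circ}X(\tau,\omega)\rangle_Vd\tau=\int_{(0,t]\times Z}\langle\Psi,\eta(\tau,z,\omega)\rangle_VN_{\Theta}(d\tau\otimes z,\omega)$ for all $t>0$, $\Psi\in V^{\ast}$. A $\mathfrak{B}([0,\infty))\otimes\mathcal{F}$-$\mathfrak{B}(V)$-measurable process $Y$ is a mild solution of (ACPRM)$\{x,\eta,V^{\ast}\}$ if it satisfies (i)-(iv) a.s. and there are $x_m\in\mathcal{M}(\Omega;V)$, $\eta_m\in\mathcal{M}((0,\infty)\times Z\times\Omega;V)$ and strong solutions $X_m$ of (ACPRM)$\{x_m,\eta_m,V^{\ast}\}$ ($m\in\mathbb{N}$) such that almost surely, for all $t>0$, $\lim_m\sup_{\tau\in[0,t]}\|X_m(\tau)-Y(\tau)\|_V=0$ and $\lim_m\int_{(0,t]\times Z}\|\eta_m(\tau,z)-\eta(\tau,z)\|_VN_{\Theta}(d\tau\otimes z)=0$. **Process generated by $(x,\eta)$.** Put $\eta_m(\omega):=\eta(\alpha_m(\omega),\Theta(\omega)(\alpha_m(\omega)),\omega)$ for $m\in\mathbb N$, $\mathsf{x}_0:=x$, $\mathsf{x}_m:=T_{\mathcal{A}}(\alpha_m-\alpha_{m-1})\mathsf{x}_{m-1}+\eta_m$ for $m\in\mathbb{N}$ (sequence of jumps generated by $(x,\eta)$), and $\mathbb{X}(t):=\sum_{m=0}^{\infty}T_{\mathcal{A}}((t-\alpha_m)_+)(\mathsf{x}_m)\mathbf{1}_{[\alpha_m,\alpha_{m+1})}(t)$,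 $t\ge0$. Everything is defined up to $\mathbb{P}$-null sets, and indistinguishable processes are identified. *)

(* Defs.v *)
From HB Require Import structures.
From mathcomp Require Export all_boot all_order all_algebra.
From mathcomp Require Export all_classical all_reals all_analysis.

Set Implicit Arguments.
Unset Strict Implicit.
Unset Printing Implicit Defensive.
Set Warnings "-redundant-canonical-projection".

Import Order.TTheory GRing.Theory Num.Theory.
Export numFieldNormedType.Exports.

Local Open Scope classical_set_scope.
Local Open Scope ring_scope.

Definition separable (T : topologicalType) :=
  exists2 D : set T, countable D & dense D.

Notation borel V := (g_sigma_algebraType (@open V)).

(* [V'], as a set of (algebraically) linear forms. *)
Definition dual (R : realType) (V : normedModType R) : set {linear V -> R^o} :=
  [set Psi | continuous Psi].

Definition separates_points (R : realType) (V : normedModType R)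
    (S : set {linear V -> R^o}) :=
  forall v : V, (forall Phi, S Phi -> Phi v = 0) -> v = 0.

(* Cadlag on [[0, +oo)]; values at negative times are irrelevant. *)
Definition cadlag (R : realType) (V : normedModType R) (f : R -> V) :=
  (forall t, 0 <= t -> f s @[s --> t^'+] --> f t) /\
  (forall t, 0 < t -> exists l : V, f s @[s --> t^'-] --> l).

Definition absolutely_continuous (R : realType) (V : normedModType R)
    (a b : R) (f : R -> V) :=
  forall e : R, 0 < e -> exists2 d : R, 0 < d &
    forall (n : nat) (l r : 'I_n -> R),
      (forall i, a <= l i /\ l i <= r i /\ r i <= b) ->
      trivIset setT (fun i => `]l i, r i[%classic) ->
      \sum_(i < n) (r i - l i) < d ->
      \sum_(i < n) `|f (r i) - f (l i)| < e.

(* [W^{1,1}([a,b];V)]; the end points form a null set, so differentiability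
   is only requested in the interior, where it only depends on the
   restriction of [f] to [[a,b]]. *)
Definition W11 (R : realType) (V : normedModType R) (a b : R) (f : R -> V) :=
  absolutely_continuous a b f /\
  {ae @lebesgue_measure R, forall t, a < t < b -> derivable f t 1}.

Section operators.
Context (R : realType) (V : completeNormedModType R).
Implicit Types (A : V -> set V) (T : R -> V -> V) (Ao : V -> V).

Definition op_dom A : set V := [set v | A v !=set0].

Definition accretive A :=
  forall (a : R) (v1 v2 w1 w2 : V), 0 < a -> A v1 w1 -> A v2 w2 ->
    `|v1 - v2| <= `|v1 - v2 + a *: (w1 - w2)|.

Definition m_accretive A :=
  accretive A /\
  forall (a : R) (f : V), 0 < a -> exists v w : V, A v w /\ v + a *: w = f.

Definition densely_defined A := closure (op_dom A) = setT.

(* An [e]-approximate implicit Euler scheme of [0 \in u' + A u] on [[0, S]]: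
   the nodes are [t 0 < ... < t N], the values are [u 0, ..., u N], and [f i.+1]
   is the error made in the [i]-th step. *)
Definition euler_scheme A (e S : R) (N : nat) (t : nat -> R) (f u : nat -> V) :=
  [/\ t 0%N = 0,
      (forall i, (i < N)%N -> t i < t i.+1 /\ t i.+1 - t i <= e),
      S - e < t N /\ t N <= S,
      \sum_(i < N) (t i.+1 - t i) * `|f i.+1| <= e &
      forall i, (i < N)%N ->
        A (u i.+1) (f i.+1 - (t i.+1 - t i)^-1 *: (u i.+1 - u i))].

(* Mild solution on [[0, +oo)] of [0 \in u' + A u], [u 0 = v]: on every
   [[0, S]], [u] is the uniform limit of implicit Euler schemes. *)
Definition mild_solution_ACP A (v : V) (u : R -> V) :=
  [/\ u 0 = v, {within `[0, +oo[, continuous u} &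
      forall S e : R, 0 < S -> 0 < e ->
        exists (N : nat) (t : nat -> R) (f w : nat -> V),
          [/\ euler_scheme A e S N t f w,
              `|u 0 - w 0%N| <= e &
              forall i s, (i < N)%N -> t i < s <= t i.+1 ->
                `|u s - w i.+1| <= e]].

(* [T] is the semigroup associated with [A]. For an m-accretive and densely
   defined [A] this determines [T t v] for all [t >= 0] and [v] (existence and
   uniqueness of mild solutions); values at [t < 0] are irrelevant. *)
Definition semigroup_of A T :=
  forall v, mild_solution_ACP A v (fun t => T t v).

Definition invariant (W : set V) T :=
  forall t v, 0 <= t -> W v -> W (T t v).

Definition domain_invariant A T :=
  forall t v, 0 < t -> op_dom A (T t v).

Definition infinitesimal_generator A T Ao :=
  (forall v, op_dom A v ->
     - (h^-1 *: (T h v - v)) @[h --> 0^'+] --> Ao v /\ A v (Ao v)) /\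
  (forall v, ~ op_dom A v -> Ao v = 0).

End operators.

(* A point function [theta : D(theta) -> Z] is encoded as the partial function
   [R -> option Z] whose domain of definition is [D(theta)]. *)
Record point_function (R : realType) (Z : Type) := PointFunction {
  pf_val :> R -> option Z ;
  pf_dom_gt0 : forall t, pf_val t <> None -> 0 < t ;
  pf_dom_countable : countable [set t | pf_val t <> None] }.

Definition pf_dom (R : realType) (Z : Type) (theta : point_function R Z) : set R :=
  [set t | theta t <> None].

(* [theta t] as an element of [Z], for [t] in the domain of [theta]; the junk
   value [point] is taken elsewhere. *)
Definition pf_at (R : realType) (Z : pointedType) (theta : point_function R Z)
    (t : R) : Z := odflt point (theta t).

HB.instance Definition _ (R : realType) (Z : Type) :=
  gen_eqMixin (point_function R Z).
HB.instance Definition _ (R : realType) (Z : Type) :=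
  gen_choiceMixin (point_function R Z).

Lemma pf_empty_subproof (R : realType) (Z : Type) :
  (forall t : R, (fun=> @None Z) t <> None -> 0 < t) /\
  countable [set t : R | (fun=> @None Z) t <> None].
Proof.
split => //; rewrite (_ : [set t | _] = set0) //.
by apply/seteqP; split.
Qed.

HB.instance Definition _ (R : realType) (Z : Type) :=
  isPointed.Build (point_function R Z)
    (PointFunction (proj1 (pf_empty_subproof R Z)) (proj2 (pf_empty_subproof R Z))).

Section counting_measure.
Context (R : realType) d (Z : measurableType d).
Implicit Type theta : point_function R Z.

(* The counting measure [N_theta]. *)
Definition pf_count theta (U : set (R * Z)) : \bar R :=
  counting [set t | pf_dom theta t /\ U (t, pf_at theta t)].

Let pf_count0 theta : pf_count theta set0 = 0%E.
Proof.
rewrite /pf_count (_ : [set t | _] = set0) ?measure0//.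
by apply/seteqP; split => t // [].
Qed.

Let pf_count_ge0 theta U : (0 <= pf_count theta U)%E.
Proof. exact: measure_ge0. Qed.

Let measurable_pf_dom theta (B : set R) :
  measurable (pf_dom theta `&` B).
Proof.
apply: countable_measurable; first exact: measurable_set1.
apply: sub_countable (@pf_dom_countable _ _ theta).
by apply: subset_card_le => t [].
Qed.

Let pf_count_sigma_additive theta : semi_sigma_additive (pf_count theta).
Proof.
move=> F mF tF mU; rewrite /pf_count.
pose G i := [set t | pf_dom theta t /\ F i (t, pf_at theta t)].
rewrite [X in counting X](_ : _ = \bigcup_i G i); last first.
  apply/seteqP; split => [t [Dt [i _ Fi]]|t [i _ [Dt Fi]]]; first by exists i.
  by split => //; exists i.
apply: (@measure_semi_sigma_additive _ _ _ (@counting R R)).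
- by move=> i; exact: measurable_pf_dom.
- apply/trivIsetP => i j _ _ ij; apply/seteqP; split => t // -[[_ Fi] [_ Fj]].
  move/trivIsetP : tF => /(_ i j Logic.I Logic.I ij)/seteqP[Fij _].
  exact: (Fij (t, pf_at theta t)).
- by apply: bigcup_measurable => i _; exact: measurable_pf_dom.
Qed.

HB.instance Definition _ theta := isMeasure.Build _ _ _ (pf_count theta)
  (pf_count0 theta) (pf_count_ge0 theta) (@pf_count_sigma_additive theta).

(* [<<s pf_generators >>] is the sigma-algebra [Pi(Z)]. *)
Definition pf_generators : set (set (point_function R Z)) :=
  [set [set theta | pf_count theta U = k%:R%:E] | k in [set: nat] &
     U in [set U : set (R * Z) | measurable U /\ U `<=` `]0, +oo[ `*` setT]].

End counting_measure.

Section point_process.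
Context (R : realType) d (Omega : measurableType d) (P : probability Omega R)
  dZ (Z : measurableType dZ).
Implicit Types (Theta : Omega -> point_function R Z) (alpha : nat -> Omega -> R).

Definition point_process Theta :=
  measurable_fun setT
    (Theta : Omega -> g_sigma_algebraType (@pf_generators R dZ Z)).

Definition finite_point_process Theta :=
  forall t : R, 0 < t ->
    (\int[P]_w pf_count (Theta w) (`]0%R, t] `*` setT) < +oo)%E.

(* [alpha 0 = 0], and [alpha m] for [m >= 1] are the hitting times of [Theta]. *)
Definition hitting_times Theta alpha :=
  [/\ (forall w, alpha 0%N w = 0),
      (forall m, measurable_fun setT (alpha m)),
      (forall m w, 0 < alpha m.+1 w),
      {ae P, forall w, pf_dom (Theta w) = range (fun m => alpha m.+1 w)} &
      {ae P, forall w, forall m, alpha m w < alpha m.+1 w}].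

End point_process.

Section ACPRM.
Context (R : realType) (V : completeNormedModType R).
Context d (Omega : measurableType d) (P : probability Omega R).
Context dZ (Z : measurableType dZ).
Variables (Theta : Omega -> point_function R Z) (alpha : nat -> Omega -> R).
Variables (A : V -> set V) (Ao : V -> V).
Variable Vstar : set {linear V -> R^o}.
Implicit Types (x : Omega -> V) (eta : R -> Z -> Omega -> V)
  (X : R -> Omega -> V) (T : R -> V -> V).

Definition measurable_initial x :=
  measurable_fun setT (x : Omega -> borel V).

(* Elements of [M((0, +oo) x Z x Omega; V)] are encoded as total functions whose
   values at times [t <= 0] are irrelevant; similarly below for processes. *)
Definition measurable_jumps eta :=
  measurable_fun [set p : R * Z * Omega | 0 < p.1.1]
    ((fun p => eta p.1.1 p.1.2 p.2) : R * Z * Omega -> borel V).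

Definition measurable_process X :=
  measurable_fun [set p : R * Omega | 0 <= p.1]
    ((fun p => X p.1 p.2) : R * Omega -> borel V).

Definition solution_regularity x X (w : Omega) :=
  [/\ X 0 w = x w,
      cadlag (fun t => X t w),
      (forall t, 0 < t -> (forall m, t <> alpha m.+1 w) -> op_dom A (X t w)) &
      (forall m a b, alpha m w < a -> a <= b -> b < alpha m.+1 w ->
         W11 a b (fun t => X t w))].

Definition strong_solution x eta X :=
  measurable_process X /\
  {ae P, forall w,
    [/\ solution_regularity x X w,
        (forall (t : R) Psi, 0 < t -> Vstar Psi ->
          lebesgue_measure.-integrable `]0, t[
            (fun tau => (Psi (Ao (X tau w)) : R)%:E)) &
        (forall (t : R) Psi, 0 < t -> Vstar Psi ->
          ((Psi (X t w - x w) : R)%:E +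
            \int[lebesgue_measure]_(tau in `]0%R, t[) (Psi (Ao (X tau w)) : R)%:E
          = \int[pf_count (Theta w)]_(p in `]0%R, t] `*` setT)
              (Psi (eta p.1 p.2 w) : R)%:E)%E)]}.

Definition mild_solution x eta Y :=
  [/\ measurable_process Y,
      {ae P, forall w, solution_regularity x Y w} &
      exists (xs : nat -> Omega -> V) (etas : nat -> R -> Z -> Omega -> V)
             (Xs : nat -> R -> Omega -> V),
        (forall m, [/\ measurable_initial (xs m), measurable_jumps (etas m) &
                       strong_solution (xs m) (etas m) (Xs m)]) /\
        {ae P, forall w, forall t : R, 0 < t ->
          (ereal_sup [set (`|Xs m tau w - Y tau w|)%:E | tau in `[0, t]]
             @[m --> \oo] --> 0%E) /\
          (\int[pf_count (Theta w)]_(p in `]0%R, t] `*` setT)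
             (`|etas m p.1 p.2 w - eta p.1 p.2 w|)%:E
             @[m --> \oo] --> 0)%E}].

Definition indistinguishable X Y :=
  {ae P, forall w, forall t : R, 0 <= t -> X t w = Y t w}.

Definition jump_mark eta (m : nat) (w : Omega) : V :=
  eta (alpha m w) (pf_at (Theta w) (alpha m w)) w.

Fixpoint jump_sequence T x eta (m : nat) (w : Omega) : V :=
  if m is m'.+1 then
    T (alpha m w - alpha m' w) (jump_sequence T x eta m' w) + jump_mark eta m w
  else x w.

(* The series has a single nonzero term as soon as the [alpha m w] increase to
   infinity, i.e. for almost every [w]; elsewhere its value is irrelevant. *)
Definition generated_process T x eta (t : R) (w : Omega) : V :=
  \big[+%R/0]_(0 <= m <oo)
    ((\1_(`[alpha m w, alpha m.+1 w[ : set R) t : R) *: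
       T (Num.max (t - alpha m w) 0) (jump_sequence T x eta m w)).

End ACPRM.

(* Main.v *)
(* Kobayashi's estimate compares two implicit Euler schemes of an accretive
   operator on different grids; it makes the mild solutions of the Cauchy
   problem a nonexpansive semigroup which is Lipschitz at positive times. The
   generator is thus the right derivative of a Lipschitz trajectory, which
   forces differentiability almost everywhere in a separable space: with
   right derivative [G], the increment of the trajectory minus [h *: v] is at
   most the integral of [|G - v|], and one lets [v] range over a dense sequence
   at points where all these integrals are differentiable.

   Existence: replacing the data by countably valued ones with values in the
   invariant dense subspace yields generated processes which are strong
   solutions (integrate the generator along each trajectory between two jumps),
   and nonexpansiveness makes them converge uniformly on bounded intervals.

   Uniqueness: by separability a countable subset of [Vstar] separates points,
   so that between two jumps a strong solution solves the differential equation
   almost everywhere; by accretivity its distance to the semigroup trajectory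
   has a left derivative [<= 0] almost everywhere, hence vanishes. Strong
   solutions are therefore the generated processes of their data, and mild
   solutions are limits of these. *)

(* A Lipschitz map into a general Banach space may be nowhere differentiable, so the
   differentiability demanded of solutions has to come from the right derivative that the generator
   supplies at every positive time. Hence each argument about a trajectory begins at a later time
   [c], where domain invariance gives a Lipschitz bound, and [c] is then sent to the start.
   Nonexpansiveness and continuity survive this limit; the integral identity survives it because of
   the integrability assumed on the dense subspace, which is why strong solutions are built from
   data in that subspace. Rounding the data to a dense sequence makes an error that is uniform in
   all arguments, and almost surely only finitely many jumps fall into a bounded interval; so the
   errors made at the jumps can be summed path by path. *)
From HB Require Import structures.
Require Import Defs.
From mathcomp Require Import measurable_realfun ring lra.

Set Implicit Arguments.
Unset Strict Implicit.
Unset Printing Implicit Defensive.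

Import Order.TTheory GRing.Theory Num.Theory.
Import numFieldNormedType.Exports.

Local Open Scope classical_set_scope.
Local Open Scope ring_scope.

(** * Linear combinations in modules *)

Section module_expressions.
Context (R : comPzRingType) (V : lmodType R).

Inductive mexp :=
  | MZero | MVar of nat | MAdd of mexp & mexp | MOpp of mexp
  | MScale of R & mexp.

Fixpoint meval (env : seq V) e : V :=
  match e with
  | MZero => 0 | MVar k => env`_k | MAdd e1 e2 => meval env e1 + meval env e2
  | MOpp e1 => - meval env e1 | MScale a e1 => a *: meval env e1
  end.

Fixpoint mcoef e (i : nat) : R :=
  match e with
  | MZero => 0 | MVar k => if k == i then 1 else 0
  | MAdd e1 e2 => mcoef e1 i + mcoef e2 i
  | MOpp e1 => - mcoef e1 i | MScale a e1 => a * mcoef e1 i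
  end.

Fixpoint mcoef_eq e1 e2 (n : nat) : Prop :=
  if n is n'.+1 then mcoef e1 n' = mcoef e2 n' /\ mcoef_eq e1 e2 n' else True.

Lemma meval_sum env e :
  meval env e = \sum_(i < size env) mcoef e i *: env`_i.
Proof.
elim: e => [|k|e1 IH1 e2 IH2|e IH|a e IH] /=.
- by rewrite big1// => i _; rewrite scale0r.
- have [kn|kn] := ltnP k (size env).
    rewrite (bigD1 (Ordinal kn))//= eqxx scale1r big1 ?addr0// => i.
    by rewrite -val_eqE/= eq_sym => /negbTE ->; rewrite scale0r.
  (* An index out of range reads the default value [0], and the sum does not see it either. *)
  rewrite nth_default// big1// => i _.
  by rewrite gtn_eqF ?scale0r// (leq_trans _ kn).
- by rewrite IH1 IH2 -big_split; apply: eq_bigr => i _; rewrite scalerDl.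
- by rewrite IH -sumrN; apply: eq_bigr => i _; rewrite scaleNr.
- by rewrite IH scaler_sumr; apply: eq_bigr => i _; rewrite scalerA.
Qed.

Lemma meval_eq env e1 e2 :
  mcoef_eq e1 e2 (size env) -> meval env e1 = meval env e2.
Proof.
move=> e12; rewrite !meval_sum; apply: eq_bigr => i _; congr (_ *: _).
elim: (size env) i e12 => [[]//|n IH] i /= [en e12].
by have := ltn_ord i; rewrite ltnS leq_eqVlt => /predU1P[->//|lin];
  exact: (IH (Ordinal lin)).
Qed.

End module_expressions.

Ltac mindex x env :=
  match env with
  | x :: _ => constr:(0%N)
  | _ :: ?e => let k := mindex x e in constr:(k.+1)
  end.

(** The inner [match] backtracks: if [mindex] fails, the atom is new and is pushed to the front.
    This shifts the indices, so reification has to wait for the final list. *)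
Ltac mexp_vars t env :=
  match t with
  | (?a + ?b)%R => let env' := mexp_vars a env in mexp_vars b env'
  | (- ?a)%R => mexp_vars a env
  | (_ *: ?a)%R => mexp_vars a env
  | (0)%R => env
  | _ => match env with
         | _ => let k := mindex t env in env
         | _ => constr:(t :: env)
         end
  end.

Ltac mexp_reify R t env :=
  match t with
  | (?a + ?b)%R => let a' := mexp_reify R a env in let b' := mexp_reify R b env in
                constr:(MAdd a' b')
  | (- ?a)%R => let a' := mexp_reify R a env in constr:(MOpp a')
  | (?c *: ?a)%R => let a' := mexp_reify R a env in constr:(@MScale R c a')
  | (0)%R => constr:(@MZero R)
  | _ => let k := mindex t env in constr:(@MVar R k)
  end.

(* Reduces an identity between linear combinations in a [V : lmodType R] to the
   identities in [R] between the coefficients of the atoms. *)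
Ltac lincomb R V :=
  match goal with
  | |- ?l = ?r =>
    let e0 := mexp_vars l (@nil V) in
    let env := mexp_vars r e0 in
    let l' := mexp_reify R l env in
    let r' := mexp_reify R r env in
    change (@meval R V env l' = @meval R V env r'); apply: meval_eq;
    cbn [size mcoef_eq mcoef eqn eq_op Nat.eqb]; rewrite /=; repeat split
  end.

(** * Implicit Euler schemes of accretive operators *)

Section accretive.
Context (R : realType) (V : completeNormedModType R) (A : V -> set V).
Hypothesis A_acc : accretive A.

(** With parameter [h] in accretivity, [u2] cancels against the difference quotient, which leaves
    [u1 - z] and two error terms. *)
Lemma accretive_euler_step (h : R) (u1 u2 f z y : V) : 0 < h ->
  A u2 (f - h^-1 *: (u2 - u1)) -> A z y ->
  `|u2 - z| <= `|u1 - z| + h * `|f| + h * `|y|.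
Proof.
move=> h0 Au Az; apply: le_trans (A_acc h0 Au Az) _.
rewrite -(gtr0_norm h0) -!normrZ (gtr0_norm h0).
rewrite [X in `|X|](_ : _ = (u1 - z) + h *: f - h *: y).
  by rewrite (le_trans (ler_normB _ _)) ?lerD2r ?ler_normD.
by lincomb R V; field; lra.
Qed.

(** The parameter [h * k / (h + k)] is the one for which accretivity leaves a convex combination of
    the two differences in which just one scheme has gone back a step. *)
Lemma accretive_euler_step2 (h k : R) (u1 u2 v1 v2 f g : V) : 0 < h -> 0 < k ->
  A u2 (f - h^-1 *: (u2 - u1)) -> A v2 (g - k^-1 *: (v2 - v1)) ->
  `|u2 - v2| <= k / (h + k) * `|u1 - v2| + h / (h + k) * `|u2 - v1|
                + h * k / (h + k) * (`|f| + `|g|).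
Proof.
move=> h0 k0 Au Av.
have hk : 0 < h + k by lra.
have a0 : 0 < h * k / (h + k) by rewrite divr_gt0 ?mulr_gt0.
apply: le_trans (A_acc a0 Au Av) _.
rewrite [X in `|X|](_ : _ = (k / (h + k)) *: (u1 - v2) +
    (h / (h + k)) *: (u2 - v1) + (h * k / (h + k)) *: (f - g)); last first.
  by lincomb R V; field; lra.
rewrite (le_trans (ler_normD _ _))// lerD ?(le_trans (ler_normD _ _)) ?lerD//.
- by rewrite normrZ ger0_norm// divr_ge0 ?ltW.
- by rewrite normrZ ger0_norm// divr_ge0 ?ltW.
- by rewrite normrZ gtr0_norm// ler_pM2l// ler_normB.
Qed.

(** Concavity of the square root; after squaring, the gap is [p * q * (a - b) ^+ 2]. *)
Lemma sqrt_convex (p q x y : R) : 0 <= p -> 0 <= q -> p + q = 1 ->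
  0 <= x -> 0 <= y ->
  p * Num.sqrt x + q * Num.sqrt y <= Num.sqrt (p * x + q * y).
Proof.
move=> p0 q0 pq x0 y0.
have := sqr_sqrtr x0; have := sqr_sqrtr y0.
have := sqrtr_ge0 x; have := sqrtr_ge0 y.
move: (Num.sqrt x) (Num.sqrt y) => a b b0 a0 <- <-.
rewrite -[leLHS]ger0_norm; last by rewrite addr_ge0 ?mulr_ge0.
rewrite -sqrtr_sqr ler_sqrt; last by rewrite addr_ge0 ?mulr_ge0 ?sqr_ge0.
have -> : q = 1 - p by lra.
rewrite -subr_ge0 (_ : _ - _ = p * q * (a - b) ^+ 2).
  by rewrite mulr_ge0 ?sqr_ge0 ?mulr_ge0.
by rewrite (_ : q = 1 - p); [ring | lra].
Qed.

Let err (t : nat -> R) (f : nat -> V) n :=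
  \sum_(i < n) (t i.+1 - t i) * `|f i.+1|.
Let sqs (t : nat -> R) n := \sum_(i < n) (t i.+1 - t i) ^+ 2.

Definition euler_steps N (t : nat -> R) (f u : nat -> V) := forall i, (i < N)%N ->
  t i < t i.+1 /\ A (u i.+1) (f i.+1 - (t i.+1 - t i)^-1 *: (u i.+1 - u i)).

Lemma euler_steps_near N t f u z y n : euler_steps N t f u -> A z y ->
  (n <= N)%N ->
  `|u n - z| <= `|u 0%N - z| + (t n - t 0%N) * `|y| + err t f n.
Proof.
move=> st Azy; elim: n => [|n IH] nN.
  by rewrite /err big_ord0 subrr mul0r !addr0.
have [tn Au] := st n nN; rewrite -subr_gt0 in tn.
have := accretive_euler_step tn Au Azy.
rewrite /err big_ord_recr/= -/(err t f n); have := IH (ltnW nN); lra.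
Qed.

(** Double induction; the base cases are [euler_steps_near]. In the induction step the weights
    satisfy [p * h = q * k], so the mixed terms [D * h] and [D * k] cancel, the averaged radicand is
    exactly the new one, and concavity of the root closes the recursion. *)
Lemma kobayashi_estimate N M t s f g u v z y i j :
  euler_steps N t f u -> euler_steps M s g v -> A z y ->
  (i <= N)%N -> (j <= M)%N ->
  `|u i - v j| <= `|u 0%N - z| + `|v 0%N - z| +
    Num.sqrt ((t i - t 0%N - (s j - s 0%N)) ^+ 2 + (sqs t i + sqs s j)) * `|y|
    + (err t f i + err s g j).
Proof.
have sqs_ge0 t' n : 0 <= sqs t' n by apply: sumr_ge0 => ? _; exact: sqr_ge0.
move=> stu stv Azy; elim: i j => [|i IHi] j iN jM.
  rewrite (le_trans (ler_distD z _ _))// (distrC z).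
  have := euler_steps_near stv Azy jM.
  rewrite -/(err s g j) {2}/err big_ord0 subrr add0r sqrrN.
  set b := s j - s 0%N; set c := sqs _ _ + _.
  have : b <= Num.sqrt (b ^+ 2 + c).
    rewrite (le_trans (ler_norm _))// -sqrtr_sqr ler_sqrt ?lerDl ?addr_ge0//.
    by rewrite sqr_ge0.
  move=> /ler_wpM2r => /(_ `|y| (normr_ge0 _)); lra.
elim: j jM => [|j IHj] jM.
  rewrite (le_trans (ler_distD z _ _))// (distrC z).
  have := euler_steps_near stu Azy iN.
  rewrite -/(err t f _) {3}/err big_ord0 subrr subr0.
  set b := t _ - t 0%N; set c := sqs _ _ + _.
  have : b <= Num.sqrt (b ^+ 2 + c).
    rewrite (le_trans (ler_norm _))// -sqrtr_sqr ler_sqrt ?lerDl ?addr_ge0//.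
    by rewrite sqr_ge0.
  move=> /ler_wpM2r => /(_ `|y| (normr_ge0 _)); lra.
have [h0 Au] := stu i iN; have [k0 Av] := stv j jM.
rewrite -subr_gt0 in h0; rewrite -subr_gt0 in k0.
apply: le_trans (accretive_euler_step2 h0 k0 Au Av) _.
have := IHi j.+1 (ltnW iN) jM; have := IHj (ltnW jM).
rewrite /sqs /err ![\sum_(_ < i.+1) _]big_ord_recr ![\sum_(_ < j.+1) _]big_ord_recr/=.
rewrite -!/(sqs _ _) -!/(err _ _ _).
set h := t i.+1 - t i in h0 *; set k := s j.+1 - s j in k0 *.
rewrite (_ : t i - t 0%N - _ = t i.+1 - t 0%N - (s j.+1 - s 0%N) - h); last first.
  by rewrite /h; ring.
rewrite (_ : t i.+1 - t 0%N - (s j - _) = t i.+1 - t 0%N - (s j.+1 - s 0%N) + k); last first.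
  by rewrite /k; ring.
set D := t i.+1 - _ - _.
set B := sqs t i; set C := sqs s j.
move=> H1 H2.
have hk : 0 < h + k by lra.
set p := k / (h + k); set q := h / (h + k).
have p0 : 0 <= p by rewrite divr_ge0 ?ltW.
have q0 : 0 <= q by rewrite divr_ge0 ?ltW.
have pq : p + q = 1 by rewrite /p /q; field; lra.
have ph : h * k / (h + k) = p * h by rewrite /p; field; lra.
have qk : h * k / (h + k) = q * k by rewrite /q; field; lra.
have E1 : 0 <= (D - h) ^+ 2 + (B + (C + k ^+ 2)).
  by rewrite addr_ge0 ?sqr_ge0// addr_ge0 ?sqs_ge0// addr_ge0 ?sqs_ge0 ?sqr_ge0.
have E2 : 0 <= (D + k) ^+ 2 + (B + h ^+ 2 + C).
  by rewrite addr_ge0 ?sqr_ge0// addr_ge0 ?sqs_ge0// addr_ge0 ?sqs_ge0 ?sqr_ge0.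
have := sqrt_convex p0 q0 pq E1 E2.
rewrite [X in _ <= Num.sqrt X](_ : _ =
    D ^+ 2 + (B + h ^+ 2 + (C + k ^+ 2))); last first.
  by rewrite /p /q; field; lra.
move=> /ler_wpM2r => /(_ `|y| (normr_ge0 _)) H3.
have {}H1 := ler_wpM2l q0 H1.
have {}H2 := ler_wpM2l p0 H2.
rewrite mulrDr {1}ph qk.
set X1 := `|u i - _| in H2 *; set X2 := `|_ - v j| in H1 *.
move: H1 H2 H3; move: (Num.sqrt _) (Num.sqrt _) (Num.sqrt _) => r1 r2 r3.
have -> : q = 1 - p by lra.
move: (`|u 0%N - z|) (`|v 0%N - z|) (`|y|) (`|f i.+1|) (`|g j.+1|) (err _ _ _) (err _ _ _).
move=> a1 a2 a3 a4 a5 a6 a7; lra.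
Qed.

End accretive.

(** * Comparison of two mild solutions through their schemes *)

Section mild_solutions.
Context (R : realType) (V : completeNormedModType R) (A : V -> set V).
Hypothesis A_acc : accretive A.

Lemma grid_cell N (t : nat -> R) (c : R) : t 0%N < c -> c <= t N ->
  exists2 i, (i < N)%N & t i < c <= t i.+1.
Proof.
move=> t0 tN; have ex : exists n, c <= t n by exists N.
case: (ex_minnP ex) => [[|n]]; first by rewrite leNgt t0.
move=> cn min; exists n; first exact: min.
by rewrite cn andbT ltNge; apply/negP => /min; rewrite ltnn.
Qed.

Lemma grid_le N (t : nat -> R) i j : (forall i, (i < N)%N -> t i < t i.+1) ->
  (i <= j)%N -> (j <= N)%N -> t i <= t j.
Proof.
move=> ti; elim: j => [|j IH]; first by rewrite leqn0 => /eqP ->.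
rewrite leq_eqVlt => /predU1P[->//|ij] jN.
by rewrite (le_trans (IH ij (ltnW jN)))// ltW// ti.
Qed.

Lemma grid_lt N (t : nat -> R) i j : (forall i, (i < N)%N -> t i < t i.+1) ->
  (i <= N)%N -> (j <= N)%N -> t i < t j -> (i < j)%N.
Proof.
by move=> ti iN jN; rewrite ltnNge; apply: contraTN => /(grid_le ti)/(_ iN); rewrite leNgt.
Qed.

(** This makes the sums of squares in the radicand of Kobayashi's estimate vanish with the mesh
    [e]. *)
Lemma sum_sqr_steps (e : R) (t : nat -> R) n :
  (forall i, (i < n)%N -> t i < t i.+1 /\ t i.+1 - t i <= e) ->
  \sum_(i < n) (t i.+1 - t i) ^+ 2 <= e * (t n - t 0%N).
Proof.
elim: n => [|n IH] H; first by rewrite big_ord0 subrr mulr0.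
rewrite big_ord_recr/=; have [t1 t2] := H n (ltnSn n).
have := IH (fun i ni => H i (ltnW ni)).
have : (t n.+1 - t n) * (t n.+1 - t n) <= e * (t n.+1 - t n).
  by rewrite ler_wpM2r// subr_ge0 ltW.
rewrite expr2; lra.
Qed.

Lemma sum_shift_le (F : nat -> R) N p n : (forall i, (i < N)%N -> 0 <= F i) ->
  (p + n <= N)%N -> \sum_(i < n) F (p + i)%N <= \sum_(i < N) F i.
Proof.
move=> F0 pnN; rewrite -[in leRHS](subnKC pnN) !big_split_ord/=.
rewrite addrAC lerDr addr_ge0// sumr_ge0// => i _; rewrite F0//.
  by rewrite (leq_trans (ltn_ord i))// (leq_trans (leq_addr n p)).
by rewrite -[ltnRHS](subnKC pnN) ltn_add2l.
Qed.

Lemma euler_scheme_steps e S N t f u :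
  euler_scheme A e S N t f u -> euler_steps A N t f u.
Proof. by move=> [_ t1 _ _ t2] i iN; have [? _] := t1 i iN; split=> //; exact: t2. Qed.

(** The scheme of [u] is restarted at a node [p] just after [c] and compared with the scheme of [u']
    from [0]. Six errors of size [e] occur: two approximations at the end, two at the start, two
    accumulated scheme errors. The three nodes overshoot by at most [e] each, hence [9 * e ^+ 2];
    the other term bounds the two sums of squared steps. *)
Lemma mild_compare_near v v' u u' c s z y (e : R) :
  mild_solution_ACP A v u -> mild_solution_ACP A v' u' ->
  0 <= c -> 0 < s -> A z y -> 0 < e -> e <= 1 -> 
  `|u (c + s) - u' s| <= `|u c - z| + `|v' - z| + 6 * e +
     Num.sqrt (9 * e ^+ 2 + 2 * e * (c + s + 1)) * `|y|.
Proof.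
move=> mu mu' c0 s0 Azy e0 e1.
(* A scheme may stop up to [e <= 1] before its horizon, so the horizon is one unit too long. *)
have S0 : 0 < c + s + 1 by lra.
have S'0 : 0 < s + 1 by lra.
have [_ _ /(_ _ _ S0 e0)[N [t [f [w [sch w0 near]]]]]] := mu.
have [u'0 _ /(_ _ _ S'0 e0)[M [t' [g [w' [sch' w'0 near']]]]]] := mu'.
have stp := euler_scheme_steps sch; have stp' := euler_scheme_steps sch'.
have [t0 ti [tN1 tN2] errt _] := sch; have [t'0 t'i [t'N1 t'N2] errt' _] := sch'.
have tmon i : (i < N)%N -> t i < t i.+1 by move=> /ti[].
have t'mon i : (i < M)%N -> t' i < t' i.+1 by move=> /t'i[].
have [i iN icell] : exists2 i, (i < N)%N & t i < c + s <= t i.+1.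
  by apply: grid_cell; [rewrite t0; lra | lra].
have [j jM jcell] : exists2 i, (i < M)%N & t' i < s <= t' i.+1.
  by apply: grid_cell; [rewrite t'0; lra | lra].
(* For [c = 0] no cell has [c] in its left-open interval; the node [0] serves instead. *)
have [p [pi pc wp]] : exists p, [/\ (p <= i.+1)%N, c <= t p <= c + e & `|u c - w p| <= e].
  move: c0; rewrite le_eqVlt => /predU1P[c0|c0].
    by exists 0%N; split => //; rewrite -c0// t0; lra.
  have [p pN pcell] : exists2 i, (i < N)%N & t i < c <= t i.+1.
    by apply: grid_cell; [rewrite t0; lra | lra].
  have [_ te] := ti _ pN.
  exists p.+1; split; [|lra|exact: near].
  by rewrite (grid_lt tmon (ltnW pN) iN)//; lra.
have /andP[ic1 ic2] := icell; have /andP[jc1 jc2] := jcell; have /andP[pc1 pc2] := pc.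
have stps : euler_steps A (N - p) (fun l => t (p + l)%N) (fun l => f (p + l)%N)
    (fun l => w (p + l)%N).
  by move=> l lN; rewrite addnS; apply: stp; rewrite -ltn_subRL.
have iNp : (i.+1 - p <= N - p)%N by rewrite leq_sub2r.
have := kobayashi_estimate A_acc stps stp' Azy iNp jM.
rewrite addn0 subnKC// t'0 subr0.
have errl : \sum_(l < i.+1 - p) (t (p + l.+1)%N - t (p + l)%N) * `|f (p + l.+1)%N| <= e.
  apply: le_trans errt.
  under eq_bigr do rewrite addnS.
  apply: (@sum_shift_le (fun i => (t i.+1 - t i) * `|f i.+1|)); last by rewrite subnKC.
  by move=> l lN; rewrite mulr_ge0// subr_ge0 ltW// tmon.
have errr : \sum_(l < j.+1) (t' l.+1 - t' l) * `|g l.+1| <= e.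
  apply: le_trans errt'.
  apply: (@sum_shift_le (fun i => (t' i.+1 - t' i) * `|g i.+1|) M 0 j.+1) => //.
  by move=> l lN; rewrite mulr_ge0// subr_ge0 ltW// t'mon.
have sqsl : \sum_(l < i.+1 - p) (t (p + l.+1)%N - t (p + l)%N) ^+ 2 <= e * (c + s + 1).
  apply: (le_trans (@sum_sqr_steps e (fun l => t (p + l)%N) (i.+1 - p) _)).
    by move=> l ln; rewrite addnS; apply: ti; rewrite (leq_trans _ iN)// -ltn_subRL.
  rewrite addn0 subnKC// (ler_wpM2l (ltW e0))//.
  have := grid_le tmon iN (leqnn N); lra.
have sqsr : \sum_(l < j.+1) (t' l.+1 - t' l) ^+ 2 <= e * (c + s + 1).
  apply: (le_trans (@sum_sqr_steps e t' j.+1 _)).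
    by move=> l ln; apply: t'i; rewrite (leq_trans _ jM).
  rewrite (ler_wpM2l (ltW e0))//.
  have := grid_le t'mon jM (leqnn M); lra.
have [_ tie] := ti _ iN; have [_ tje] := t'i _ jM.
set r := Num.sqrt _; have : r <= Num.sqrt (9 * e ^+ 2 + 2 * e * (c + s + 1)).
  rewrite ler_sqrt; last by rewrite addr_ge0 ?mulr_ge0 ?sqr_ge0//; lra.
  have : (t i.+1 - t p - t' j.+1) ^+ 2 <= 9 * e ^+ 2.
    set x := _ - _; rewrite -subr_ge0.
    have -> : 9 * e ^+ 2 - x ^+ 2 = (3 * e - x) * (3 * e + x) by ring.
    by rewrite mulr_ge0// /x; lra.
  lra.
move=> /ler_wpM2r => /(_ `|y| (normr_ge0 _)).
have n1 := near _ _ iN icell; have n2 := near' _ _ jM jcell.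
have := ler_distD (w i.+1) (u (c + s)) (u' s).
have := ler_distD (w' j.+1) (w i.+1) (u' s).
have := ler_distD (u c) (w p) z; rewrite distrC in wp.
have := ler_distD v' (w' 0%N) z; rewrite u'0 distrC in w'0.
rewrite distrC in n2.
lra.
Qed.
End mild_solutions.

(** * The semigroup of an m-accretive operator *)

Section mild_compare.
Context (R : realType) (V : completeNormedModType R) (A : V -> set V).
Hypothesis A_acc : accretive A.

Lemma mild_compare_dom v v' u u' c s z y :
  mild_solution_ACP A v u -> mild_solution_ACP A v' u' ->
  0 <= c -> 0 < s -> A z y ->
  `|u (c + s) - u' s| <= `|u c - z| + `|v' - z|.
Proof.
move=> mu mu' c0 s0 Azy; apply/ler_addgt0Pr => eta eta0.
set K := `|y|; have K0 : 0 <= K by exact: normr_ge0.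
pose S := c + s + 1; pose D := eta / (2 * (K + 1)).
have D0 : 0 < D by rewrite divr_gt0//; lra.
have S9 : 0 < 9 + 2 * S by rewrite /S; lra.
(* Chosen so that [6 * e] and the root term are each at most [eta / 2]; [e <= 1] bounds [9 * e ^+ 2]
   by [9 * e]. *)
pose e := Num.min 1 (Num.min (eta / 12) (D ^+ 2 / (9 + 2 * S))).
have e0 : 0 < e by rewrite !lt_min !divr_gt0 ?exprn_gt0//; lra.
have e1 : e <= 1 by rewrite ge_min lexx.
have e2 : e <= eta / 12 by rewrite !ge_min lexx orbT.
have e3 : e <= D ^+ 2 / (9 + 2 * S) by rewrite !ge_min lexx !orbT.
have := mild_compare_near A_acc mu mu' c0 s0 Azy e0 e1.
have -> : c + s + 1 = S by [].
have : Num.sqrt (9 * e ^+ 2 + 2 * e * S) <= D.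
  rewrite -(ger0_norm (ltW D0)) -sqrtr_sqr ler_sqrt ?sqr_ge0//.
  move: e3; rewrite ler_pdivlMr//; apply: le_trans.
  rewrite -subr_ge0 (_ : _ - _ = 9 * (e * (1 - e))); last by ring.
  by rewrite !mulr_ge0//; lra.
move=> /ler_wpM2r => /(_ K K0).
have : D * K <= eta / 2.
  rewrite /D -subr_ge0 (_ : _ - _ = eta / (2 * (K + 1))); last by field; lra.
  exact: ltW.
rewrite -/K; lra.
Qed.

Hypothesis A_dense : densely_defined A.

Lemma op_dom_dense (v : V) (e : R) : 0 < e -> exists2 z, op_dom A z & `|v - z| < e.
Proof.
move=> e0; have : closure (op_dom A) v by rewrite A_dense.
move=> /(_ (ball v e) (nbhsx_ballx v e e0))[z [Dz vz]]; exists z => //.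
by move: vz; rewrite -ball_normE.
Qed.

(** The shift [c] lets one inequality serve twice: [c = 0] gives nonexpansiveness, and [v' = u c]
    gives the semigroup law. The comparison point [z] of the domain is taken within [e / 2] of [v']
    and enters twice. *)
Lemma mild_compare v v' u u' c s :
  mild_solution_ACP A v u -> mild_solution_ACP A v' u' ->
  0 <= c -> 0 <= s -> `|u (c + s) - u' s| <= `|u c - v'|.
Proof.
move=> mu mu' c0; rewrite le_eqVlt => /predU1P[<-|s0].
  by rewrite addr0; have [-> _ _] := mu'.
apply/ler_addgt0Pr => e e0.
have [z [y Azy] vz] := op_dom_dense v' (divr_gt0 e0 (ltr0Sn R 1)).
have := mild_compare_dom mu mu' c0 s0 Azy.
have := ler_distD v' (u c) z; lra.
Qed.

Lemma mild_near_dom z y u s : mild_solution_ACP A z u -> 0 <= s -> A z y ->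
  `|u s - z| <= s * `|y|.
Proof.
move=> [u0 _ mu]; rewrite le_eqVlt => /predU1P[<- _|s0 Azy].
  by rewrite u0 subrr normr0 mul0r.
set K := `|y|; have K0 : 0 <= K by exact: normr_ge0.
apply/ler_addgt0Pr => eta eta0.
(* Three errors of size [e], and a node up to [e] beyond [s], which costs [e * K]. *)
pose e := Num.min 1 (eta / (3 + K)).
have e0 : 0 < e by rewrite lt_min divr_gt0//; lra.
have e1 : e <= 1 by rewrite ge_min lexx.
have : e <= eta / (3 + K) by rewrite ge_min lexx orbT.
rewrite ler_pdivlMr; last by lra.
move=> e2.
have S0 : 0 < s + 1 by lra.
have [N [t [f [w [sch w0 near]]]]] := mu _ _ S0 e0.
have stp := euler_scheme_steps sch.
have [t0 ti [tN1 tN2] errt _] := sch.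
have [i iN icell] : exists2 i, (i < N)%N & t i < s <= t i.+1.
  by apply: grid_cell; [rewrite t0; lra | lra].
have /andP[ic1 ic2] := icell.
have := euler_steps_near A_acc stp Azy iN.
have : \sum_(l < i.+1) (t l.+1 - t l) * `|f l.+1| <= e.
  apply: le_trans errt.
  apply: (@sum_shift_le _ (fun i => (t i.+1 - t i) * `|f i.+1|) N 0 i.+1) => //.
  by move=> l lN; rewrite mulr_ge0// subr_ge0 ltW//; have [] := ti _ lN.
have [_ tie] := ti _ iN.
have := near _ _ iN icell.
have := ler_distD (w i.+1) (u s) z.
rewrite u0 distrC in w0.
have : (t i.+1 - t 0%N) * K <= (s + e) * K by rewrite ler_wpM2r// t0; lra.
rewrite -/K; lra.
Qed.
End mild_compare.

Section semigroup.
Context (R : realType) (V : completeNormedModType R) (A : V -> set V).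
Hypotheses (A_acc : accretive A) (A_dense : densely_defined A).
Context (T : R -> V -> V).
Hypothesis T_sg : semigroup_of A T.

Lemma semigroup0 v : T 0 v = v.
Proof. by have [] := T_sg v. Qed.

Lemma semigroup_nonexpansive t v w : 0 <= t -> `|T t v - T t w| <= `|v - w|.
Proof.
move=> t0; have := mild_compare A_acc A_dense (T_sg v) (T_sg w) (lexx 0) t0.
by rewrite add0r semigroup0.
Qed.

Lemma semigroupD s t v : 0 <= s -> 0 <= t -> T (s + t) v = T t (T s v).
Proof.
move=> s0 t0; apply/eqP; rewrite -subr_eq0 -normr_le0.
have := mild_compare A_acc A_dense (T_sg v) (T_sg (T s v)) s0 t0.
by rewrite subrr normr0.
Qed.

Lemma semigroup_near_dom t z y : 0 <= t -> A z y -> `|T t z - z| <= t * `|y|.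
Proof. by move=> t0 Azy; exact: mild_near_dom (T_sg z) t0 Azy. Qed.

Lemma semigroup_lipschitz s t z y : 0 <= s -> 0 <= t -> A z y ->
  `|T t z - T s z| <= `|t - s| * `|y|.
Proof.
move=> s0 t0 Azy; wlog st : s t s0 t0 / s <= t.
  by move=> H; have [/H|/ltW/H] := leP s t; [exact | rewrite distrC (distrC s); exact].
have ts : 0 <= t - s by rewrite subr_ge0.
rewrite ger0_norm// -[in T t](subrK s t) semigroupD//.
apply: le_trans (semigroup_nonexpansive _ _ s0) _.
exact: semigroup_near_dom.
Qed.

Lemma semigroup_fix0 t : A 0 0 -> 0 <= t -> T t 0 = 0.
Proof.
move=> A00 t0; apply/eqP; rewrite -normr_le0 -[T t 0]subr0.
by have := semigroup_near_dom t0 A00; rewrite normr0 mulr0.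
Qed.

Lemma max0_lipschitz (s t : R) : `|Num.max t 0 - Num.max s 0| <= `|t - s|.
Proof.
have := ler_norm (t - s); have := ler_norm (s - t); rewrite (distrC s t) => st ts.
have := normr_ge0 (t - s); rewrite ler_norml.
by case: (lerP t 0) => t0; case: (lerP s 0) => s0 ?; apply/andP; split; lra.
Qed.

(** [T] is arbitrary at negative times, so time is clamped at [0]. Trajectories from the domain are
    Lipschitz, and nonexpansiveness carries continuity over to the closure. *)
Lemma semigroup_continuous v : continuous (fun t : R => T (Num.max t 0) v).
Proof.
move=> t; apply/cvgrPdist_lt => /= e e0.
have e4 : 0 < e / 4 by lra.
have [z [y Azy] vz] := op_dom_dense A_dense v e4.
have d0 : 0 < e / (2 * (`|y| + 1)).
  by have := normr_ge0 y; rewrite divr_gt0//; lra.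
near=> s.
have st : `|t - s| < e / (2 * (`|y| + 1)) by near: s; exact: cvgr_dist_lt.
have m0 (r : R) : 0 <= Num.max r 0 by rewrite le_max lexx orbT.
have := semigroup_nonexpansive v z (m0 t).
have := semigroup_nonexpansive v z (m0 s).
have := semigroup_lipschitz (m0 s) (m0 t) Azy.
have := ler_distD (T (Num.max t 0) z) (T (Num.max t 0) v) (T (Num.max s 0) v).
have := ler_distD (T (Num.max s 0) z) (T (Num.max t 0) z) (T (Num.max s 0) v).
rewrite (distrC (T (Num.max s 0) z)).
have : `|Num.max t 0 - Num.max s 0| * `|y| <= e / 2.
  apply: (@le_trans _ _ (`|t - s| * `|y|)); first by rewrite ler_wpM2r// max0_lipschitz.
  move: st; rewrite ltr_pdivlMr; last by have := normr_ge0 y; lra.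
  have := normr_ge0 (t - s); lra.
lra.
Unshelve. all: by end_near. Qed.

End semigroup.

(** * Absolutely continuous functions and Dini derivatives *)

Section real_lemmas.
Context (R : realType).
Local Notation mu := (@lebesgue_measure R).

Lemma sum_itv_le_open (U : set R) (d : R) n (l r : 'I_n -> R) :
  open U -> (mu U < d%:E)%E -> (forall i, l i <= r i) ->
  trivIset setT (fun i => `]l i, r i[%classic) ->
  (forall i, `]l i, r i[ `<=` U) ->
  \sum_(i < n) (r i - l i) < d.
Proof.
move=> oU Ud lr tI sU; rewrite -lte_fin; apply: le_lt_trans Ud.
have mI (i : 'I_n) : measurable (`]l i, r i[%classic : set R) by [].
rewrite [leLHS](_ : _ = mu (\big[setU/set0]_(i < n) `]l i, r i[%classic)).
  apply: le_measure; rewrite ?inE; [exact: bigsetU_measurable|exact: open_measurable|].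
  apply: (big_ind (fun A => A `<=` U)) => //.
  by move=> A B AU BU x [/AU|/BU].
rewrite measure_bigsetU_ord//= -sumEFin; apply: eq_bigr => i _.
rewrite lebesgue_measure_itv/= lte_fin; case: ltP => [//|rl].
by have /eqP -> : r i == l i; [rewrite eq_le rl lr | rewrite subrr].
Qed.

Lemma negligible_open_cover (N : set R) (d : R) : mu.-negligible N -> 0 < d ->
  exists U, [/\ open U, N `<=` U & (mu U < d%:E)%E].
Proof.
move=> [B [mB B0 NB]] d0.
have Boo : (mu B < +oo)%E by rewrite B0 ltry.
have [U [oU BU UB]] := lebesgue_regularity_outer mB Boo d0.
exists U; split => //; first exact: subset_trans NB BU.
have mU : measurable U by exact: open_measurable.
apply: (@le_lt_trans _ _ (mu B + mu (U `\` B))%E).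
  by rewrite -[in leLHS](setDUK BU); apply: measureU2 => //; exact: measurableD.
by apply: le_lt_trans UB; rewrite B0 add0e.
Qed.

Definition interval_variations (U : set R) (m : R -> R) (a s : R) : set R :=
  [set x | exists (n : nat) (l r : 'I_n -> R),
    [/\ forall i, a <= l i /\ l i <= r i /\ r i <= s,
        trivIset setT (fun i => `]l i, r i[%classic),
        forall i, `]l i, r i[ `<=` U &
        x = \sum_(i < n) `|m (r i) - m (l i)| ]].

Lemma interval_variations0 U m a s : interval_variations U m a s 0.
Proof.
exists 0%N, (fun=> 0), (fun=> 0); split; rewrite ?big_ord0//.
all: by case.
Qed.

Lemma interval_variationsS U m a s s' : s <= s' ->
  interval_variations U m a s `<=` interval_variations U m a s'.
Proof.
move=> ss' x [n [l [r [lr tI sU ->]]]]; exists n, l, r; split => // i.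
by have [? [? rs]] := lr i; rewrite (le_trans rs ss').
Qed.

Lemma interval_variations_cons U m a s s' x : a <= s -> s <= s' ->
  `]s, s'[ `<=` U -> interval_variations U m a s x ->
  interval_variations U m a s' (`|m s' - m s| + x).
Proof.
move=> sa ss' sU [n [l [r [lr tI lU ->]]]].
exists n.+1, (fun i => oapp l s (unlift ord0 i)), (fun i => oapp r s' (unlift ord0 i)).
split.
- move=> i; case: unliftP => [j _|_]/=; last by [].
  by have [? [? rs]] := lr j; rewrite (le_trans rs ss').
- apply/trivIsetP => i j _ _; case: unliftP => [i' ->|->]; case: unliftP => [j' ->|->]//=.
  + move=> ij; have := trivIsetP.1 tI i' j' Logic.I Logic.I; apply.
    by apply: contraNneq ij => ->.
  + move=> _; apply/seteqP; split => // y [/=]; rewrite !in_itv/= => /andP[_ yr] /andP[sy _].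
    by have [_ [_]] := lr i'; lra.
  + move=> _; apply/seteqP; split => // y [/=]; rewrite !in_itv/= => /andP[sy _] /andP[_ yr].
    by have [_ [_]] := lr j'; lra.
- by move=> i; case: unliftP => [j _|_]/=; [exact: lU | exact: sU].
- rewrite big_ord_recl unlift_none/=; congr (_ + _).
  by apply: eq_bigr => i _; rewrite liftK.
Qed.

(* The variation of [m] over an open cover [U] of the exceptional set is small
   by absolute continuity; subtracting it from [m], together with a small slope,
   leaves a function which can never increase. *)
Lemma absolutely_continuous_dini_le (m : R -> R) (a b : R) : a <= b ->
  absolutely_continuous (V := R^o) a b m ->
  {ae mu, forall t, a < t < b -> forall e, 0 < e ->
     exists2 d, 0 < d & forall h, 0 < h < d -> m (t + h) - m t <= e * h} ->
  m b <= m a.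
Proof.
rewrite le_eqVlt => /predU1P[-> //|ab] acm aem; apply/ler_addgt0Pr => eps eps0.
(* The slope costs [e * (b - a)] and the variation over [U] at most [e]: together [eps]. *)
pose e := eps / (b - a + 1).
have ba1 : 0 < b - a + 1 by lra.
have e0 : 0 < e by rewrite divr_gt0.
have [d d0 acd] := acm e e0.
pose P t := a < t < b -> forall e, 0 < e ->
     exists2 d, 0 < d & forall h, 0 < h < d -> m (t + h) - m t <= e * h.
(* The Dini bound is assumed in the open interval only; covering [a] too lets the argument start
   there. *)
have negN : mu.-negligible (~` [set t | P t] `|` [set a]).
  by apply: negligibleU => //; exists [set a]; split => //; exact: lebesgue_measure_set1.
have [U [oU NU Ud]] := negligible_open_cover negN d0.
pose E s := interval_variations U m a s.
have Ee s x : s <= b -> E s x -> x <= e.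
  move=> sb [n [l [r [lr tI lU ->]]]]; apply/ltW; apply: acd => //.
    by move=> i; have [? [? rs]] := lr i; rewrite (le_trans rs sb).
  by apply: sum_itv_le_open Ud _ tI lU => // i; have [_ []] := lr i.
have E0 s : E s !=set0 by exists 0; exact: interval_variations0.
have ubE s : s <= b -> has_ubound (E s) by move=> sb; exists e => x; exact: Ee.
have supE s x : s <= b -> E s x -> x <= sup (E s) by move=> sb; exact: (ub_le_sup (ubE _ sb)).
pose phi s := m s - m a - e * (s - a) - sup (E s).
pose S := [set s | a <= s <= b /\ phi s <= 0].
have Sa : S a.
  split; first by rewrite lexx ltW.
  have := supE a 0 (ltW ab) (interval_variations0 _ _ _ _); rewrite /phi; lra.
have hS : has_sup S by split; [exists a | exists b => s [/andP[]]].
set z := sup S.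
have az : a <= z by apply: ub_le_sup => //; case: hS.
have zb : z <= b by apply: ge_sup; [exists a | move=> s [/andP[]]].
(* A single interval in the definition of absolute continuity makes [m] continuous. The terms
   [e * (s - a)] and [sup (E s)] increase with [s] and enter [phi] with a minus sign, so the bound
   passes to the supremum. *)
have Sz : phi z <= 0.
  apply/ler_addgt0Pr => k k0; rewrite add0r.
  have [d' d'0 acd'] := acm k k0.
  have [s [/andP[as_ sb] phis] zs] := sup_adherent d'0 hS.
  have sz : s <= z by apply: ub_le_sup; [case: hS|split; rewrite ?as_].
  have := acd' 1%N (fun=> s) (fun=> z); rewrite !big_ord1.
  move=> /(_ (fun=> conj as_ (conj sz zb))) H.
  have {}H : `|m z - m s| < k.
    apply: H; last by rewrite -/z in zs; lra.
    by apply/trivIsetP => i j _ _; rewrite !ord1.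
  have := ler_norm (m z - m s).
  have : sup (E s) <= sup (E z).
    by apply: ge_sup => // x Ex; apply: supE => //; exact: interval_variationsS Ex.
  have : e * (s - a) <= e * (z - a) by rewrite ler_pM2l// lerD2r.
  by move: phis; rewrite /phi; lra.
suff zb' : z = b.
  move: Sz; rewrite zb' /phi.
  have : sup (E b) <= e by apply: ge_sup => // x; exact: Ee.
  have : e * (b - a) + e = eps by rewrite /e; field; lra.
  lra.
apply/eqP; rewrite eq_le zb/= leNgt; apply/negP => zltb.
suff [s [zs sb phis]] : exists s, [/\ z < s, s <= b & phi s <= phi z].
  have : s <= z by apply: ub_le_sup; [case: hS|split; rewrite ?sb ?andbT; lra].
  by rewrite leNgt zs.
(* Inside [U] the variation grows by at least [|m s - m z|], so [phi] cannot increase; outside [U]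
   the Dini bound with slope [e] holds at [z]. *)
have [Uz|nUz] := pselect (U z).
  move: oU; rewrite openE => /(_ z Uz); rewrite /interior => /nbhs_ballP[r/= r0 rU].
  pose s := Num.min b (z + r).
  have zs : z < s by rewrite lt_min zltb/= ltrDl.
  have sb : s <= b by rewrite ge_min lexx.
  have sr : s <= z + r by rewrite ge_min lexx orbT.
  exists s; split => //.
  have : sup (E z) <= sup (E s) - `|m s - m z|.
    apply: ge_sup => // x Ex; rewrite lerBrDl; apply: supE => //.
    apply: interval_variations_cons => //; first exact: ltW.
    move=> y /=; rewrite in_itv/= => /andP[zy ys]; apply: rU.
    by rewrite /ball/= ltr_norml; lra.
  have := ler_norm (m s - m z).
  have : e * (z - a) <= e * (s - a) by rewrite ler_pM2l// lerD2r ltW.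
  rewrite /phi; lra.
have za : a < z.
  rewrite lt_neqAle az andbT; apply/eqP => za; apply: nUz; apply: NU; right.
  by rewrite /= za.
have : P z by apply: contrapT => nP; apply: nUz; apply: NU; left.
rewrite /P za zltb => /(_ isT e e0)[d' d'0 Hd'].
pose h := Num.min (d' / 2) (b - z).
have h0 : 0 < h by rewrite lt_min divr_gt0//= subr_gt0.
have hd : h < d' by rewrite gt_min; apply/orP; left; lra.
have hb : h <= b - z by rewrite ge_min lexx orbT.
exists (z + h); split; [lra|lra|].
have := Hd' h; rewrite h0 hd => /(_ isT).
have : sup (E z) <= sup (E (z + h)).
  apply: ge_sup => // x Ex; apply: supE; first by lra.
  by apply: interval_variationsS Ex; lra.
rewrite /phi; lra.
Qed.

End real_lemmas.

Section left_dini.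
Context (R : realType).
Local Notation mu := (@lebesgue_measure R).

Lemma negligible_opp (N : set R) : mu.-negligible N ->
  mu.-negligible (-%R @^-1` N).
Proof.
move=> [B [mB B0 NB]]; exists (-%R @^-1` B); split.
- rewrite -[X in measurable X]setTI.
  have mopp : measurable_fun setT (fun t : R => - t) by exact: measurableT_comp.
  exact: (mopp measurableT _ mB).
- by rewrite -B0; exact: lebesgue_measureN.
- by move=> t /= /NB.
Qed.

Lemma absolutely_continuous_left_dini_le (m : R -> R) (a b : R) : a <= b ->
  absolutely_continuous (V := R^o) a b m ->
  {ae mu, forall t, a < t < b -> forall e, 0 < e ->
     exists2 d, 0 < d & forall h, 0 < h < d -> m t - m (t - h) <= e * h} ->
  m b <= m a.
Proof.
move=> ab acm aem; rewrite -lerN2.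
rewrite -[b in leRHS]opprK -[a in leLHS]opprK.
apply: (@absolutely_continuous_dini_le _ (fun r => - m (- r))).
- by rewrite lerN2.
- move=> e e0; have [d d0 Hd] := acm e e0; exists d => // n l r lr tI lt.
  have lr' i : a <= - r i /\ - r i <= - l i /\ - l i <= b.
    by have [? [? ?]] := lr i; rewrite lerNr lerN2 lerNl.
  have tI' : trivIset setT (fun i => `]- r i, - l i[%classic).
    apply/trivIsetP => i j _ _ ij; apply/seteqP; split => // x [/=].
    rewrite !in_itv/= => /andP[x1 x2] /andP[x3 x4].
    have /seteqP[H _] := trivIsetP.1 tI i j Logic.I Logic.I ij.
    by apply: (H (- x)); split; rewrite /= in_itv/= ltrNr ltrNl ?x1 ?x2 ?x3 ?x4.
  have lt' : \sum_(i < n) (- l i - - r i) < d.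
    by apply: le_lt_trans lt; apply: ler_sum => i _; rewrite opprK addrC.
  apply: le_lt_trans (Hd n _ _ lr' tI' lt'); apply: ler_sum => i _.
  by rewrite opprK addrC.
- have := negligible_opp aem; apply: negligibleS => t /= nH H; apply: nH => /andP[at_ tb] e e0.
  have [|d d0 Hd] := H _ e e0; first by rewrite ltrNr tb ltrNl at_.
  by exists d => // h hd; have := Hd h hd; rewrite opprD opprK; lra.
Qed.

End left_dini.

(** * Lipschitz functions with a right derivative *)

Section difference_quotients.
Context (R : realType) (V : normedModType R).
Implicit Types (F : R -> V) (g : V).

(** Without a quotient, these estimates can be added, scaled and passed through norms and
    functionals directly. *)
Definition has_derivative F (t : R) g := forall e : R, 0 < e ->
  exists2 d, 0 < d &
    forall h, `|h| < d -> `|F (t + h) - F t - h *: g| <= e * `|h|.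

Definition has_right_derivative F (t : R) g := forall e : R, 0 < e ->
  exists2 d, 0 < d &
    forall h, 0 < h < d -> `|F (t + h) - F t - h *: g| <= e * h.

Lemma norm_quotient_sub (h : R) (x g : V) : h != 0 ->
  `|x - h *: g| = `|h| * `|h^-1 *: x - g|.
Proof.
by move=> h0; rewrite -normrZ scalerBr scalerA mulfV// scale1r.
Qed.

Lemma has_derivativeP F t g : has_derivative F t g ->
  derivable F t 1 /\ 'D_1 F t = g.
Proof.
move=> Ftg; suff H : h^-1 *: ((F \o shift t) (h *: 1) - F t) @[h --> 0^'] --> g.
  by split; [apply/cvg_ex; exists g | exact/cvg_lim].
apply/cvgrPdist_le => e e0; have [d d0 Hd] := Ftg e e0.
near=> h.
have h0 : h != 0 by near: h; exact: nbhs_dnbhs_neq.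
have hd : `|h| < d by near: h; exact: dnbhs0_lt.
have := Hd h hd.
rewrite norm_quotient_sub// mulrC ler_pM2r ?normr_gt0//.
by rewrite /= [h *: 1]mulr1 (addrC h) distrC.
Unshelve. all: by end_near. Qed.

Lemma derivable_has_derivative F t : derivable F t 1 ->
  has_derivative F t ('D_1 F t).
Proof.
move=> dF e e0; move: dF => /cvg_ex[l Fl].
have -> : 'D_1 F t = l by exact/cvg_lim.
move/cvgrPdist_le : Fl => /(_ e e0); move=> [d /= d0 Hd].
exists d => // h hd; have [->|h0] := eqVneq h 0.
  by rewrite addr0 subrr scale0r subrr !normr0 mulr0.
rewrite norm_quotient_sub// mulrC ler_pM2r ?normr_gt0// distrC.
have := Hd h; rewrite /= sub0r normrN => /(_ hd h0).
by rewrite [h *: 1]mulr1 (addrC h).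
Qed.

Lemma has_right_derivative_quotient F t g :
  h^-1 *: (F (t + h) - F t) @[h --> 0^'+] --> g -> has_right_derivative F t g.
Proof.
move=> /cvgrPdist_le Fg e e0; have := Fg e e0.
move=> [d /= d0 Hd].
exists d => // h /andP[h0 hd].
rewrite norm_quotient_sub ?gt_eqF// mulrC gtr0_norm// ler_pM2r// distrC.
by apply: Hd => //=; rewrite sub0r normrN gtr0_norm.
Qed.

End difference_quotients.

(** * Primitives of bounded functions *)

Section bounded_primitive.
Context (R : realType) (g : R -> R) (K : R).
Hypotheses (mg : measurable_fun setT g) (gK : forall t, `|g t| <= K).
Local Notation mu := (@lebesgue_measure R).

Lemma bounded_integrable_itv (i j : itv_bound R) : (mu [set` Interval i j] < +oo)%E ->
  mu.-integrable [set` Interval i j] (EFin \o g).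
Proof.
move=> fin; apply: measurable_bounded_integrable => //.
  exact: measurable_funTS.
exists K; split; first exact: num_real.
by move=> M KM x _; apply: le_trans (gK x) (ltW KM).
Qed.

Lemma mu_itv_fin (a b : R) (i j : bool) :
  (mu [set` Interval (BSide i a) (BSide j b)] < +oo)%E.
Proof. by rewrite lebesgue_measure_itv/=; case: ifP => // _; rewrite -EFinB ltry. Qed.

Lemma bounded_locally_integrable : locally_integrable setT g.
Proof.
split => //; first exact: openT.
move=> C _ cC; have mC := compact_measurable cC.
apply: (@le_lt_trans _ _ (\int[mu]_(x in C) cst K%:E x)%E).
  apply: ge0_le_integral => //.
  - by apply/measurable_EFinP; apply: measurableT_comp => //; exact: measurable_funTS.
  - by move=> x _; rewrite lee_fin (le_trans _ (gK x)).
rewrite integral_cst// lte_mul_pinfty// ?lee_fin ?(le_trans _ (gK 0))//.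
exact: compact_finite_measure.
Qed.

Definition primitive (a t : R) : R := \int[mu]_(x in `[a, t]) g x.

Lemma primitive_sub a s t : a <= s -> s <= t ->
  primitive a t - primitive a s = \int[mu]_(x in `]s, t]) g x.
Proof.
move=> as_ st; apply: Rintegral_itvB; rewrite ?bnd_simp//.
exact: bounded_integrable_itv (mu_itv_fin _ _ _ _).
Qed.

Lemma primitive_lipschitz a s t : a <= s -> s <= t ->
  `|primitive a t - primitive a s| <= K * (t - s).
Proof.
move=> as_ st; rewrite primitive_sub//.
have ig := bounded_integrable_itv (mu_itv_fin s t false false).
apply: le_trans (le_normr_Rintegral _ ig) _ => //.
apply: (@le_trans _ _ (\int[mu]_(x in `]s, t]) K)).
  apply: le_Rintegral => //.
  - exact: integrable_norm ig.
  - apply: measurable_bounded_integrable => //; first exact: mu_itv_fin.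
    exists K; split; first exact: num_real.
    move=> M KM x _; rewrite ger0_norm; first exact: ltW.
    exact: le_trans (normr_ge0 _) (gK 0).
rewrite Rintegral_cst//= lebesgue_measure_itv/= lte_fin.
case: ltP => //= ts; have -> : t = s by apply/eqP; rewrite eq_le st ts.
by rewrite subrr !mulr0.
Qed.

Lemma primitive_ae a :
  {ae mu, forall t, a < t -> has_derivative (primitive a : R -> R^o) t (g t)}.
Proof.
have ig y : mu.-integrable [set` Interval (BLeft a) (BRight y)] (EFin \o g).
  exact: bounded_integrable_itv (mu_itv_fin _ _ _ _).
have := FTC1 ig bounded_locally_integrable; apply: filterS; first exact: (ae_filter_ringOfSetsType mu).
move=> t H at_.
have [|dF FE] := H; first exact: at_.
by rewrite -FE derive1E; exact: derivable_has_derivative.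
Qed.

Lemma lipschitz_absolutely_continuous (V : normedModType R) (a b L : R) (m : R -> V) :
  (forall s t, a <= s -> s <= t -> t <= b -> `|m t - m s| <= L * (t - s)) ->
  absolutely_continuous a b m.
Proof.
move=> mL e e0; pose L' := `|L| + 1.
have L'0 : 0 < L' by have := normr_ge0 L; rewrite /L'; lra.
exists (e / L'); first exact: divr_gt0.
move=> n l r lr _; rewrite ltr_pdivlMr// => /le_lt_trans; apply => //.
rewrite mulrC mulr_sumr; apply: ler_sum => i _; have [al [lr' rb]] := lr i.
apply: le_trans (mL _ _ al lr' rb) _; rewrite ler_wpM2r ?subr_ge0//.
by have := ler_norm L; rewrite /L'; lra.
Qed.

(** The Dini bound on [m] holds everywhere, but the primitive of [g] has derivative [g] only almost
    everywhere; their difference is covered by a monotonicity criterion that tolerates a null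
    set. *)
Lemma dini_le_integral (m : R -> R) (a b L : R) : a <= b ->
  (forall s t, a <= s -> s <= t -> t <= b -> `|m t - m s| <= L * (t - s)) ->
  (forall t, a < t < b -> forall e, 0 < e -> exists2 d, 0 < d &
     forall h, 0 < h < d -> m (t + h) - m t <= (g t + e) * h) ->
  m b - m a <= \int[mu]_(x in `[a, b]) g x.
Proof.
move=> ab mL md; pose q t := m t - primitive a t.
have qa : q a = m a by rewrite /q /primitive set_itv1 Rintegral_set1 subr0.
suff : q b <= q a by rewrite qa /q /primitive; lra.
apply: absolutely_continuous_dini_le => //.
  apply: (@lipschitz_absolutely_continuous _ _ _ (L + K)) => s t as_ st tb.
  have := mL _ _ as_ st tb; have := primitive_lipschitz as_ st.
  rewrite mulrDl; have := ler_normB (m t - m s) (primitive a t - primitive a s).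
  by rewrite (_ : m t - _ - _ = q t - q s); [lra | rewrite /q; ring].
have := primitive_ae a; apply: filterS; first exact: (ae_filter_ringOfSetsType mu).
move=> t dP /andP[at_ tb] e e0.
have e2 : 0 < e / 2 by lra.
have [d1 d10 H1] := dP at_ _ e2.
have [|d2 d20 H2] := md t _ _ e2; first by rewrite at_.
exists (Num.min d1 d2); first by rewrite lt_min d10.
move=> h /andP[h0]; rewrite lt_min => /andP[hd1 hd2].
have := H1 h; rewrite gtr0_norm// => /(_ hd1).
have := H2 h; rewrite h0 hd2 => /(_ isT).
rewrite ler_norml => H3 /andP[H4 _]; have {}H4 : - (e / 2 * h) <= primitive a (t + h) - primitive a t - h * g t := H4.
rewrite /q; lra.
Qed.

End bounded_primitive.

Lemma separable_dense_seq (R : realType) (V : normedModType R) : separable V ->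
  exists u : nat -> V, forall v (e : R), 0 < e -> exists n, `|v - u n| < e.
Proof.
move=> [D cD dD].
have DV v (e : R) : 0 < e -> exists2 z, D z & `|v - z| < e.
  move=> e0; have [||z [vz Dz]] := dD (ball v e); last first.
  - by exists z => //; move: vz; rewrite -ball_normE.
  - exact: ball_open.
  - by exists v; exact: ballxx.
have [z0 Dz0 _] := DV 0 1 ltr01.
have /pcard_surjP[u uD] := cD.
exists u => v e /DV-/(_ v)[z Dz vz]; have [n _ un] := uD _ Dz.
by exists n; rewrite un.
Qed.

Lemma lipschitz_continuous (R : realType) (V : normedModType R) (F : R -> V) (L : R) :
  (forall s t, `|F t - F s| <= L * `|t - s|) -> continuous F.
Proof.
move=> FL t; apply/cvgrPdist_lt => e e0; have L0 : 0 < `|L| + 1 by have := normr_ge0 L; lra.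
near=> s; have ts : `|t - s| < e / (`|L| + 1).
  by near: s; apply: cvgr_dist_lt => //; rewrite divr_gt0.
apply: le_lt_trans (FL _ _) _; move: ts; rewrite ltr_pdivlMr//; apply: le_lt_trans.
by rewrite mulrC ler_wpM2l//; have := ler_norm L; lra.
Unshelve. all: by end_near. Qed.

Section lipschitz_right_derivative.
Context (R : realType) (V : normedModType R) (F G : R -> V) (L : R).
Hypothesis FL : forall s t, `|F t - F s| <= L * `|t - s|.
Hypothesis FG : forall t, has_right_derivative F t (G t).
Local Notation mu := (@lebesgue_measure R).

Lemma right_derivative_bound t : `|G t| <= L.
Proof.
apply/ler_addgt0Pr => e e0; have [d d0 /(_ (d / 2))] := FG t e0.
have d2 : 0 < d / 2 by lra.
have -> : 0 < d / 2 < d by lra.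
move=> /(_ isT) H; have := FL t (t + d / 2).
rewrite addrAC subrr add0r gtr0_norm// => H'.
rewrite -(ler_pM2l d2) -[X in X * `|_|]gtr0_norm// -normrZ.
have := ler_distD (F (t + d / 2) - F t) ((d / 2) *: G t) 0.
rewrite !subr0 distrC.
move: (`|(d / 2) *: _|) (`|_ - _ - _|) H (`|_ - _|) H' => x y Hy z Hz; lra.
Qed.

(** A pointwise limit of continuous difference quotients. Integrating these real functions takes the
    place of a vector-valued integral of [G]. *)
Lemma measurable_right_derivative v : measurable_fun setT (fun t => `|G t - v|).
Proof.
apply: (@measurable_fun_cvg _ _ R setT
  (fun (n : nat) (t : R) => `|n.+1%:R *: (F (t + n.+1%:R^-1) - F t) - v|)
  (fun t => `|G t - v|)).
  move=> n; have Fc := lipschitz_continuous FL.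
  have Fnc : continuous (fun t : R => F (t + n.+1%:R^-1)).
    apply: (@lipschitz_continuous _ _ _ L) => s t; rewrite (le_trans (FL _ _))//.
    by rewrite opprD addrACA subrr addr0.
  apply: continuous_measurable_fun => t; apply: cvg_norm.
  by apply: cvgB; [apply: cvgZr; apply: cvgB; [exact: Fnc|exact: Fc]|exact: cvg_cst].
move=> t _; apply: cvg_norm; apply: cvgB; last exact: cvg_cst.
apply/cvgrPdist_le => e e0; have [d d0 Hd] := FG t e0.
near=> n.
have h0 : 0 < (n.+1%:R : R)^-1 by rewrite invr_gt0 ltr0n.
have := Hd n.+1%:R^-1; rewrite h0.
have -> : n.+1%:R^-1 < d by near: n; exact: near_infty_natSinv_lt (PosNum d0).
move=> /(_ isT); rewrite norm_quotient_sub ?gt_eqF// invrK mulrC gtr0_norm//.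
by rewrite ler_pM2r// distrC.
Unshelve. all: by end_near. Qed.

Lemma right_derivative_dist_bound v t : `| `|G t - v| | <= L + `|v|.
Proof.
by rewrite normr_id (le_trans (ler_normB _ _))// lerD2r right_derivative_bound.
Qed.

(** The real function [m] starts at [0], and its upper right Dini derivative is at most
    [|G t - v|]. *)
Lemma lipschitz_increment_le v a b : a <= b ->
  `|F b - F a - (b - a) *: v| <= \int[mu]_(s in `[a, b]) `|G s - v|.
Proof.
move=> ab; pose m t := `|F t - F a - (t - a) *: v|.
have ma : m a = 0 by rewrite /m !subrr scale0r subr0 normr0.
rewrite -[leLHS]/(m b) -[m b]subr0 -ma.
apply: (dini_le_integral (measurable_right_derivative v)
  (right_derivative_dist_bound v) (L := L + `|v|)) => //.
  move=> s t _ st _; apply: le_trans (ler_dist_dist _ _) _.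
  rewrite (_ : _ - _ - _ = (F t - F s) - (t - s) *: v); last by lincomb R V; ring.
  rewrite (le_trans (ler_normB _ _))// normrZ mulrDl lerD//.
    by rewrite (le_trans (FL _ _))// ger0_norm// subr_ge0.
  by rewrite mulrC ger0_norm// subr_ge0.
move=> t _ e e0; have [d d0 Hd] := FG t e0; exists d => // h hd.
have := Hd h hd; have /andP[h0 _] := hd.
have -> : F (t + h) - F t - h *: G t = (F (t + h) - F a - (t + h - a) *: v)
   - (F t - F a - (t - a) *: v) - h *: (G t - v) by lincomb R V; ring.
rewrite /m; set x := F (t + h) - _ - _; set y := F t - _ - _; set z := _ *: (_ - _).
have := ler_distD (x - y) x y.
have : `|x - y| <= `|x - y - z| + `|z| by rewrite -[in leLHS](subrK z (x - y)) ler_normD.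
have -> : `|z| = `|G t - v| * h by rewrite normrZ gtr0_norm// mulrC.
have := ler_norm (`|x| - `|y|); have := ler_dist_dist x y.
rewrite mulrDl; lra.
Qed.

Lemma ae_has_derivative a : separable V ->
  {ae mu, forall t, a < t -> has_derivative F t (G t)}.
Proof.
move=> /separable_dense_seq[u u_dense].
have H n := primitive_ae (measurable_right_derivative (u n))
  (right_derivative_dist_bound (u n)) a.
have {}H : {ae mu, forall t, forall n, a < t ->
    has_derivative (primitive (fun s => `|G s - u n|) a : R -> R^o) t `|G t - u n|}.
  exact: ae_foralln H.
move: H; apply: filterS; first exact: (ae_filter_ringOfSetsType mu).
move=> t H at_ e e0.
have e4 : 0 < e / 4 by lra.
have [n un] := u_dense (G t) _ e4.
have [d d0 Hd] := H n at_ _ e4.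
(* This bound ignores on which end of the interval [t] lies. Used on [[t, t + h]] and on
   [[t + h, t]], it turns the right derivative into a two-sided one. *)
have key s r : a <= s -> s <= r ->
    `|F r - F s - (r - s) *: u n| <=
    primitive (fun s => `|G s - u n|) a r - primitive (fun s => `|G s - u n|) a s.
  move=> as_ sr; rewrite (primitive_sub (measurable_right_derivative (u n))
    (right_derivative_dist_bound (u n)))//.
  rewrite Rintegral_itv_obnd_cbnd; first exact: lipschitz_increment_le.
  exact: (bounded_integrable_itv (measurable_right_derivative (u n))
    (right_derivative_dist_bound (u n)) (mu_itv_fin _ _ _ _)).
exists (Num.min d (t - a)); first by rewrite lt_min d0 subr_gt0.
move=> h; rewrite lt_min => /andP[hd hta].
have {}Hd : `|primitive (fun s => `|G s - u n|) a (t + h) -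
    primitive (fun s => `|G s - u n|) a t - h * `|G t - u n| | <= e / 4 * `|h| := Hd h hd.
have : `|F (t + h) - F t - h *: G t| <= `|F (t + h) - F t - h *: u n| + `|h| * `|G t - u n|.
  rewrite (_ : F (t + h) - F t - h *: G t =
    F (t + h) - F t - h *: u n - h *: (G t - u n)); last by lincomb R V; ring.
  by rewrite -normrZ ler_normB.
have : `|h| * `|G t - u n| <= `|h| * (e / 4) by rewrite ler_wpM2l// ltW.
move: Hd; rewrite ler_norml => /andP[Hd1 Hd2].
have [h0|h0] := leP 0 h.
  rewrite ger0_norm// in hta Hd1 Hd2 *.
  have := key t (t + h) (ltW at_); rewrite lerDl => /(_ h0).
  rewrite (_ : t + h - t = h); last by ring.
  lra.
rewrite ltr0_norm// in hta Hd1 Hd2 *.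
have := key (t + h) t; rewrite gerDl (ltW h0) => /(_ _ isT).
have -> : a <= t + h by lra.
move=> /(_ isT); rewrite -normrN.
rewrite (_ : - (F t - F (t + h) - (t - (t + h)) *: u n) =
  F (t + h) - F t - h *: u n); last by lincomb R V; ring.
lra.
Qed.

End lipschitz_right_derivative.

Lemma lipschitz_integral_right_derivative (R : realType) (F G : R -> R) (L a b : R) :
  (forall s t, `|F t - F s| <= L * `|t - s|) ->
  (forall t, has_right_derivative (F : R -> R^o) t (G t)) -> a <= b ->
  F b - F a = \int[@lebesgue_measure R]_(s in `[a, b]) G s.
Proof.
move=> FL FG ab.
have GL := right_derivative_bound (V := R^o) FL FG.
have mG : measurable_fun setT G.
  (* Since [|G| <= L], adding [L] removes the absolute value, so measurability of the distances is
     enough. *)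
  rewrite (_ : G = (fun t => `|G t - (- L)| - L)); last first.
    apply/funext => t; have := GL t; rewrite ler_norml => /andP[Gl _].
    by rewrite opprK ger0_norm ?addrK//; lra.
  by apply: measurable_funB => //; exact: (measurable_right_derivative (V := R^o) FL FG).
have ig : (@lebesgue_measure R).-integrable `[a, b] (EFin \o G).
  exact: (bounded_integrable_itv mG GL (mu_itv_fin _ _ _ _)).
have L_itv (m : R -> R) : (forall s t, `|m t - m s| <= L * `|t - s|) ->
    forall s t, a <= s -> s <= t -> t <= b -> `|m t - m s| <= L * (t - s).
  move=> mL s t _ st _; apply: le_trans (mL _ _) _.
  by rewrite ger0_norm ?subr_ge0.
have FG' t e : 0 < e -> exists2 d, 0 < d &
    forall h, 0 < h < d -> `|F (t + h) - F t - h * G t| <= e * h.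
  exact: FG.
apply/eqP; rewrite eq_le; apply/andP; split.
  apply: (dini_le_integral mG GL ab (L_itv _ FL)) => t _ e e0.
  have [d d0 Hd] := FG' t e e0; exists d => // h /Hd; rewrite ler_norml; lra.
rewrite -lerN2 -[leRHS]mulN1r -RintegralZl//.
have -> : - (F b - F a) = (- F b) - (- F a) by ring.
under eq_Rintegral do rewrite mulN1r.
apply: (@dini_le_integral _ (fun t => - G t) L _ _ (fun t => - F t) a b L) => //.
- exact: measurableT_comp.
- by move=> t; rewrite normrN.
- by apply: L_itv => s t; rewrite -opprD normrN.
- move=> t _ e e0; have [d d0 Hd] := FG' t e e0.
  by exists d => // h /Hd; rewrite ler_norml; lra.
Qed.

(** * Trajectories of the semigroup *)

Section dual.
Context (R : realType) (V : normedModType R).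

Lemma dual_bounded (Psi : {linear V -> R^o}) : dual Psi ->
  exists2 C : R, 0 < C & forall v, `|Psi v : R| <= C * `|v|.
Proof.
move=> cPsi.
have /linear_boundedP/pinfty_ex_gt0[C C0 HC] := continuous_linear_bounded 0 (cPsi 0).
by exists C.
Qed.
End dual.

Section trajectories.
Context (R : realType) (V : completeNormedModType R) (A : V -> set V).
Hypotheses (A_acc : accretive A) (A_dense : densely_defined A).
Context (T : R -> V -> V) (Ao : V -> V).
Hypothesis T_sg : semigroup_of A T.
Hypothesis T_dom : domain_invariant A T.
Hypothesis Ao_gen : infinitesimal_generator A T Ao.
Local Notation mu := (@lebesgue_measure R).

Let TD := semigroupD A_acc A_dense T_sg.

Lemma generator_right_derivative t v : 0 < t ->
  has_right_derivative (T ^~ v) t (- Ao (T t v)).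
Proof.
move=> t0; apply: has_right_derivative_quotient.
have [/(_ _ (T_dom v t0))[cA _] _] := Ao_gen.
have : - - (h^-1 *: (T h (T t v) - T t v)) @[h --> 0^'+] --> - Ao (T t v).
  apply: cvgN; exact: cA.
apply: cvg_trans; apply: near_eq_cvg; near=> h.
have h0 : 0 < h by near: h; exact: nbhs_right_gt.
by rewrite /= opprK TD// ltW.
Unshelve. all: by end_near. Qed.

(** [v] may lie outside the domain, but [T c v] does not; freezing the trajectory before time [c]
    makes it globally Lipschitz, with the norm of an element of [A (T c v)] as constant. *)
Lemma stopped_trajectory_lipschitz c v : 0 < c -> exists L : R, forall s t : R,
  `|T (Num.max t c) v - T (Num.max s c) v| <= L * `|t - s|.
Proof.
move=> c0; have [y Ay] := T_dom v c0; exists `|y| => s t.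
have E r : T (Num.max r c) v = T (Num.max r c - c) (T c v).
  by rewrite -TD ?subr_ge0 ?le_max ?lexx ?orbT ?ltW// addrC subrK.
rewrite !E; apply: le_trans (semigroup_lipschitz A_acc A_dense T_sg _ _ Ay) _.
- by rewrite subr_ge0 le_max lexx orbT.
- by rewrite subr_ge0 le_max lexx orbT.
rewrite mulrC ler_wpM2l//.
have M r : Num.max r c - c = Num.max (r - c) 0.
  by case: (lerP r c) => rc; [rewrite max_r | rewrite max_l]; lra.
rewrite !M.
by rewrite (le_trans (max0_lipschitz _ _))// opprB addrA subrK.
Qed.

Lemma stopped_trajectory_right_derivative c v t : 0 < c ->
  has_right_derivative (fun s : R => T (Num.max s c) v) t
    (if t < c then 0 else - Ao (T t v)).
Proof.
move=> c0 e e0; have [tc|ct] := ltP t c.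
  exists (c - t) => [|h /andP[h0 hc]]; first by rewrite subr_gt0.
  rewrite max_r; last by lra.
  by rewrite subrr scaler0 subr0 normr0 mulr_ge0// ltW.
have [d d0 Hd] := generator_right_derivative v (lt_le_trans c0 ct) e0.
exists d => // h /[dup] /andP[h0 _] /Hd.
by rewrite /= !max_l//; lra.
Qed.

Lemma trajectory_ae_derivative v s : separable V ->
  {ae mu, forall t, s < t ->
     has_derivative (fun t => T (t - s) v) t (- Ao (T (t - s) v))}.
Proof.
move=> sepV.
have H c : 0 < c -> {ae mu, forall t, s + c < t ->
    has_derivative (fun t => T (t - s) v) t (- Ao (T (t - s) v))}.
  move=> c0; have [L HL] := stopped_trajectory_lipschitz v c0.
  have FL (r t : R) : `|T (Num.max (t - s) c) v - T (Num.max (r - s) c) v|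
      <= L * `|t - r|.
    by rewrite (le_trans (HL _ _))// opprB addrA subrK.
  have FG (t : R) : has_right_derivative (fun t => T (Num.max (t - s) c) v) t
      (if t - s < c then 0 else - Ao (T (t - s) v)).
    move=> e e0.
    have [d d0 Hd] := stopped_trajectory_right_derivative v (t - s) c0 e0.
    by exists d => // h /Hd; rewrite (addrAC t).
  have := ae_has_derivative FL FG (s + c) sepV.
  apply: filterS; first exact: (ae_filter_ringOfSetsType mu).
  move=> t H ct e e0; have [d d0 Hd] := H ct e e0.
  exists (Num.min d (t - (s + c))); first by rewrite lt_min d0 subr_gt0.
  move=> h; rewrite lt_min => /andP[/Hd].
  have -> : (t - s < c) = false by apply/negbTE; rewrite -leNgt; lra.
  rewrite ltr_norml => + /andP[h1 h2].
  by rewrite /= !max_l//; lra.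
(* The null set depends on [c]; a sequence of values of [c] tending to [0] exhausts all [t > s]. *)
have {}H (n : nat) : {ae mu, forall t, s + n.+1%:R^-1 < t ->
    has_derivative (fun t => T (t - s) v) t (- Ao (T (t - s) v))}.
  by apply: H; rewrite invr_gt0 ltr0n.
have {}H : {ae mu, forall t, forall n : nat, s + n.+1%:R^-1 < t ->
    has_derivative (fun t => T (t - s) v) t (- Ao (T (t - s) v))}
  by exact: ae_foralln H.
move: H; apply: filterS; first exact: (ae_filter_ringOfSetsType mu).
move=> t H st; have t0 : 0 < t - s by rewrite subr_gt0.
have [n /= _ nt] := near_infty_natSinv_lt (PosNum t0).
by apply: (H n); rewrite -ltrBrDl; exact: (nt n (leqnn n)).
Qed.

Lemma trajectory_W11 v s a b : separable V -> s < a ->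
  W11 a b (fun t => T (t - s) v).
Proof.
move=> sepV sa; have as0 : 0 < a - s by lra.
have [L HL] := stopped_trajectory_lipschitz v as0.
split.
  apply: (@lipschitz_absolutely_continuous _ _ _ _ L) => r t ar rt tb.
  have := HL (r - s) (t - s).
  have -> : Num.max (t - s) (a - s) = t - s by rewrite max_l; lra.
  have -> : Num.max (r - s) (a - s) = r - s by rewrite max_l; lra.
  by rewrite (_ : t - s - (r - s) = t - r) ?[`|t - r|]ger0_norm ?subr_ge0//; ring.
have := trajectory_ae_derivative v s sepV.
apply: filterS; first exact: (ae_filter_ringOfSetsType mu).
by move=> t H /andP[at_ _]; have /has_derivativeP[] := H (lt_trans sa at_).
Qed.

Lemma trajectory_dual_integral v (Psi : {linear V -> R^o}) s a b : dual Psi ->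
  s < a -> a <= b ->
  Psi (T (a - s) v) - Psi (T (b - s) v) =
  \int[mu]_(r in `[a, b]) (Psi (Ao (T (r - s) v)) : R).
Proof.
move=> cPsi sa ab; have a0 : 0 < a - s by lra.
have [C C0 HC] := dual_bounded cPsi.
have [L HL] := stopped_trajectory_lipschitz v a0.
pose F (t : R) : R := - Psi (T (Num.max (t - s) (a - s)) v).
pose G (t : R) : R := - Psi (if t - s < a - s then 0 else - Ao (T (t - s) v)).
have FL r t : `|F t - F r| <= C * L * `|t - r|.
  rewrite /F -opprD normrN -linearB (le_trans (HC _))//.
  rewrite -mulrA ler_pM2l// (le_trans (HL _ _))//.
  by rewrite opprB addrA subrK.
have FG t : has_right_derivative (F : R -> R^o) t (G t).
  move=> e e0; have eC : 0 < e / C by rewrite divr_gt0.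
  have [d d0 Hd] := stopped_trajectory_right_derivative v (t - s) a0 eC.
  exists d => // h /Hd; rewrite (addrAC t (- s)); set x := T (Num.max (t + h - s) _) _ - _ - _ => xh.
  rewrite (_ : _ - _ - _ = - Psi x); last first.
    have PsiE y z w : Psi (y - z - h *: w) = (Psi y : R) - Psi z - h * Psi w.
      by rewrite !linearB linearZ.
    by rewrite /x PsiE -[h *: G t]/(h * G t) /F /G; ring.
  rewrite normrN.
  apply: le_trans (HC _) _.
  by rewrite mulrC -ler_pdivlMr// mulrAC.
have := lipschitz_integral_right_derivative FL FG ab.
rewrite /F !max_l ?lerD2r// opprK addrC => ->; apply: eq_Rintegral => r.
by rewrite inE/= in_itv/= /G ltrD2r => /andP[ar _]; rewrite ltNge ar/= linearN opprK.
Qed.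

End trajectories.

(** * Borel measurability in separable normed spaces *)

Section borel_measurability.
Context (R : realType) (V : normedModType R).
Context d (X : measurableType d).
Implicit Types (f : X -> V) (D : set X).

Lemma measurable_lt_cst D (g : X -> R) (r : R) : measurable D ->
  measurable_fun D g -> measurable (D `&` [set x | g x < r]).
Proof.
move=> mD mg; have := mg mD `]-oo, r[%classic (measurable_itv _).
by congr (measurable (_ `&` _)); apply/seteqP; split => x /=; rewrite in_itv.
Qed.

Lemma continuous_measurable_borel D f (g : V -> R) : continuous g ->
  measurable_fun D (f : X -> borel V) -> measurable_fun D (fun x => g (f x)).
Proof.
move=> cg mf mD; apply: (measurability _ (RGenOInfty.measurableE R)) => //.
move=> /= _ [_ [r ->] <-].
have mo : measurable (g @^-1` `]r, +oo[%classic : set (borel V)).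
  by apply: sub_sigma_algebra; apply: open_comp => // ? _; exact: cg.
exact: (mf mD _ mo).
Qed.

Lemma measurable_borel_dist D f v :
  measurable_fun D (f : X -> borel V) -> measurable_fun D (fun x => `|f x - v|).
Proof.
apply: (continuous_measurable_borel (g := fun w => `|w - v|)) => w.
by apply: cvg_norm; apply: cvgB; [exact: cvg_id | exact: cvg_cst].
Qed.

Variable u : nat -> V.
Hypothesis u_dense : forall v (e : R), 0 < e -> exists n, `|v - u n| < e.

Lemma open_bigcup_balls (U : set V) : open U ->
  U = \bigcup_(p in [set p : nat * nat | ball (u p.1) p.2.+1%:R^-1 `<=` U])
        ball (u p.1) p.2.+1%:R^-1.
Proof.
move=> oU; apply/seteqP; split => [v Uv|v [p pU]]; last exact: pU.
move: oU; rewrite openE => /(_ v Uv)/nbhs_ballP[r /= r0 rU].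
have r2 : 0 < r / 2 by rewrite divr_gt0.
have [k /= _ /(_ k (leqnn k)) /= kr] := near_infty_natSinv_lt (PosNum r2).
have [n vn] : exists n, `|v - u n| < k.+1%:R^-1 by apply: u_dense; rewrite invr_gt0.
exists (n, k) => /=; last by rewrite -ball_normE/= distrC.
move=> w; rewrite -ball_normE /= => wn; apply: rU; rewrite -ball_normE/=.
apply: le_lt_trans (ler_distD (u n) _ _) _.
by move: (k.+1%:R^-1 : R) kr vn wn => c kr vn wn; lra.
Qed.

(** Every open set is a countable union of balls around the [u n], so countably many real functions
    decide Borel measurability. *)
Lemma measurable_borelP D f :
  (forall n, measurable_fun D (fun x => `|f x - u n|)) ->
  measurable_fun D (f : X -> borel V).
Proof.
move=> mf mD; apply: (@measurability _ _ _ (borel V) D f (@open V)) => //.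
move=> _ [U oU <-].
rewrite (open_bigcup_balls oU) preimage_bigcup setI_bigcupr bigcup_mkcond.
apply: countable_bigcupT_measurable => [|[n k]]; first exact: countableP.
case: ifP => // _; have := measurable_lt_cst k.+1%:R^-1 mD (mf n).
congr (measurable (_ `&` _)); apply/seteqP.
by split => x /=; rewrite -ball_normE/= distrC.
Qed.

Lemma dense_index_exists (k : nat) v : exists n, `|v - u n| < k.+1%:R^-1.
Proof. by apply: u_dense; rewrite invr_gt0 ltr0n. Qed.

(** Taking the least admissible index makes the selection of a nearby [u n] measurable. *)
Definition dense_index k v := ex_minn (dense_index_exists k v).

Lemma dense_index_lt k v : `|v - u (dense_index k v)| < k.+1%:R^-1.
Proof. by rewrite /dense_index; case: ex_minnP. Qed.

Lemma measurable_dense_index D f k n : measurable D ->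
  measurable_fun D (f : X -> borel V) ->
  measurable (D `&` [set x | dense_index k (f x) = n]).
Proof.
move=> mD mf.
rewrite (_ : _ `&` _ = (D `&` [set x | `|f x - u n| < k.+1%:R^-1]) `\`
    \bigcup_(i in `I_n) (D `&` [set x | `|f x - u i| < k.+1%:R^-1])).
  apply: measurableD; last apply: bigcup_measurable => i _;
    by apply: measurable_lt_cst => //; exact: measurable_borel_dist.
apply/seteqP; split => x /=.
  rewrite /dense_index; case: ex_minnP => m xm min [Dx mn]; split.
    by split => //; rewrite -mn.
  move=> [i /= ni [_ xi]]; have := min _ xi.
  by rewrite mn leqNgt ni.
move=> [[Dx xn] nx]; split => //; rewrite /dense_index; case: ex_minnP => m xm min.
apply/eqP; rewrite eqn_leq min//= leqNgt; apply/negP => mn.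
by apply: nx; exists m.
Qed.

Lemma measurable_dense_approx D f k : measurable D ->
  measurable_fun D (f : X -> borel V) ->
  measurable_fun D ((fun x => u (dense_index k (f x))) : X -> borel V).
Proof.
move=> mD mf _ B mB; rewrite (_ : _ `&` _ =
  \bigcup_(i in [set i | B (u i)]) (D `&` [set x | dense_index k (f x) = i])).
  by apply: bigcup_measurable => i _; exact: measurable_dense_index.
apply/seteqP; split => x /=; first by move=> [Dx Bx]; exists (dense_index k (f x)).
by move=> [i /= Bi [Dx xi]]; rewrite xi.
Qed.

(** [f] is rounded to the dense sequence: on each of countably many measurable pieces the
    composition is some [phi (u i)], and the Lipschitz bound in [v] gives pointwise convergence.
    Sums, multiples and the semigroup are all treated as instances. *)
Lemma measurable_caratheodory D f (phi : V -> X -> V) (C : X -> R) :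
  measurable D -> measurable_fun D (f : X -> borel V) ->
  (forall n, measurable_fun D (phi (u n) : X -> borel V)) ->
  (forall v w x, `|phi v x - phi w x| <= C x * `|v - w|) ->
  measurable_fun D ((fun x => phi (f x) x) : X -> borel V).
Proof.
move=> mD mf mphi phiC; apply: measurable_borelP => n.
pose g (k : nat) (x : X) : R := `|phi (u (dense_index k (f x))) x - u n|.
apply: (@measurable_fun_cvg _ _ R D g).
  move=> k mD' B mB; rewrite (_ : _ `&` _ =
    \bigcup_i ((D `&` [set x | dense_index k (f x) = i]) `&`
      (D `&` (fun x => `|phi (u i) x - u n|) @^-1` B))).
    apply: bigcup_measurable => i _; apply: measurableI.
      exact: measurable_dense_index.
    exact: (measurable_borel_dist (u n) (mphi i)).
  apply/seteqP; split => x /=.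
    by move=> [Dx Bx]; exists (dense_index k (f x)).
  by move=> [i _ [[Dx <-] [_ Bx]]].
move=> x Dx; apply/cvgrPdist_le => e e0.
have C1 : 0 < `|C x| + 1 by have := normr_ge0 (C x); lra.
have eC : 0 < e / (`|C x| + 1) by rewrite divr_gt0.
near=> k.
rewrite (le_trans (ler_dist_dist _ _))// opprB addrA subrK.
rewrite (le_trans (phiC _ _ _))//.
apply: (@le_trans _ _ ((`|C x| + 1) * k.+1%:R^-1)).
  apply: (@le_trans _ _ ((`|C x| + 1) * `|f x - u (dense_index k (f x))|)).
    by rewrite ler_wpM2r//; have := ler_norm (C x); lra.
  by rewrite ler_pM2l//; exact/ltW/dense_index_lt.
rewrite -ler_pdivlMl// mulrC; apply: ltW.
by near: k; exact: near_infty_natSinv_lt (PosNum eC).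
Unshelve. all: by end_near. Qed.

End borel_measurability.

Section borel_measurability_separable.
Context (R : realType) (V : completeNormedModType R) (sepV : separable V).
Context d (X : measurableType d).
Implicit Types (f g : X -> V) (D : set X).

Lemma measurable_borel_cst D v : measurable_fun D ((fun=> v) : X -> borel V).
Proof. exact: measurable_cst. Qed.

Lemma measurable_borelD D f g : measurable D ->
  measurable_fun D (f : X -> borel V) -> measurable_fun D (g : X -> borel V) ->
  measurable_fun D ((fun x => f x + g x) : X -> borel V).
Proof.
have [u u_dense] := separable_dense_seq sepV => mD mf mg.
apply: (measurable_caratheodory u_dense (phi := fun v x => v + g x) (C := fun=> 1)) => //.
  move=> n; apply: (measurable_borelP u_dense) => m.
  under eq_fun do rewrite addrAC addrC.
  rewrite (_ : (fun x => _) = (fun x => `|g x - (u m - u n)|)).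
    exact: measurable_borel_dist.
  by apply/funext => x; rewrite opprB.
by move=> v w x; rewrite mul1r opprD addrACA subrr addr0.
Qed.

Lemma measurable_borelZ D (c : X -> R) f : measurable D ->
  measurable_fun D c -> measurable_fun D (f : X -> borel V) ->
  measurable_fun D ((fun x => c x *: f x) : X -> borel V).
Proof.
have [u u_dense] := separable_dense_seq sepV => mD mc mf.
apply: (measurable_caratheodory u_dense (phi := fun v x => c x *: v) (C := fun x => `|c x|)) => //.
  move=> n; apply: (measurable_borelP u_dense) => m.
  apply: (@measurableT_comp _ _ _ _ _ _ (fun r : R => `|r *: u n - u m|)) => //.
  apply: continuous_measurable_fun => t; apply: cvg_norm; apply: cvgB; last exact: cvg_cst.
  by apply: cvgZl; exact: cvg_id.
by move=> v w x; rewrite -scalerBr normrZ.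
Qed.

Lemma measurable_borelB D f g : measurable D ->
  measurable_fun D (f : X -> borel V) -> measurable_fun D (g : X -> borel V) ->
  measurable_fun D ((fun x => f x - g x) : X -> borel V).
Proof.
move=> mD mf mg; rewrite (_ : (fun x => _) = (fun x => f x + (- 1) *: g x)).
  by apply: measurable_borelD => //; apply: measurable_borelZ => //; exact: measurable_cst.
by apply/funext => x; rewrite scaleN1r.
Qed.

Lemma measurable_borel_sum D (F : nat -> X -> V) n : measurable D ->
  (forall k, measurable_fun D (F k : X -> borel V)) ->
  measurable_fun D ((fun x => \sum_(0 <= k < n) F k x) : X -> borel V).
Proof.
move=> mD mF; elim: n => [|n IH].
  by under eq_fun do rewrite big_geq//; exact: measurable_borel_cst.
by under eq_fun do rewrite big_nat_recr//=; exact: measurable_borelD.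
Qed.

Lemma cvg_seq_cauchyP (s : nat -> V) : cvgn s <->
  forall k : nat, exists n : nat, forall m : nat, (n <= m)%N -> `|s m - s n| < k.+1%:R^-1.
Proof.
split => [cs k|H].
  have k0 : 0 < (k.+1%:R^-1 : R) / 2 by rewrite divr_gt0.
  move/cvgrPdist_lt : cs => /(_ _ k0)[n _ Hn]; exists n => m nm.
  rewrite (le_lt_trans (ler_distD (limn s) _ _))// distrC.
  by rewrite [ltRHS]splitr ltrD//; apply: Hn => //=.
apply: cauchy_cvg; apply: cauchy_exP => e e0.
have [k /= _ /(_ k (leqnn k)) /= ke] := near_infty_natSinv_lt (PosNum e0).
have [n Hn] := H k; exists (s n), n => // m /= nm.
by rewrite -ball_normE/= distrC (lt_trans (Hn m nm)).
Qed.

(** The set of convergence is measurable by the Cauchy criterion; off it [limn] takes the default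
    value [point], to which [h] switches. *)
Lemma measurable_borel_lim (F : nat -> X -> V) :
  (forall k, measurable_fun setT (F k : X -> borel V)) ->
  measurable_fun setT ((fun x => limn (F ^~ x)) : X -> borel V).
Proof.
move=> mF; have [u u_dense] := separable_dense_seq sepV.
pose C : set X := [set x | cvgn (F ^~ x)].
have mC : measurable C.
  rewrite (_ : C = \bigcap_k \bigcup_n \bigcap_(m in [set m | (n <= m)%N])
      [set x | `|F m x - F n x| < k.+1%:R^-1]).
    apply: bigcapT_measurable => k; apply: bigcupT_measurable => n.
    apply: bigcap_measurableType => m _; rewrite -[X in measurable X]setTI.
    apply: measurable_lt_cst => //.
    apply: (continuous_measurable_borel (g := @Num.norm R V)); first exact: norm_continuous.
    exact: measurable_borelB.
  apply/seteqP; split => x; rewrite /C/= cvg_seq_cauchyP.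
    by move=> H k _; have [n Hn] := H k; exists n => // m; exact: Hn.
  by move=> H k; have [n _ Hn] := H k Logic.I; exists n => m; exact: Hn.
apply: (measurable_borelP u_dense) => n.
pose h (k : nat) (x : X) : R := \1_C x * `|F k x - u n| + (1 - \1_C x) * `|(point : V) - u n|.
apply: (@measurable_fun_cvg _ _ R setT h).
  move=> k; apply: measurable_funD; apply: measurable_funM.
  - exact: measurable_indic.
  - exact: measurable_borel_dist.
  - by apply: measurable_funB; [exact: measurable_cst|exact: measurable_indic].
  - exact: measurable_cst.
move=> x _; rewrite /h indicE; have [Cx|Cx] := pselect (C x).
  rewrite mem_set//= subrr mul0r; under eq_fun do rewrite mul1r addr0.
  by apply: cvg_norm; apply: cvgB; [exact: Cx | exact: cvg_cst].
rewrite memNset//=; under eq_fun do rewrite mul0r add0r subr0 mul1r.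
rewrite [limn _]dvgP//; first exact: cvg_cst.
Qed.

Lemma ae_eq_measurable d' (Y : measurableType d') (P : probability X R) (f g : X -> Y) :
  measure_is_complete P -> measurable_fun setT f ->
  {ae P, forall x, f x = g x} -> measurable_fun setT g.
Proof.
move=> cP mf fg _ B mB; rewrite setTI.
pose N := [set x | f x <> g x].
have nN : P.-negligible N.
  by move: fg; congr (P.-negligible _); apply/seteqP; split.
have mN : measurable N by exact: cP.
rewrite (_ : _ @^-1` _ = (f @^-1` B `\` N) `|` (g @^-1` B `&` N)).
  apply: measurableU; first by apply: measurableD => //; rewrite -[X in measurable X]setTI; exact: mf.
  by apply: cP; apply: negligibleS nN => x [].
apply/seteqP; split => x /=.
  by move=> Bx; have [fx|fx] := pselect (f x = g x); [left; split => //; rewrite fx|right].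
by move=> [[Bx /contrapT <-]|[]].
Qed.

End borel_measurability_separable.

(** * Marks of a point process *)

Section counting_facts.
Context (R : realType).

Lemma counting_finite (T : choiceType) (X : set T) :
  (counting X < +oo :> \bar R)%E -> finite_set X.
Proof. by rewrite /counting; case: asboolP => //; rewrite ltxx. Qed.

Lemma counting_set1 (T : choiceType) (a : T) : counting [set a] = 1%:E :> \bar R.
Proof.
rewrite /counting; case: asboolP => [_|]; last by move=> /(_ (finite_set1 a)).
by rewrite fset_set1 finmap.cardfs1.
Qed.

Lemma counting_eq1 (T : choiceType) (X : set T) :
  counting X = 1%:E :> \bar R -> exists a, X = [set a].
Proof.
rewrite /counting; case: asboolP => // fX [] /eqP.
rewrite -[1]/(1%:R) eqr_nat => /finmap.cardfs1P[a Xa]; exists a.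
by rewrite -(fset_setK fX) Xa; apply/seteqP; split => x /=; rewrite finmap.inE => /eqP.
Qed.

Lemma counting_natural (T : choiceType) (X : set T) :
  (counting X : \bar R) = +oo%E \/ exists k : nat, counting X = (k%:R : R)%:E.
Proof.
rewrite /counting; case: asboolP => _; last by left.
by right; eexists.
Qed.

End counting_facts.

Section point_processes.
Context (R : realType) d (Omega : measurableType d) (P : probability Omega R).
Context dZ (Z : measurableType dZ).
Context (Theta : Omega -> point_function R Z) (alpha : nat -> Omega -> R).
Hypotheses (P_complete : measure_is_complete P) (Theta_pp : point_process Theta).
Hypothesis Theta_finite : finite_point_process P Theta.
Hypothesis alpha_hit : hitting_times P Theta alpha.

(** The almost sure event on which the later arguments are carried out path by path. *)
Definition regular_path (w : Omega) :=
  [/\ pf_dom (Theta w) = range (fun m => alpha m.+1 w),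
      (forall m, alpha m w < alpha m.+1 w) &
      (forall t, exists m, t < alpha m w)].

Lemma measurable_pf_count_eq (U : set (R * Z)) (k : nat) : measurable U ->
  U `<=` `]0, +oo[ `*` setT -> measurable [set w | pf_count (Theta w) U = k%:R%:E].
Proof.
move=> mU U0; rewrite -[X in measurable X]setTI.
have mY : measurable ([set theta | pf_count theta U = k%:R%:E]
    : set (g_sigma_algebraType (@pf_generators R _ Z))).
  by apply: sub_sigma_algebra; exists k => //; exists U.
exact: (Theta_pp measurableT mY).
Qed.

Lemma measurable_pf_count (U : set (R * Z)) : measurable U ->
  U `<=` `]0, +oo[ `*` setT -> measurable_fun setT (fun w => pf_count (Theta w) U).
Proof.
move=> mU U0 _ B mB; rewrite setTI.
pose N k := [set w | pf_count (Theta w) U = k%:R%:E].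
have mN k : measurable (N k) by exact: measurable_pf_count_eq.
(* The generators of the sigma-algebra speak of finite counts; the value [+oo] is what remains. *)
pose I := ~` \bigcup_k N k.
have mI : measurable I by apply: measurableC; apply: bigcupT_measurable.
have Ioo w : I w -> pf_count (Theta w) U = +oo%E.
  move=> Iw; have [//|[k kE]] := counting_natural R [set t | pf_dom (Theta w) t /\ U (t, pf_at (Theta w) t)].
  by exfalso; apply: Iw; exists k.
rewrite (_ : _ @^-1` _ = (\bigcup_(k in [set k : nat | B k%:R%:E]) N k) `|`
    (I `&` [set w | B +oo%E])).
  apply: measurableU; first exact: bigcup_measurable.
  have [Boo|Boo] := pselect (B +oo%E).
    by rewrite (_ : [set w | _] = setT) ?setIT//; apply/seteqP; split.
  by rewrite (_ : [set w | _] = set0) ?setI0//; apply/seteqP; split.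
apply/seteqP; split => w /=.
  move=> Bw; have [Iw|] := pselect (I w); first by right; rewrite -(Ioo _ Iw).
  by move=> /contrapT[k _ kE]; left; exists k => //=; rewrite -kE.
by move=> [[k /= Bk ->]//|[/Ioo -> ]].
Qed.

Lemma measurable_itv_setX (i j : itv_bound R) (B : set Z) : measurable B ->
  measurable ([set` Interval i j] `*` B).
Proof. by move=> mB; apply: measurableX. Qed.

(** A finite expected number of points in a bounded interval makes that number almost surely finite;
    hitting times that stayed bounded would be infinitely many distinct points there. *)
Lemma ae_regular_path : {ae P, forall w, regular_path w}.
Proof.
have [_ _ _ ae_dom ae_incr] := alpha_hit.
have H (n : nat) : {ae P, forall w, finite_set (pf_dom (Theta w) `&` `]0, n.+1%:R])}.
  pose U : set (R * Z) := `]0, n.+1%:R] `*` setT.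
  have mU : measurable U by exact: measurable_itv_setX.
  have U0 : U `<=` `]0, +oo[ `*` setT.
    by move=> [t z] [/= + _]; rewrite !in_itv/= andbT => /andP[].
  have : P.-integrable setT (fun w => pf_count (Theta w) U).
    apply/integrableP; split; first exact: measurable_pf_count.
    under eq_integral do rewrite gee0_abs ?measure_ge0//.
    by apply: Theta_finite; rewrite ltr0n.
  move=> /integrable_ae => /(_ measurableT).
  apply: filterS => w /(_ Logic.I).
  rewrite ge0_fin_numE ?measure_ge0// => /counting_finite; apply: sub_finite_set.
  by move=> t [Dt tn]; split.
have {}H : {ae P, forall w, forall n : nat,
    finite_set (pf_dom (Theta w) `&` `]0, n.+1%:R])} by exact: ae_foralln H.
move: H ae_dom ae_incr; apply: filterS3 => w fin dom incr; split => // t.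
apply: contrapT => /forallNP H.
have {}H m : alpha m w <= t by rewrite leNgt; exact/negP/H.
pose n := Num.truncn `|t|.
have tn : t <= n.+1%:R.
  by rewrite (le_trans (ler_norm t))// ltW// truncnS_gt.
have a_lt : {homo (fun m => alpha m w) : i j / (i < j)%N >-> i < j}.
  exact: homo_ltn lt_trans incr.
have inj : injective (fun m => alpha m.+1 w).
  move=> i j /= ij; apply/eqP; case: ltngtP => //.
    by move=> ij'; have := a_lt i.+1 j.+1 ij'; rewrite ij ltxx.
  by move=> ij'; have := a_lt j.+1 i.+1 ij'; rewrite ij ltxx.
have [a0 _ a_gt0 _ _] := alpha_hit.
apply: infinite_nat; have := @finite_preimage _ _ _ (fun m => alpha m.+1 w) _ (fin n).
rewrite (_ : _ @^-1` _ = setT); last first.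
  apply/seteqP; split => // m _ /=; split; first by rewrite dom; exists m.
  by rewrite in_itv/= a_gt0/= (le_trans (H _)).
by apply => i j _ _; exact: inj.
Qed.

Lemma measurable_regular_path : measurable [set w | regular_path w].
Proof.
rewrite -[X in measurable X]setCK; apply: measurableC; apply: P_complete.
exact: ae_regular_path.
Qed.

Lemma regular_path_lt w i j : regular_path w -> (i < j)%N -> alpha i w < alpha j w.
Proof. by move=> [_ incr _]; exact: (homo_ltn lt_trans incr). Qed.

Lemma regular_path_ltP w i j : regular_path w -> (alpha i w < alpha j w) = (i < j)%N.
Proof.
move=> wr; have [ij|ji|->] := ltngtP i j; last by rewrite ltxx.
  exact: regular_path_lt.
by apply/negbTE; rewrite -leNgt ltW// regular_path_lt.
Qed.

Lemma alpha_ge0 m w : 0 <= alpha m w.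
Proof. by have [a0 _ a_gt0 _ _] := alpha_hit; case: m => [|m]; rewrite ?a0// ltW. Qed.

(** The sigma-algebra on point functions sees counts only. On a regular path the mark at
    [alpha m.+1] lies in [B] exactly when some rational interval around [alpha m.+1] contains a
    single point of [Theta] and the count restricted to marks in [B] is still one. *)
Lemma measurable_mark m :
  measurable_fun setT (fun w => pf_at (Theta w) (alpha m.+1 w)).
Proof.
have [a0 ma a_gt0 _ _] := alpha_hit.
move=> _ B mB; rewrite setTI; set G := [set w | regular_path w].
have mG : measurable G := measurable_regular_path.
pose N (p : rat * rat) C := [set w | pf_count (Theta w)
  (`]ratr p.1, ratr p.2[%classic `*` C) = 1%:R%:E].
pose J (p : rat * rat) := alpha m.+1 @^-1` `]ratr p.1, ratr p.2[%classic.
(* Counts are known to be measurable only on subsets of the positive half-line. *)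
pose Q := [set p : rat * rat | (0 <= ratr p.1 :> R)].
have mJ p : measurable (J p) by rewrite -[X in measurable X]setTI; apply: ma.
have mN p C : Q p -> measurable C -> measurable (N p C).
  move=> Qp mC; apply: measurable_pf_count_eq; first exact: measurable_itv_setX.
  move=> [t z] /= [+ _]; rewrite !in_itv/= andbT => /andP[pt _]; split => //.
  exact: le_lt_trans Qp pt.
set M := (X in measurable X).
rewrite (_ : M = (G `&` \bigcup_(p in Q) (J p `&` N p setT `&` N p B))
    `|` (M `\` G)).
  apply: measurableU.
    apply: measurableI => //; rewrite bigcup_mkcond.
    apply: countable_bigcupT_measurable => [|p]; first exact: countableP.
    case: ifPn => // /set_mem Qp.
    by apply: measurableI; [apply: measurableI => //; exact: mN|exact: mN].
  apply: P_complete; apply: negligibleS ae_regular_path => w [_ nG] //.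
apply/seteqP; split => w /=; last first.
  move=> [[Gw [p Qp [[Jp N1] N2]]]|[]//].
  have [t1 E1] := counting_eq1 N1; have [t2 E2] := counting_eq1 N2.
  have at1 : [set t1] (alpha m.+1 w).
    rewrite -E1/=; split; last by split.
    by have [-> _ _] := Gw; exists m.
  have : [set t2] t2 by [].
  rewrite -E2/= => -[Dt2 [Jt2 Bt2]].
  have t21 : [set t1] t2 by rewrite -E1/=; split.
  by rewrite /M/= at1 -t21.
move=> Bw; have [Gw|] := pselect (G w); last by right.
left; split => //.
have [q] := rat_in_itvoo (regular_path_lt Gw (ltnSn m)).
have [r] := rat_in_itvoo (regular_path_lt Gw (ltnSn m.+1)).
rewrite !in_itv/= => /andP[ar ra] /andP[aq qa].
have only t : pf_dom (Theta w) t -> ratr q < t < ratr r -> t = alpha m.+1 w.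
  have [-> _ _] := Gw => -[k _ <-] /andP[qk kr].
  have mk := lt_trans aq qk; have km := lt_trans kr ra.
  rewrite !regular_path_ltP// in mk km.
  by congr (alpha _ w); apply/eqP; rewrite eqn_leq -ltnS km mk.
have aJ : ratr q < alpha m.+1 w < ratr r by rewrite qa ar.
have D : pf_dom (Theta w) (alpha m.+1 w) by have [-> _ _] := Gw; exists m.
have NC C : C (pf_at (Theta w) (alpha m.+1 w)) -> N (q, r) C w.
  move=> Cw; rewrite /N/= /pf_count -(counting_set1 R (alpha m.+1 w)).
  congr counting; apply/seteqP; split => t /=.
    by rewrite in_itv/= => -[Dt [Jt _]]; exact: only.
  by move=> ->; rewrite in_itv.
exists (q, r); first by rewrite /Q/= (le_trans (alpha_ge0 m w))// ltW.
by split; [split|] => /=; [rewrite /J/= in_itv|exact: NC|exact: NC].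
Qed.

Lemma measurable_alpha m : measurable_fun setT (alpha m).
Proof. by have [_ ma _ _ _] := alpha_hit. Qed.

Section marks.
Context (V : completeNormedModType R) (eta : R -> Z -> Omega -> V).
Hypothesis eta_meas : measurable_jumps eta.

Lemma measurable_jump_mark m :
  measurable_fun setT (jump_mark Theta alpha eta m.+1 : Omega -> borel V).
Proof.
have [_ _ a_gt0 _ _] := alpha_hit.
apply: (measurable_comp (F := [set p : R * Z * Omega | 0 < p.1.1])
  (f := (fun p => eta p.1.1 p.1.2 p.2) : _ -> borel V)
  (g := fun w => (alpha m.+1 w, pf_at (Theta w) (alpha m.+1 w), w))).
- rewrite (_ : [set p | _] = (`]0, +oo[ `*` setT) `*` setT).
    by apply: measurableX => //; exact: measurable_itv_setX.
  apply/seteqP; split => -[[t z] w] /=; rewrite in_itv/= andbT; first by [].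
  by move=> [[]].
- by move=> _ [w _ <-] /=; exact: a_gt0.
- exact: eta_meas.
- apply: measurable_fun_pair => //; apply: measurable_fun_pair.
    exact: measurable_alpha.
  exact: measurable_mark.
Qed.

Lemma measurable_jumps_section w :
  measurable_fun [set p : R * Z | 0 < p.1] ((fun p => eta p.1 p.2 w) : _ -> borel V).
Proof.
apply: (measurable_comp (F := [set p : R * Z * Omega | 0 < p.1.1])
  (f := (fun p => eta p.1.1 p.1.2 p.2) : _ -> borel V) (g := fun p => (p, w))).
- rewrite (_ : [set p | _] = (`]0, +oo[ `*` setT) `*` setT).
    by apply: measurableX => //; exact: measurable_itv_setX.
  apply/seteqP; split => -[[t z] w'] /=; rewrite in_itv/= andbT; first by [].
  by move=> [[]].
- by move=> _ [[t z] t0 <-].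
- exact: eta_meas.
- by apply: measurable_funTS; apply: measurable_fun_pair.
Qed.

End marks.
End point_processes.

Lemma dense_seq_in (R : realType) (V : normedModType R) (W : set V) :
  separable V -> closure W = setT ->
  exists2 u : nat -> V, (forall n, W (u n)) &
    forall v (e : R), 0 < e -> exists n, `|v - u n| < e.
Proof.
move=> /separable_dense_seq[s s_dense] W_dense.
have sW (p : nat * nat) : exists w, W w /\ `|s p.1 - w| < (p.2.+1%:R : R)^-1.
  have : closure W (s p.1) by rewrite W_dense.
  have p0 : 0 < (p.2.+1%:R : R)^-1 by rewrite invr_gt0 ltr0n.
  move=> /(_ (ball (s p.1) p.2.+1%:R^-1) (nbhsx_ballx _ _ p0))[w [Ww sw]].
  by exists w; split => //; move: sw; rewrite -ball_normE.
have [w /all_and2[Ww sw]] := choice sW.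
exists (fun n => w (odflt (0%N, 0%N) (unpickle n))) => [n|v e e0]; first exact: Ww.
have e2 : 0 < e / 2 by rewrite divr_gt0.
have [k /= _ /(_ k (leqnn k)) /= ke] := near_infty_natSinv_lt (PosNum e2).
have [n vn] := s_dense v _ e2.
exists (pickle (n, k)); rewrite pickleK/=.
rewrite (le_lt_trans (ler_distD (s n) _ _))// [ltRHS]splitr ltrD//.
exact: lt_trans (sw (n, k)) ke.
Qed.

(** * Measurability of the generated process *)

Section generated_measurable.
Context (R : realType) (V : completeNormedModType R) (A : V -> set V).
Hypotheses (A_acc : accretive A) (A_dense : densely_defined A).
Context (T : R -> V -> V).
Hypothesis T_sg : semigroup_of A T.
Hypothesis sepV : separable V.

Lemma continuous_measurable_to_borel (f : R -> V) : continuous f ->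
  measurable_fun setT (f : R -> borel V).
Proof.
move=> cf; have [u u_dense] := separable_dense_seq sepV.
apply: (measurable_borelP u_dense) => n; apply: continuous_measurable_fun => t.
by apply: cvg_norm; apply: cvgB; [exact: cf | exact: cvg_cst].
Qed.

Lemma measurable_semigroup d (X : measurableType d) (tau : X -> R) (f : X -> V) :
  measurable_fun setT tau -> measurable_fun setT (f : X -> borel V) ->
  measurable_fun setT ((fun x => T (Num.max (tau x) 0) (f x)) : X -> borel V).
Proof.
move=> mtau mf; have [u u_dense] := separable_dense_seq sepV.
apply: (measurable_caratheodory u_dense (phi := fun v x => T (Num.max (tau x) 0) v)
  (C := fun=> 1)) => //.
  move=> n; apply: (@measurableT_comp _ _ _ _ _ (borel V)
    (fun t : R => T (Num.max t 0) (u n)) setT tau) => //.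
  apply: continuous_measurable_to_borel.
  exact: (semigroup_continuous A_acc A_dense T_sg).
move=> v w x; rewrite mul1r; apply: (semigroup_nonexpansive A_acc A_dense T_sg).
by rewrite le_max lexx orbT.
Qed.

Context d (Omega : measurableType d) (P : probability Omega R).
Context dZ (Z : measurableType dZ).
Context (Theta : Omega -> point_function R Z) (alpha : nat -> Omega -> R).
Hypotheses (P_complete : measure_is_complete P) (Theta_pp : point_process Theta).
Hypothesis Theta_finite : finite_point_process P Theta.
Hypothesis alpha_hit : hitting_times P Theta alpha.
Context (x : Omega -> V) (eta : R -> Z -> Omega -> V).
Hypotheses (x_meas : measurable_initial x) (eta_meas : measurable_jumps eta).

Lemma measurable_jump_sequence m :
  measurable_fun setT (jump_sequence Theta alpha T x eta m : Omega -> borel V).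
Proof.
have ma k := measurable_alpha alpha_hit k.
elim: m => [|m IH]; first exact: x_meas.
(* The hitting times increase only almost surely, so the clamped variant is measured first and
   completeness of [P] transfers the result. *)
pose f w := T (Num.max (alpha m.+1 w - alpha m w) 0)
  (jump_sequence Theta alpha T x eta m w) + jump_mark Theta alpha eta m.+1 w.
apply: (@ae_eq_measurable _ _ _ _ (borel V) P f) => //.
  apply: measurable_borelD => //; first apply: measurable_semigroup => //.
    exact: measurable_funB.
  exact: (measurable_jump_mark P_complete).
have := ae_regular_path Theta_pp Theta_finite alpha_hit.
apply: filterS => w [_ incr _]; rewrite /f max_l// subr_ge0 ltW//.
Qed.

Lemma measurable_generated_process :
  measurable_process (generated_process Theta alpha T x eta).
Proof.
have ma k := measurable_alpha alpha_hit k.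
rewrite /measurable_process; apply: measurable_funTS.
apply: (measurable_borel_lim sepV) => n; apply: measurable_borel_sum => // m.
have mat k : measurable_fun setT (fun p : R * Omega => alpha k p.2).
  by apply: measurableT_comp => //; exact: measurable_snd.
apply: measurable_borelZ => //; last first.
  apply: measurable_semigroup.
    by apply: measurable_funB => //; exact: measurable_fst.
  apply: (@measurableT_comp _ _ _ _ _ (borel V) _ setT snd) => //.
  exact: measurable_jump_sequence.
rewrite (_ : (fun p => _) =
    \1_[set p : R * Omega | alpha m p.2 <= p.1 /\ p.1 < alpha m.+1 p.2]).
  apply: measurable_indic; rewrite -[X in measurable X]setTI.
  pose g (p : R * Omega) := (alpha m p.2 <= p.1) && (p.1 < alpha m.+1 p.2).
  have mg : measurable_fun setT g.
    apply: measurable_and.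
      by apply: measurable_fun_ler => //; exact: measurable_fst.
    by apply: measurable_fun_ltr => //; exact: measurable_fst.
  have := mg measurableT [set true] (Logic.I); congr (measurable (_ `&` _)).
  by apply/seteqP; split => p /=; rewrite /g => /andP.
apply/funext => p; rewrite !indicE; congr (nat_of_bool _)%:R.
apply/idP/idP => /set_mem/= H; apply/mem_set => /=; first exact/andP.
by rewrite in_itv/=; exact/andP.
Qed.

End generated_measurable.

(** * Integrals against the counting measure as finite sums over the jumps *)

Section counting_integral.
Context (R : realType) d (Omega : measurableType d) (P : probability Omega R).
Context dZ (Z : measurableType dZ).
Context (Theta : Omega -> point_function R Z) (alpha : nat -> Omega -> R).
Hypothesis alpha_hit : hitting_times P Theta alpha.
Variables (w : Omega) (t : R) (K : nat).
Hypotheses (wr : regular_path Theta alpha w) (Kt : alpha K w <= t)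
  (tK : t < alpha K.+1 w).

(** The index is shifted because [alpha 0 = 0] is not a hitting time; exactly [K] of these points
    have their time in []0, t]]. *)
Let z (k : nat) : R * Z := (alpha k.+1 w, pf_at (Theta w) (alpha k.+1 w)).
Let D : set (R * Z) := `]0, t] `*` setT.

Let Dz k : (k < K)%N -> D (z k).
Proof.
move=> kK; have [_ _ a_gt0 _ _] := alpha_hit.
split => //=; rewrite in_itv/= a_gt0/= (le_trans _ Kt)//.
by rewrite leNgt (regular_path_ltP _ _ wr) -leqNgt.
Qed.

Let mD : measurable D.
Proof. exact: measurable_itv_setX. Qed.

Lemma pf_count_dirac_sum (A : set (R * Z)) : measurable A -> A `<=` D ->
  pf_count (Theta w) A = msum (fun k => \d_(z k)) K A.
Proof.
move=> mA AD; rewrite /msum /pf_count.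
pose G (k : nat) : set R := [set s | s = alpha k.+1 w /\ A (z k)].
have GE k : G k = if z k \in A then [set alpha k.+1 w] else set0.
  case: ifPn => [/set_mem Az|/negP Az]; apply/seteqP; split => s.
  - by case.
  - by move=> ->; split.
  - by move=> [_ /mem_set/Az].
  - by [].
rewrite [X in counting X](_ : _ = \big[setU/set0]_(k < K) G k).
  have mG (k : nat) : measurable (G k).
    by rewrite GE; case: ifP => // _; exact: measurable_set1.
  rewrite (@measure_semi_additive_ord_I _ _ _ (@counting R R))//; first last.
  - by apply: bigsetU_measurable => k _; exact: mG.
  - apply/trivIsetP => i j _ _ ij; apply/seteqP; split => // s [[-> _] [+ _]].
    have [ij'|ji|ij'] := ltngtP i j; last by rewrite ij' eqxx in ij.
      by have := regular_path_lt wr (ij' : (i.+1 < j.+1)%N) => + E; rewrite E ltxx.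
    by have := regular_path_lt wr (ji : (j.+1 < i.+1)%N) => + E; rewrite E ltxx.
  apply: eq_bigr => k _; rewrite GE /= diracE; case: ifP => _.
    by rewrite counting_set1.
  by rewrite measure0.
rewrite -bigcup_mkord; apply/seteqP; split => s /=.
  have [-> _ _] := wr => -[[k _ <-] As]; exists k; last by split.
  have [/= + _] := AD _ As; rewrite in_itv/= => /andP[_ /le_lt_trans/(_ tK)].
  by rewrite (regular_path_ltP _ _ wr) ltnS.
move=> [k /= kK [-> Ak]]; split => //.
by have [-> _ _] := wr; exists k.
Qed.

Lemma ge0_integral_pf_count (f : R * Z -> \bar R) :
  (forall p, D p -> (0 <= f p)%E) -> measurable_fun D f ->
  (\int[pf_count (Theta w)]_(p in D) f p = \sum_(k < K) f (z k))%E.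
Proof.
move=> f0 mf.
rewrite (eq_measure_integral (msum (fun k => \d_(z k)) K)); last first.
  by move=> A mA AD; exact: pf_count_dirac_sum.
rewrite ge0_integral_measure_sum//; apply: eq_bigr => k _.
by rewrite integral_dirac// diracE mem_set ?mul1e//; exact: Dz.
Qed.

Lemma integral_pf_count (f : R * Z -> R) : measurable_fun D f ->
  (\int[pf_count (Theta w)]_(p in D) (f p)%:E)%E = (\sum_(k < K) f (z k))%:E.
Proof.
move=> mf; have mfE : measurable_fun D (EFin \o f) by exact/measurable_EFinP.
rewrite integralE !ge0_integral_pf_count//; last 2 first.
  exact: measurable_funeneg.
  exact: measurable_funepos.
under eq_bigr do rewrite funeposE /= -EFin_max.
under [X in (_ - X)%E]eq_bigr do rewrite funenegE /= -EFin_max.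
rewrite !sumEFin -EFinB -sumrB; congr EFin; apply: eq_bigr => k _.
by case: (lerP (f (z k)) 0) => fk; case: (lerP (- f (z k)) 0) => fk'; lra.
Qed.

End counting_integral.

(** * Translation of integrable functions *)

Section shift.
Context (R : realType) (s : R).
Local Notation mu := (@lebesgue_measure R).

Let phi (t : measurableTypeR R) : measurableTypeR R := (t : R) - s.
Let mphi : measurable_fun setT phi.
Proof.
have : measurable_fun setT (fun t : R => t - s); last by [].
by apply: measurable_funB => //; exact: measurable_cst.
Qed.
Let phi_mfun : {mfun measurableTypeR R >-> measurableTypeR R} :=
  HB.pack phi (isMeasurableFun.Build _ _ _ _ _ mphi).

Lemma lebesgue_measure_shift (B : set R) : measurable B ->
  pushforward mu phi_mfun B = mu B.
Proof.
move=> mB; apply/esym/lebesgue_measure_unique => //= _ [[a b]] _ <-.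
rewrite /pushforward/= (_ : _ @^-1` _ = `]a + s, b + s]%classic); last first.
  by apply/seteqP; split => t /=; rewrite !in_itv/= /phi ltrBrDr lerBlDr.
rewrite !lebesgue_measure_itv/= !lte_fin ltrD2r -!EFinB.
by rewrite (_ : b + s - (a + s) = b - a)//; ring.
Qed.

Lemma integrable_shift (f : R -> R) (t : R) :
  mu.-integrable `]0, t[ (EFin \o f) ->
  mu.-integrable `]s, s + t[ (fun r => (f (r - s))%:E).
Proof.
have E : `]s, s + t[%classic = phi @^-1` `]0, t[%classic.
  by apply/seteqP; split => r /=; rewrite !in_itv/= /phi subr_gt0 ltrBlDl.
move=> /integrableP[mf intf]; apply/integrableP; split.
  apply: (measurable_comp (F := `]0, t[%classic) (f := EFin \o f) (g := phi)) => //.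
    by rewrite E => _ [r ? <-].
  exact: measurable_funTS.
rewrite E; apply: le_lt_trans intf.
rewrite -(ge0_integral_pushforward mphi mu (f := fun r => `|(f r)%:E|%E))//; last first.
  exact: measurableT_comp.
rewrite (eq_measure_integral (@lebesgue_measure R))// => B mB _.
exact: lebesgue_measure_shift.
Qed.

End shift.

(** * The generated process *)

Section regularity_transfer.
Context (R : realType) (V : normedModType R).

Lemma eq_W11 (a b : R) (f g : R -> V) : (forall t, a <= t <= b -> f t = g t) ->
  W11 a b f -> W11 a b g.
Proof.
move=> fg [acf df]; split.
  move=> e e0; have [d d0 Hd] := acf e e0; exists d => // n l r lr tI lt.
  have := Hd n l r lr tI lt; congr (_ < _); apply: eq_bigr => i _.
  by have [al [lr' rb]] := lr i; rewrite !fg// ?al/= ?rb ?(le_trans al lr') ?(le_trans lr' rb).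
move: df; apply: filterS; first exact: (ae_filter_ringOfSetsType (@lebesgue_measure R)).
move=> t /[swap] /[dup] tab /andP[at_ tb] /(_ tab) /derivable_has_derivative.
set l := 'D_1 f t => H; suff /has_derivativeP[] : has_derivative g t l by [].
move=> e e0; have [d d0 Hd] := H e e0.
exists (Num.min d (Num.min (t - a) (b - t))); first by rewrite !lt_min d0 !subr_gt0 at_.
move=> h; rewrite !lt_min => /and3P[hd]; rewrite !ltr_norml => /andP[h1 h2] /andP[h3 h4].
by have := Hd h hd; rewrite !fg//; lra.
Qed.

Lemma eq_cvg_at_right (f g : R -> V) (t d : R) (l : V) : t < d ->
  (forall s, t < s < d -> f s = g s) -> f s @[s --> t] --> l ->
  g s @[s --> t^'+] --> l.
Proof.
move=> td fg fl; have : f s @[s --> t^'+] --> l by exact: cvg_within_filter.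
apply: cvg_trans; apply: near_eq_cvg; near=> s; rewrite /= fg//.
by apply/andP; split; near: s; [exact: nbhs_right_gt | exact: nbhs_right_lt].
Unshelve. all: by end_near. Qed.

Lemma eq_cvg_at_left (f g : R -> V) (t d : R) (l : V) : d < t ->
  (forall s, d < s < t -> f s = g s) -> f s @[s --> t] --> l ->
  g s @[s --> t^'-] --> l.
Proof.
move=> td fg fl; have : f s @[s --> t^'-] --> l by exact: cvg_within_filter.
apply: cvg_trans; apply: near_eq_cvg; near=> s; rewrite /= fg//.
by apply/andP; split; near: s; [exact: nbhs_left_gt | exact: nbhs_left_lt].
Unshelve. all: by end_near. Qed.

End regularity_transfer.

Section generated_path.
Context (R : realType) (V : completeNormedModType R) (A : V -> set V).
Hypotheses (A_acc : accretive A) (A_dense : densely_defined A).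
Context (T : R -> V -> V) (Ao : V -> V).
Hypothesis T_sg : semigroup_of A T.
Hypothesis T_dom : domain_invariant A T.
Hypothesis Ao_gen : infinitesimal_generator A T Ao.
Hypothesis sepV : separable V.
Context d (Omega : measurableType d) (P : probability Omega R).
Context dZ (Z : measurableType dZ).
Context (Theta : Omega -> point_function R Z) (alpha : nat -> Omega -> R).
Hypothesis alpha_hit : hitting_times P Theta alpha.
Context (x : Omega -> V) (eta : R -> Z -> Omega -> V).
Variable (w : Omega).
Hypothesis wr : regular_path Theta alpha w.

Let y m := jump_sequence Theta alpha T x eta m w.
Local Notation X t := (generated_process Theta alpha T x eta t w).

Let a0 : alpha 0%N w = 0.
Proof. by have [-> _ _ _ _] := alpha_hit. Qed.

Lemma regular_path_cell t : 0 <= t -> exists m, alpha m w <= t < alpha m.+1 w.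
Proof.
move=> t0; have [_ _ inf] := wr; case: (ex_minnP (inf t)) => -[|m].
  by rewrite a0 ltNge t0.
move=> tm min; exists m; rewrite tm andbT leNgt; apply/negP => /min.
by rewrite ltnn.
Qed.

Lemma regular_path_left_cell t : 0 < t -> exists m, alpha m w < t <= alpha m.+1 w.
Proof.
move=> t0; have [_ _ inf] := wr.
have ex : exists m, t <= alpha m w by have [m /ltW] := inf t; exists m.
case: (ex_minnP ex) => -[|m]; first by rewrite a0 leNgt t0.
move=> tm min; exists m; rewrite tm andbT ltNge; apply/negP => /min.
by rewrite ltnn.
Qed.

Lemma generated_process_cell m t : alpha m w <= t < alpha m.+1 w ->
  X t = T (t - alpha m w) (y m).
Proof.
move=> /andP[mt tm].
have S n : (m < n)%N -> \sum_(0 <= k < n)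
    ((\1_(`[alpha k w, alpha k.+1 w[ : set R) t : R) *:
       T (Num.max (t - alpha k w) 0) (y k)) = T (t - alpha m w) (y m).
  move=> mn; rewrite big_mkord (bigD1 (Ordinal mn))//= big1 ?addr0.
    by rewrite indicE mem_set/= ?in_itv/= ?mt// scale1r max_l// subr_ge0.
  move=> k; rewrite -val_eqE/= => km.
  rewrite indicE memNset ?scale0r//= in_itv/= => /andP[kt tk].
  have := le_lt_trans kt tm; have := le_lt_trans mt tk.
  rewrite !(regular_path_ltP _ _ wr) !ltnS => mk km'.
  by move: km; rewrite eqn_leq mk km'.
rewrite /generated_process; apply: cvg_lim => //.
apply: cvg_near_cst; near=> n; apply: S; near: n; exact: nbhs_infty_gt.
Unshelve. all: by end_near. Qed.

Let shifted_continuous m t : (fun s => T (Num.max (s - alpha m w) 0) (y m)) s @[s --> t] -->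
  T (Num.max (t - alpha m w) 0) (y m).
Proof.
have c : s - alpha m w @[s --> t] --> t - alpha m w.
  by apply: cvgB; [exact: cvg_id | exact: cvg_cst].
apply: (@continuous_comp R R V (fun s : R => s - alpha m w)
  (fun r : R => T (Num.max r 0) (y m)) t); first exact: c.
exact: (semigroup_continuous A_acc A_dense T_sg).
Qed.

Lemma generated_process_left_limit m t : alpha m w < t <= alpha m.+1 w ->
  X s @[s --> t^'-] --> T (t - alpha m w) (y m).
Proof.
move=> /andP[mt tm].
have := @shifted_continuous m t; rewrite max_l ?subr_ge0 ?ltW//.
apply: (eq_cvg_at_left mt) => s /andP[ms st].
rewrite max_l; last by rewrite subr_ge0 ltW.
rewrite (@generated_process_cell m s)// (ltW ms)/=.
exact: lt_le_trans tm.
Qed.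

Lemma generated_process_regularity :
  solution_regularity alpha A x (generated_process Theta alpha T x eta) w.
Proof.
split.
- rewrite (@generated_process_cell 0%N); last first.
    by rewrite a0 lexx/=; have [_ _ a_gt0 _ _] := alpha_hit; exact: a_gt0.
  by rewrite a0 subr0 (semigroup0 T_sg).
- split=> t t0.
    have [m /andP[mt tm]] := regular_path_cell t0.
    rewrite (@generated_process_cell m t) ?mt//.
    have := @shifted_continuous m t; rewrite max_l ?subr_ge0//.
    apply: (eq_cvg_at_right tm) => s /andP[ts sm].
    have ms := le_trans mt (ltW ts).
    by rewrite max_l ?subr_ge0// (@generated_process_cell m s)// ms.
  have [m mt] := regular_path_left_cell t0.
  by eexists; exact: generated_process_left_limit mt.
- move=> t t0 ta; have [m /andP[mt tm]] := regular_path_cell (ltW t0).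
  rewrite (@generated_process_cell m t) ?mt//; apply: T_dom.
  rewrite subr_gt0 lt_neqAle mt andbT; apply/eqP => mE.
  by case: m mt tm mE => [|m] _ _ mE; [move: t0; rewrite -mE a0 ltxx | exact: (ta m)].
- move=> m a b ma ab bm.
  apply: eq_W11 (trajectory_W11 A_acc A_dense T_sg T_dom Ao_gen (y m) b sepV ma).
  move=> t /andP[at_ tb]; rewrite (@generated_process_cell m)//.
  by rewrite (le_trans (ltW ma) at_) (le_lt_trans tb bm).
Qed.

End generated_path.

(** * Strong solutions with initial value and jumps in the invariant subspace *)

Section interval_integrals.
Context (R : realType).
Local Notation mu := (@lebesgue_measure R).

Lemma integrable_setU d (X : measurableType d) (m : {measure set X -> \bar R})
    (B C : set X) (f : X -> \bar R) : measurable B -> measurable C ->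
  [disjoint B & C] -> m.-integrable B f -> m.-integrable C f ->
  m.-integrable (B `|` C) f.
Proof.
move=> mB mC BC /integrableP[mfB fB] /integrableP[mfC fC]; apply/integrableP.
have mf : measurable_fun (B `|` C) f by apply/measurable_funU.
split => //; rewrite ge0_integral_setU//; last exact: measurableT_comp.
exact: lte_add_pinfty.
Qed.

Lemma integrable_lebesgue_set1 (f : R -> R) (a : R) : mu.-integrable [set a] (EFin \o f).
Proof.
have fin : (mu [set a] < +oo)%E by rewrite lebesgue_measure_set1 ltry.
apply: measurable_bounded_integrable => //.
- exact: measurable_fun_set1.
exists `|f a|; split; first exact: num_real.
by move=> M aM _ ->; exact: ltW.
Qed.

Lemma integrable_itv_oc (f : R -> R) (a b : R) :
  mu.-integrable `]a, b[ (EFin \o f) -> mu.-integrable `]a, b] (EFin \o f).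
Proof.
move=> fi; have [ab|ba] := ltP a b; last first.
  by rewrite set_itv_ge ?bnd_simp -?leNgt//; exact: integrable_set0.
rewrite -(@setUitv1 _ _ _ _ true) ?bnd_simp//.
apply: integrable_setU => //; last exact: integrable_lebesgue_set1.
by apply/disj_setPS => x [/=]; rewrite in_itv/= => /andP[_ +] xE; rewrite xE ltxx.
Qed.

Lemma integrable_itv_cc (f : R -> R) (a b : R) :
  mu.-integrable `]a, b[ (EFin \o f) -> mu.-integrable `[a, b] (EFin \o f).
Proof.
move=> /integrable_itv_oc fi; have [ab|ba] := leP a b; last first.
  by rewrite set_itv_ge ?bnd_simp -?ltNge//; exact: integrable_set0.
rewrite -(@setU1itv _ _ _ _ false) ?bnd_simp//.
apply: integrable_setU => //; last exact: integrable_lebesgue_set1.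
by apply/disj_setPS => x [/= ->]; rewrite in_itv/= ltxx.
Qed.

Lemma Rintegral_itv_oo_cc (f : R -> R) (a b : R) :
  mu.-integrable `]a, b[ (EFin \o f) ->
  \int[mu]_(x in `]a, b[) f x = \int[mu]_(x in `[a, b]) f x.
Proof.
move=> fi; rewrite Rintegral_itv_bndo_bndc//.
by rewrite Rintegral_itv_obnd_cbnd//; exact: integrable_itv_oc.
Qed.

Lemma integrable_itv_oo_join (f : R -> R) (c a b : R) : c <= a -> a < b ->
  mu.-integrable `]c, a[ (EFin \o f) -> mu.-integrable `]a, b[ (EFin \o f) ->
  mu.-integrable `]c, b[ (EFin \o f).
Proof.
move=> ca ab /integrable_itv_oc f1 f2.
rewrite (@itv_bndbnd_setU _ _ _ (BRight a)) ?bnd_simp//.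
apply: integrable_setU => //.
by apply/disj_setPS => x [/=]; rewrite !in_itv/= => /andP[_ xa] /andP[ax _]; lra.
Qed.

Lemma Rintegral_itv_oo_join (f : R -> R) (c a b : R) : c <= a -> a < b ->
  mu.-integrable `]c, b[ (EFin \o f) ->
  \int[mu]_(x in `]c, b[) f x =
  \int[mu]_(x in `]c, a[) f x + \int[mu]_(x in `]a, b[) f x.
Proof.
move=> ca ab fi.
have fa : mu.-integrable `]c, a[ (EFin \o f).
  by apply: integrableS fi => // x; rewrite /= !in_itv/= => /andP[-> /lt_trans]; apply.
rewrite (Rintegral_itv_bndo_bndc fa).
apply/eqP; rewrite addrC -subr_eq Rintegral_itvB//= bnd_simp//.
Qed.

End interval_integrals.

Section generated_dual_integral.
Context (R : realType) (V : completeNormedModType R) (A : V -> set V).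
Hypotheses (A_acc : accretive A) (A_dense : densely_defined A).
Context (T : R -> V -> V) (Ao : V -> V).
Hypothesis T_sg : semigroup_of A T.
Hypothesis T_dom : domain_invariant A T.
Hypothesis Ao_gen : infinitesimal_generator A T Ao.
Hypothesis sepV : separable V.
Context (W : set V) (Vstar : set {linear V -> R^o}).
Hypothesis Vstar_dual : Vstar `<=` @dual R V.
Hypothesis W_L1 : forall (t : R) u Psi, 0 < t -> W u -> Vstar Psi ->
  lebesgue_measure.-integrable `]0, t[ (fun tau => (Psi (Ao (T tau u)) : R)%:E).
Local Notation mu := (@lebesgue_measure R).

Lemma shifted_trajectory_integrable (Psi : {linear V -> R^o}) v s b :
  Vstar Psi -> W v -> s < b ->
  mu.-integrable `]s, b[ (EFin \o (fun r => Psi (Ao (T (r - s) v)) : R)).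
Proof.
move=> VPsi Wv sb; have sb0 : 0 < b - s by rewrite subr_gt0.
by have := integrable_shift s (W_L1 sb0 Wv VPsi); rewrite addrC subrK.
Qed.

(** [trajectory_dual_integral] applies from any [c > s]. As [c] decreases to [s], the integral over
    [[s, c]] vanishes by the integrability assumed for [v] in [W], and [Psi (T (c - s) v)] tends to
    [Psi v] by continuity. *)
Lemma shifted_trajectory_integral (Psi : {linear V -> R^o}) v s b :
  Vstar Psi -> W v -> s < b ->
  \int[mu]_(r in `]s, b[) (Psi (Ao (T (r - s) v)) : R) = Psi v - Psi (T (b - s) v).
Proof.
move=> VPsi Wv sb; have fi := shifted_trajectory_integrable VPsi Wv sb.
pose f (r : R) : R := Psi (Ao (T (r - s) v)).
rewrite Rintegral_itv_oo_cc//.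
have fic := integrable_itv_cc fi.
have split c : s < c -> c < b -> \int[mu]_(r in `[s, b]) f r =
    \int[mu]_(r in `[s, c]) f r + ((Psi (T (c - s) v) : R) - Psi (T (b - s) v)).
  move=> sc cb; rewrite (trajectory_dual_integral A_acc A_dense T_sg T_dom Ao_gen _ (Vstar_dual VPsi) sc (ltW cb)).
  apply/eqP; rewrite addrC -subr_eq Rintegral_itvB// ?bnd_simp ?ltW//.
  rewrite Rintegral_itv_obnd_cbnd//.
  by apply: integrableS fic => // r; rewrite /= !in_itv/= => /andP[/(lt_trans sc)/ltW -> ->].
have cvT : (Psi (T (c - s) v) : R^o) @[c --> s^'+] --> (Psi v : R^o).
  have cs : c - s @[c --> s] --> s - s.
    by apply: cvgB; [exact: cvg_id | exact: cvg_cst].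
  have cT : T (Num.max (c - s) 0) v @[c --> s] --> T (Num.max (s - s) 0) v.
    apply: (@continuous_comp R R V (fun c : R => c - s) (fun r : R => T (Num.max r 0) v) s).
      exact: cs.
    exact: (semigroup_continuous A_acc A_dense T_sg).
  have cPT : (Psi (T (Num.max (c - s) 0) v) : R^o) @[c --> s] --> (Psi v : R^o).
    rewrite -{2}[v](semigroup0 T_sg v) -[X in T X v](@max_l _ R 0 0)// -[X in Num.max X _](subrr s).
    apply: (@continuous_comp R V R^o (fun c : R => T (Num.max (c - s) 0) v) Psi s).
      exact: cT.
    exact: (Vstar_dual VPsi).
  apply: (eq_cvg_at_right sb _ cPT) => c /andP[sc _].
  by rewrite max_l// subr_ge0 ltW.
have cvI : \int[mu]_(r in `[s, c]) f r @[c --> s^'+] --> (0 : R).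
  apply: cvg_within_filter.
  exact: (parameterized_integral_cvg_left sb fic).
have : (\int[mu]_(r in `[s, c]) f r + ((Psi (T (c - s) v) : R) - Psi (T (b - s) v)))
    @[c --> s^'+] --> (0 + ((Psi v : R) - Psi (T (b - s) v))).
  by apply: cvgD => //; apply: cvgB => //; exact: cvg_cst.
rewrite add0r => H; apply: (cvg_unique _ _ H) => //.
apply: cvg_near_cst; near=> c; rewrite -split//.
Unshelve. all: by end_near. Qed.

Context d (Omega : measurableType d) (P : probability Omega R).
Context dZ (Z : measurableType dZ).
Context (Theta : Omega -> point_function R Z) (alpha : nat -> Omega -> R).
Hypothesis alpha_hit : hitting_times P Theta alpha.
Context (x : Omega -> V) (eta : R -> Z -> Omega -> V).
Variable (w : Omega).
Hypothesis wr : regular_path Theta alpha w.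
Hypothesis W_inv : invariant W T.
Hypothesis W_add : forall u v, W u -> W v -> W (u + v).
Hypotheses (W_x : W (x w)) (W_eta : forall t z, W (eta t z w)).

Local Notation y m := (jump_sequence Theta alpha T x eta m w).
Local Notation X t := (generated_process Theta alpha T x eta t w).
Local Notation e m := (jump_mark Theta alpha eta m w).

Lemma jump_sequence_invariant m : W (y m).
Proof.
elim: m => [|m IH] //=; apply: W_add; last exact: W_eta.
by apply: W_inv => //; rewrite subr_ge0 ltW// (regular_path_lt wr).
Qed.

Lemma generated_cell_integral Psi m b : Vstar Psi ->
  alpha m w < b -> b <= alpha m.+1 w ->
  mu.-integrable `]alpha m w, b[ (EFin \o (fun r => Psi (Ao (X r)) : R)) /\
  \int[mu]_(r in `]alpha m w, b[) (Psi (Ao (X r)) : R) =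
    (Psi (y m) : R) - Psi (T (b - alpha m w) (y m)).
Proof.
move=> VPsi mb bm; have Wy := jump_sequence_invariant m.
have E : {in `]alpha m w, b[%classic, forall r,
    Psi (Ao (X r)) = Psi (Ao (T (r - alpha m w) (y m)))}.
  move=> r; rewrite inE/= in_itv/= => /andP[mr rb].
  rewrite (@generated_process_cell R V T d Omega dZ Z Theta alpha x eta w wr m r)// ltW//=.
  exact: lt_le_trans bm.
split.
  apply: eq_integrable (shifted_trajectory_integrable VPsi Wy mb) => // r /E /= ->.
  by [].
rewrite -(shifted_trajectory_integral VPsi Wy mb).
by apply: eq_Rintegral => r /E.
Qed.

(** The cell integrals telescope up to the jumps: the end value of one cell and the initial value of
    the next differ by a mark. *)
Lemma generated_dual_integral_alpha Psi K : Vstar Psi ->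
  mu.-integrable `]0, alpha K w[ (EFin \o (fun r => Psi (Ao (X r)) : R)) /\
  \int[mu]_(r in `]0, alpha K w[) (Psi (Ao (X r)) : R) =
    (Psi (x w) : R) - Psi (y K) + \sum_(k < K) (Psi (e k.+1) : R).
Proof.
move=> VPsi; elim: K => [|K [IH1 IH2]].
  have [-> _ _ _ _] := alpha_hit.
  rewrite set_itv_ge ?bnd_simp ?ltxx//; split; first exact: integrable_set0.
  by rewrite Rintegral_set0 big_ord0 addr0 subrr.
have incr := regular_path_lt wr (ltnSn K).
have [J1 J2] := generated_cell_integral VPsi incr (lexx _).
have K0 := alpha_ge0 alpha_hit K w.
have J := integrable_itv_oo_join K0 incr IH1 J1.
split=> //; rewrite (Rintegral_itv_oo_join K0 incr J) IH2 J2 big_ord_recr/=.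
by rewrite linearD/=; ring.
Qed.

Lemma generated_dual_integral Psi K t : Vstar Psi ->
  alpha K w <= t < alpha K.+1 w ->
  mu.-integrable `]0, t[ (EFin \o (fun r => Psi (Ao (X r)) : R)) /\
  \int[mu]_(r in `]0, t[) (Psi (Ao (X r)) : R) =
    (Psi (x w) : R) - Psi (X t) + \sum_(k < K) (Psi (e k.+1) : R).
Proof.
move=> VPsi Kt; have [IH1 IH2] := generated_dual_integral_alpha K VPsi.
rewrite (generated_process_cell _ _ _ wr Kt).
have /andP[+ tK] := Kt; rewrite le_eqVlt => /predU1P[<-|{}Kt].
  by rewrite subrr (semigroup0 T_sg).
have [J1 J2] := generated_cell_integral VPsi Kt (ltW tK).
have K0 := alpha_ge0 alpha_hit K w.
have J := integrable_itv_oo_join K0 Kt IH1 J1.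
by split=> //; rewrite (Rintegral_itv_oo_join K0 Kt J) IH2 J2; ring.
Qed.

End generated_dual_integral.

(** * Existence, by rounding the data into the invariant subspace *)

Section existence.
Context (R : realType) (V : completeNormedModType R) (A : V -> set V).
Hypotheses (A_acc : accretive A) (A_dense : densely_defined A).
Context (T : R -> V -> V) (Ao : V -> V).
Hypothesis T_sg : semigroup_of A T.
Hypothesis T_dom : domain_invariant A T.
Hypothesis Ao_gen : infinitesimal_generator A T Ao.
Hypothesis sepV : separable V.
Context (W : set V) (Vstar : set {linear V -> R^o}).
Hypothesis Vstar_dual : Vstar `<=` @dual R V.
Hypothesis W_L1 : forall (t : R) u Psi, 0 < t -> W u -> Vstar Psi ->
  lebesgue_measure.-integrable `]0, t[ (fun tau => (Psi (Ao (T tau u)) : R)%:E).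
Hypothesis W_inv : invariant W T.
Hypothesis W_add : forall u v, W u -> W v -> W (u + v).
Hypothesis W_dense : closure W = setT.
Context d (Omega : measurableType d) (P : probability Omega R).
Context dZ (Z : measurableType dZ).
Context (Theta : Omega -> point_function R Z) (alpha : nat -> Omega -> R).
Hypotheses (P_complete : measure_is_complete P) (Theta_pp : point_process Theta).
Hypothesis Theta_finite : finite_point_process P Theta.
Hypothesis alpha_hit : hitting_times P Theta alpha.
Implicit Types (x : Omega -> V) (eta : R -> Z -> Omega -> V).
Local Notation gen := (generated_process Theta alpha T).

Lemma measurable_dual_jumps eta (Psi : {linear V -> R^o}) (t : R) w : dual Psi ->
  measurable_jumps eta ->
  measurable_fun (`]0, t] `*` setT) (fun p => Psi (eta p.1 p.2 w) : R).
Proof.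
move=> cPsi meta; apply: (continuous_measurable_borel (g := fun v => Psi v : R)).
  exact: cPsi.
apply: measurable_funS (measurable_jumps_section meta w) => //.
  rewrite (_ : [set p | _] = `]0, +oo[ `*` setT); first exact: measurable_itv_setX.
  by apply/seteqP; split => -[s z] /=; rewrite in_itv/= andbT => // -[].
by move=> [s z] /= []; rewrite in_itv/= => /andP[].
Qed.

Lemma measurable_norm_jumps eta eta' (t : R) w :
  measurable_jumps eta -> measurable_jumps eta' ->
  measurable_fun (`]0, t] `*` setT) (fun p => `|eta p.1 p.2 w - eta' p.1 p.2 w|).
Proof.
move=> meta meta'.
have mD : measurable (`]0, t] `*` setT : set (R * Z)) by exact: measurable_itv_setX.
have mE : measurable ([set p : R * Z | 0 < p.1]).
  rewrite (_ : [set p | _] = `]0, +oo[ `*` setT); first exact: measurable_itv_setX.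
  by apply/seteqP; split => -[s z] /=; rewrite in_itv/= andbT => // -[].
have DE : (`]0, t] `*` setT : set (R * Z)) `<=` [set p : R * Z | 0 < p.1].
  by move=> [s z] /= []; rewrite in_itv/= => /andP[].
apply: (continuous_measurable_borel (g := @Num.norm R V)); first exact: norm_continuous.
by apply: measurable_borelB => //;
  [exact: measurable_funS (measurable_jumps_section meta w) |
   exact: measurable_funS (measurable_jumps_section meta' w)].
Qed.

Lemma generated_strong_solution x eta : measurable_initial x -> measurable_jumps eta ->
  (forall w, W (x w)) -> (forall t z w, W (eta t z w)) ->
  strong_solution P Theta alpha A Ao Vstar x eta (gen x eta).
Proof.
move=> mx meta Wx Weta; split.
  exact: (measurable_generated_process A_acc A_dense T_sg sepV P_complete Theta_pp Theta_finite alpha_hit).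
have := ae_regular_path Theta_pp Theta_finite alpha_hit.
apply: filterS => w wr.
have key := generated_dual_integral A_acc A_dense T_sg T_dom Ao_gen Vstar_dual W_L1
  alpha_hit wr W_inv W_add (Wx w) (fun t z => Weta t z w).
split.
- exact: (generated_process_regularity A_acc A_dense T_sg T_dom Ao_gen sepV alpha_hit).
- move=> t Psi t0 VPsi; have [K tK] := regular_path_cell alpha_hit wr (ltW t0).
  by have [] := key Psi K t VPsi tK.
- move=> t Psi t0 VPsi; have [K tK] := regular_path_cell alpha_hit wr (ltW t0).
  have [intf If] := key Psi K t VPsi tK.
  have /andP[Kt tK'] := tK.
  rewrite (integral_pf_count alpha_hit wr Kt tK'); last first.
    exact: measurable_dual_jumps (Vstar_dual VPsi) meta.
  rewrite -[X in (_ + X)%E]fineK; last exact: integrable_fin_num intf.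
  rewrite -EFinD; congr EFin.
  have -> : (Psi (gen x eta t w - x w) : R) = (Psi (gen x eta t w) : R) - Psi (x w).
    by rewrite linearB.
  rewrite [fine _]If; ring.
Qed.

Lemma jump_sequence_dist x x' eta eta' w m : regular_path Theta alpha w ->
  `|jump_sequence Theta alpha T x eta m w - jump_sequence Theta alpha T x' eta' m w|
  <= `|x w - x' w| + \sum_(k < m)
       `|jump_mark Theta alpha eta k.+1 w - jump_mark Theta alpha eta' k.+1 w|.
Proof.
move=> wr; elim: m => [|m IH]; first by rewrite big_ord0 addr0.
rewrite big_ord_recr/= addrA opprD addrACA (le_trans (ler_normD _ _))// lerD//.
apply: le_trans (semigroup_nonexpansive A_acc A_dense T_sg _ _ _) IH.
by rewrite subr_ge0 ltW// (regular_path_lt wr).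
Qed.

Lemma generated_process_dist x x' eta eta' w K s t : regular_path Theta alpha w ->
  0 <= s <= t -> t < alpha K.+1 w ->
  `|gen x eta s w - gen x' eta' s w| <= `|x w - x' w| + \sum_(k < K)
       `|jump_mark Theta alpha eta k.+1 w - jump_mark Theta alpha eta' k.+1 w|.
Proof.
move=> wr /andP[s0 st] tK; have [m /[dup] sm /andP[ms _]] := regular_path_cell alpha_hit wr s0.
have mK : (m <= K)%N.
  by rewrite -ltnS -(regular_path_ltP _ _ wr) (le_lt_trans ms)// (le_lt_trans st).
rewrite !(generated_process_cell _ _ _ wr sm).
apply: le_trans (semigroup_nonexpansive A_acc A_dense T_sg _ _ _) _.
  by rewrite subr_ge0.
rewrite (le_trans (jump_sequence_dist _ _ _ _ _ wr))// lerD2l.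
by rewrite -(subnKC mK) big_split_ord/= lerDl sumr_ge0.
Qed.

Lemma generated_mild_solution x eta : measurable_initial x -> measurable_jumps eta ->
  mild_solution P Theta alpha A Ao Vstar x eta (gen x eta).
Proof.
move=> mx meta; have ae_wr := ae_regular_path Theta_pp Theta_finite alpha_hit.
have [u Wu u_dense] := dense_seq_in sepV W_dense.
(* Rounding takes values in [W], preserves measurability and moves every point by at most
   [m.+1%:R^-1]. *)
pose r (m : nat) v := u (dense_index u_dense m v).
have mr m d' (Y : measurableType d') (D : set Y) (f : Y -> V) : measurable D ->
    measurable_fun D (f : Y -> borel V) -> measurable_fun D ((fun p => r m (f p)) : Y -> borel V).
  by move=> mD mf; exact: measurable_dense_approx.
have rle m v : `|r m v - v| <= m.+1%:R^-1.
  by rewrite distrC ltW//; exact: dense_index_lt.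
pose xs m w := r m (x w).
pose etas m t z w := r m (eta t z w).
have mxs m : measurable_initial (xs m) by exact: mr.
have metas m : measurable_jumps (etas m).
  apply: mr => //.
  rewrite (_ : [set p | _] = (`]0, +oo[ `*` setT) `*` setT).
    by apply: measurableX => //; exact: measurable_itv_setX.
  apply/seteqP; split => -[[t z] w] /=; rewrite in_itv/= andbT; first by [].
  by move=> [[]].
split.
- exact: (measurable_generated_process A_acc A_dense T_sg sepV P_complete Theta_pp Theta_finite alpha_hit).
- move: ae_wr; apply: filterS => w wr.
  exact: (generated_process_regularity A_acc A_dense T_sg T_dom Ao_gen sepV alpha_hit).
exists xs, etas, (fun m => gen (xs m) (etas m)); split.
  move=> m; split => //; apply: generated_strong_solution => //.
  - by move=> w; exact: Wu.
  - by move=> t z w; exact: Wu.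
move: ae_wr; apply: filterS => w wr t t0.
have [K tK] := regular_path_cell alpha_hit wr (ltW t0).
have /andP[Kt tK'] := tK.
(* For fixed [w] and [t] the number [K] of jumps does not depend on [m], so this sum, which is the
   integral of the error, tends to [0]. *)
have sumle m : \sum_(k < K) `|jump_mark Theta alpha (etas m) k.+1 w -
    jump_mark Theta alpha eta k.+1 w| <= K%:R * m.+1%:R^-1.
  apply: (@le_trans _ _ (\sum_(k < K) (m.+1%:R^-1 : R))).
    by apply: ler_sum => k _; exact: rle.
  by rewrite sumr_const card_ord mulr_natl.
have cvg0 (c : R) : (c * m.+1%:R^-1)%:E @[m --> \oo] --> 0%E.
  apply: cvg_EFin; first by near=> m.
  rewrite /comp/= -[X in _ --> X](mulr0 c); apply: cvgMr.
  exact: cvg_harmonic.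
split.
  apply: (squeeze_cvge _ (cvg_cst 0%E) (cvg0 (K%:R + 1))); near=> m; apply/andP; split.
    apply: (@le_trans _ _ (`|gen (xs m) (etas m) 0 w - gen x eta 0 w|)%:E).
      by rewrite lee_fin.
    by apply: ereal_sup_ubound; exists 0 => //=; rewrite in_itv/= lexx ltW.
  apply: ge_ereal_sup => _ [s /= + <-]; rewrite in_itv/= => st.
  rewrite lee_fin (le_trans (generated_process_dist _ _ _ _ wr st tK'))//.
  by rewrite addrC mulrDl mul1r lerD// rle.
apply: (squeeze_cvge _ (cvg_cst 0%E) (cvg0 K%:R)); near=> m.
rewrite (integral_pf_count alpha_hit wr Kt tK'); last exact: measurable_norm_jumps.
by rewrite !lee_fin sumr_ge0//= sumle.
Unshelve. all: by end_near. Qed.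

End existence.

(** * Uniqueness *)

Section derivative_facts.
Context (R : realType) (V : normedModType R).

Lemma has_derivative_unique (F : R -> V) t l l' :
  has_derivative F t l -> has_derivative F t l' -> l = l'.
Proof. by move=> /has_derivativeP[_ <-] /has_derivativeP[_ <-]. Qed.

Lemma has_derivative_near (F F' : R -> V) t l (r : R) : 0 < r ->
  (forall h, `|h| < r -> F (t + h) = F' (t + h)) ->
  has_derivative F t l -> has_derivative F' t l.
Proof.
move=> r0 FF' H e e0; have [d d0 Hd] := H e e0.
exists (Num.min d r); first by rewrite lt_min d0.
move=> h; rewrite lt_min => /andP[hd hr].
have Ft : F t = F' t by rewrite -[t]addr0 FF'// normr0.
by rewrite -FF'// -Ft; exact: Hd.
Qed.

Lemma has_derivative_dual (F : R -> V) t l (Psi : {linear V -> R^o}) : dual Psi ->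
  has_derivative F t l -> has_derivative (fun s => Psi (F s) : R^o) t (Psi l).
Proof.
move=> cPsi H e e0; have [C C0 HC] := dual_bounded cPsi.
have [d d0 Hd] := H (e / C) (divr_gt0 e0 C0); exists d => // h /Hd.
rewrite -linearB -linearZ -linearB => xh; apply: le_trans (HC _) _.
by rewrite mulrC -ler_pdivlMr// mulrAC.
Qed.

Lemma has_derivative_cstB (F : R -> R^o) (c : R) t l :
  has_derivative F t l -> has_derivative (fun s => c - F s : R^o) t (- l).
Proof.
move=> H e e0; have [d d0 Hd] := H e e0; exists d => // h /Hd.
rewrite -normrN; congr (`|_| <= _).
by rewrite scalerN !opprB !opprK; lincomb R R^o; ring.
Qed.

End derivative_facts.

(** A Lindelof argument: the open sets where some functional of [S] does not vanish cover all
    nonzero vectors, and for each ball of a countable base inside one of them a single functional is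
    chosen. [Psi0] fills the indices of the other balls. *)
Lemma separating_sequence (R : realType) (V : normedModType R)
    (S : set {linear V -> R^o}) : separable V ->
  S `<=` @dual R V -> separates_points S -> S !=set0 ->
  exists2 Psi : nat -> {linear V -> R^o}, (forall n, S (Psi n)) &
    forall v, (forall n, Psi n v = 0) -> v = 0.
Proof.
move=> /separable_dense_seq[u u_dense] S_dual S_sep [Psi0 SPsi0].
pose Q (p : nat * nat) (Psi : {linear V -> R^o}) := S Psi /\
  (ball (u p.1) p.2.+1%:R^-1 `<=` [set v | Psi v != 0 :> R]).
have ex p : exists Psi, S Psi /\ ((exists Psi', Q p Psi') -> Q p Psi).
  have [[Psi QPsi]|nQ] := pselect (exists Psi', Q p Psi').
    by exists Psi; split => //; case: QPsi.
  by exists Psi0.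
have [Psi /all_and2[SPsi QPsi]] := choice ex.
exists (fun n => Psi (odflt (0%N, 0%N) (unpickle n))) => // v Psiv0.
apply: S_sep => Phi SPhi; apply: contrapT => /eqP Phiv.
have oPhi : open [set v | Phi v != 0 :> R].
  rewrite (_ : [set v | _] = Phi @^-1` ~` [set (0 : R^o)]).
    apply: open_comp; first by move=> ? _; exact: (S_dual _ SPhi).
    by apply: closed_openC; exact: closed_eq.
  by apply/seteqP; split => z /= /eqP.
have : [set v | Phi v != 0 :> R] v by [].
rewrite (open_bigcup_balls u_dense oPhi) => -[p /= pPhi vp].
have [_ /(_ _ vp)/=] : Q p (Psi p) by apply: QPsi; exists Phi.
by rewrite (_ : Psi p v = 0) ?eqxx//; have := Psiv0 (pickle p); rewrite pickleK.
Qed.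

(** * Weak solutions on an interval without jumps *)

Section strong_uniqueness.
Context (R : realType) (V : completeNormedModType R) (A : V -> set V).
Hypotheses (A_acc : accretive A) (A_dense : densely_defined A).
Context (T : R -> V -> V) (Ao : V -> V).
Hypothesis T_sg : semigroup_of A T.
Hypothesis T_dom : domain_invariant A T.
Hypothesis Ao_gen : infinitesimal_generator A T Ao.
Hypothesis sepV : separable V.
Context (Vstar : set {linear V -> R^o}).
Hypothesis Vstar_dual : Vstar `<=` @dual R V.
Hypothesis Vstar_sep : separates_points Vstar.
Hypothesis Vstar_neq0 : Vstar !=set0.
Local Notation mu := (@lebesgue_measure R).

Variables (u : R -> V) (a b : R).
Hypothesis u_dom : forall t, a < t < b -> op_dom A (u t).
Hypothesis u_W11 : forall s t, a < s -> s <= t -> t < b -> W11 s t u.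
Hypothesis u_int : forall s t Psi, a < s -> s < t -> t < b -> Vstar Psi ->
  mu.-integrable `]s, t[ (EFin \o (fun r => Psi (Ao (u r)) : R)) /\
  (Psi (u t) : R) = Psi (u s) - \int[mu]_(r in `]s, t[) (Psi (Ao (u r)) : R).

(** Differentiability comes from [W11]; the functionals only identify the derivative. Each has its
    own null set in Lebesgue's differentiation theorem, whence a sequence of them. *)
Lemma weak_solution_derivative s t : a < s -> s <= t -> t < b ->
  {ae mu, forall r, s < r < t -> has_derivative u r (- Ao (u r))}.
Proof.
move=> as_ st tb.
have [Psi VPsi Psi_sep] := separating_sequence sepV Vstar_dual Vstar_sep Vstar_neq0.
move: st; rewrite le_eqVlt => /predU1P[->|st].
  by apply: aeW => r /andP[tr rt]; have := lt_trans tr rt; rewrite ltxx.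
pose g n (r : R) : R := Psi n (Ao (u r)).
(* Cut off outside [[s, t]], so that it is integrable up to every upper bound, as [FTC1] asks. *)
pose f n := g n \_ `[s, t].
have gi n : mu.-integrable `[s, t] (EFin \o g n).
  by apply: integrable_itv_cc; have [] := u_int as_ st tb (VPsi n).
have fi n : mu.-integrable setT (EFin \o f n).
  by rewrite /f -restrict_EFin; apply/integrable_restrict => //=; rewrite setTI.
have H1 n : {ae mu, forall r, s < r ->
    has_derivative (fun y => \int[mu]_(x in `[s, y]) f n x : R^o) r (f n r)}.
  have fiy y : mu.-integrable [set` Interval (BLeft s) (BRight y)] (EFin \o f n).
    exact: integrableS (fi n).
  have := FTC1 fiy (integrable_locally (measurable_itv _) (gi n)).
  apply: filterS; first exact: (ae_filter_ringOfSetsType mu).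
  move=> r H sr; have [|dF <-] := H; first exact: sr.
  by rewrite derive1E; exact: derivable_has_derivative.
have {}H1 : {ae mu, forall r, forall n, s < r ->
    has_derivative (fun y => \int[mu]_(x in `[s, y]) f n x : R^o) r (f n r)}.
  exact: ae_foralln H1.
have [_ H2] := u_W11 as_ (ltW st) tb.
move: H1 H2; apply: filterS2; first exact: (ae_filter_ringOfSetsType mu).
move=> r H1 H2 srt; have /andP[sr rt] := srt.
have /derivable_has_derivative := H2 srt.
set l := 'D_1 u r => ul; suff -> : - Ao (u r) = l by [].
apply/esym/eqP; rewrite -addr_eq0; apply/eqP/Psi_sep => n.
rewrite linearD; apply/eqP; rewrite addr_eq0; apply/eqP.
have d1 := has_derivative_dual (Vstar_dual (VPsi n)) ul.
have d2 := has_derivative_cstB (Psi n (u s)) (H1 n sr).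
have fr : f n r = Psi n (Ao (u r)).
  by rewrite /f patchE mem_set//= in_itv/= (ltW sr) (ltW rt).
rewrite -fr; apply: has_derivative_unique d1 _.
have m0 : 0 < Num.min (r - s) (t - r) by rewrite lt_min !subr_gt0 sr.
apply: has_derivative_near m0 _ d2 => h.
rewrite lt_min !ltr_norml => /andP[/andP[h1 _] /andP[_ h2]].
have srh : s < r + h by lra.
have rht : r + h < t by lra.
have [gi' ->] := u_int as_ srh (lt_trans rht tb) (VPsi n).
congr (_ - _); rewrite Rintegral_itv_oo_cc//; apply: eq_Rintegral => y.
rewrite inE/= in_itv/= => /andP[sy yr].
by rewrite /f patchE mem_set//= in_itv/= sy (le_trans yr)// ltW.
Qed.

(** Starting after [a] puts [u c] into the domain, so the semigroup trajectory [v] is Lipschitz from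
    [c] on and the distance [m] is absolutely continuous. *)
Lemma weak_solution_semigroup_step c t : a < c -> c <= t -> t < b ->
  u t = T (t - c) (u c).
Proof.
move=> ac ct tb.
have cb := le_lt_trans ct tb.
have [y Ay] : op_dom A (u c) by apply: u_dom; rewrite ac.
pose v r := T (r - c) (u c).
have vc : v c = u c by rewrite /v subrr (semigroup0 T_sg).
have vL r r' : c <= r -> r <= r' -> `|v r' - v r| <= `|y| * (r' - r).
  move=> cr rr'; have cr' := le_trans cr rr'.
  rewrite /v; apply: le_trans (semigroup_lipschitz A_acc A_dense T_sg _ _ Ay) _.
  - by rewrite subr_ge0.
  - by rewrite subr_ge0.
  by rewrite opprB addrA subrK ger0_norm ?subr_ge0// mulrC.
pose m r := `|u r - v r|.
suff : m t <= m c.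
  by rewrite {2}/m vc subrr normr0 normr_le0 subr_eq0 => /eqP.
have [acu _] := u_W11 ac ct tb.
apply: absolutely_continuous_left_dini_le => //.
  move=> e e0; have e2 : 0 < e / 2 by lra.
  have [d1 d10 H1] := acu _ e2.
  have acv : absolutely_continuous c t v.
    apply: (@lipschitz_absolutely_continuous _ _ _ _ `|y|) => r r' cr rr' _.
    exact: vL.
  have [d2 d20 H2] := acv _ e2.
  exists (Num.min d1 d2); first by rewrite lt_min d10.
  move=> n l r lr tI; rewrite lt_min => /andP[lt1 lt2].
  have := ltrD (H1 n l r lr tI lt1) (H2 n l r lr tI lt2).
  rewrite -splitr -big_split/=; apply: le_lt_trans; apply: ler_sum => i _.
  rewrite (le_trans (ler_dist_dist _ _))//.
  rewrite (_ : u (r i) - v (r i) - _ = u (r i) - u (l i) - (v (r i) - v (l i))).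
    exact: ler_normB.
  by lincomb R V; ring.
have H1 := weak_solution_derivative ac ct tb.
have H2 := trajectory_ae_derivative A_acc A_dense T_sg T_dom Ao_gen (u c) c sepV.
move: H1 H2; apply: filterS2; first exact: (ae_filter_ringOfSetsType mu).
move=> r H1 H2 crt e e0; have /andP[cr rt] := crt.
have e2 : 0 < e / 2 by lra.
have [d1 d10 {}H1] := H1 crt _ e2.
have [d2 d20 {}H2] := H2 cr _ e2.
exists (Num.min d1 d2); first by rewrite lt_min d10.
move=> h /andP[h0]; rewrite lt_min => /andP[hd1 hd2].
have nh : `|- h| = h by rewrite normrN gtr0_norm.
have := H1 (- h); rewrite nh => /(_ hd1) {}H1.
have := H2 (- h); rewrite nh => /(_ hd2) {}H2.
have Au : A (u r) (Ao (u r)).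
  by have [H _] := Ao_gen; apply H; apply: u_dom; rewrite (lt_trans ac cr) (lt_trans rt tb).
have Av : A (v r) (Ao (v r)).
  by have [H _] := Ao_gen; apply H; apply: T_dom; rewrite subr_gt0.
(* To first order [u r + h *: Ao (u r)] is [u (r - h)], and likewise for [v], so accretivity bounds
   [m r] by [m (r - h)] up to [e * h]: it controls left differences. *)
have := A_acc h0 Au Av; rewrite -/(m r).
move: H1 H2; rewrite -/(v r) -/(v (r - h)).
set eu := u (r - h) - u r - _; set ev := v (r - h) - v r - _ => H1 H2.
rewrite (_ : u r - v r + _ = (u (r - h) - v (r - h)) - (eu - ev)); last first.
  by rewrite /eu /ev; lincomb R V; ring.
have := ler_normB (u (r - h) - v (r - h)) (eu - ev); rewrite -/(m (r - h)).
have := ler_normB eu ev; lra.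
Qed.

Hypothesis u_right : u s @[s --> a^'+] --> u a.

(** [u a] may lie outside the domain, for instance right after a jump; right continuity and
    nonexpansiveness allow [c] to tend to [a]. *)
Lemma weak_solution_semigroup t : a <= t < b -> u t = T (t - a) (u a).
Proof.
rewrite le_eqVlt => /andP[/predU1P[<- _|at_ tb]].
  by rewrite subrr (semigroup0 T_sg).
apply/eqP; rewrite -subr_eq0 -normr_le0; apply/ler_addgt0Pr => e e0; rewrite add0r.
have e2 : 0 < e / 2 by lra.
have ta0 : 0 <= t - a by rewrite subr_ge0 ltW.
have cT : T (Num.max (t - c) 0) (u a) @[c --> a] --> T (Num.max (t - a) 0) (u a).
  apply: (@continuous_comp R R V (fun c : R => t - c) (fun r : R => T (Num.max r 0) (u a)) a).
    by apply: cvgB; [exact: cvg_cst | exact: cvg_id].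
  exact: (semigroup_continuous A_acc A_dense T_sg).
have {}cT : T (Num.max (t - c) 0) (u a) @[c --> a^'+] --> T (Num.max (t - a) 0) (u a).
  exact: cvg_within_filter.
have [c [ac ct H1 H2]] : exists c, [/\ a < c, c < t, `|u a - u c| < e / 2 &
    `|T (Num.max (t - a) 0) (u a) - T (Num.max (t - c) 0) (u a)| < e / 2].
  near (a^'+) => c; exists c; split; near: c.
  - exact: nbhs_right_gt.
  - exact: nbhs_right_lt.
  - by move/cvgrPdist_lt : u_right; apply.
  - by move/cvgrPdist_lt : cT; apply.
rewrite (weak_solution_semigroup_step ac (ltW ct) tb).
rewrite !max_l ?subr_ge0 ?ltW// in H2.
have tc0 : 0 <= t - c by rewrite subr_ge0 ltW.
have := semigroup_nonexpansive A_acc A_dense T_sg (u a) (u c) tc0.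
have := ler_distD (T (t - c) (u a)) (T (t - a) (u a)) (T (t - c) (u c)).
rewrite distrC; lra.
Unshelve. all: by end_near. Qed.

End strong_uniqueness.

(** * Strong solutions, path by path *)

Section uniqueness.
Context (R : realType) (V : completeNormedModType R) (A : V -> set V).
Hypotheses (A_acc : accretive A) (A_dense : densely_defined A).
Context (T : R -> V -> V) (Ao : V -> V).
Hypothesis T_sg : semigroup_of A T.
Hypothesis T_dom : domain_invariant A T.
Hypothesis Ao_gen : infinitesimal_generator A T Ao.
Hypothesis sepV : separable V.
Context (Vstar : set {linear V -> R^o}).
Hypothesis Vstar_dual : Vstar `<=` @dual R V.
Hypothesis Vstar_sep : separates_points Vstar.
Context d (Omega : measurableType d) (P : probability Omega R).
Context dZ (Z : measurableType dZ).
Context (Theta : Omega -> point_function R Z) (alpha : nat -> Omega -> R).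
Hypotheses (P_complete : measure_is_complete P) (Theta_pp : point_process Theta).
Hypothesis Theta_finite : finite_point_process P Theta.
Hypothesis alpha_hit : hitting_times P Theta alpha.
Implicit Types (x : Omega -> V) (eta : R -> Z -> Omega -> V).
Local Notation gen := (generated_process Theta alpha T).
Local Notation mu := (@lebesgue_measure R).

Section pathwise.
Hypothesis Vstar_neq0 : Vstar !=set0.
Variables (x : Omega -> V) (eta : R -> Z -> Omega -> V) (X : R -> Omega -> V).
Variable (w : Omega).
Hypotheses (wr : regular_path Theta alpha w) (meta : measurable_jumps eta).
Hypothesis X_reg : solution_regularity alpha A x X w.
Hypothesis X_int : forall (t : R) Psi, 0 < t -> Vstar Psi ->
  mu.-integrable `]0, t[ (fun tau => (Psi (Ao (X tau w)) : R)%:E).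
Hypothesis X_weak : forall (t : R) Psi, 0 < t -> Vstar Psi ->
  ((Psi (X t w - x w) : R)%:E +
    \int[mu]_(tau in `]0%R, t[) (Psi (Ao (X tau w)) : R)%:E
  = \int[pf_count (Theta w)]_(p in `]0%R, t] `*` setT)
      (Psi (eta p.1 p.2 w) : R)%:E)%E.
Local Notation y m := (jump_sequence Theta alpha T x eta m w).
Local Notation e m := (jump_mark Theta alpha eta m w).

Lemma weak_formulation Psi K t : 0 < t -> Vstar Psi -> alpha K w <= t < alpha K.+1 w ->
  (Psi (X t w) : R) = Psi (x w) - \int[mu]_(r in `]0, t[) (Psi (Ao (X r w)) : R)
    + \sum_(k < K) (Psi (e k.+1) : R).
Proof.
move=> t0 VPsi /andP[Kt tK]; have := X_weak t0 VPsi.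
rewrite (integral_pf_count alpha_hit wr Kt tK); last first.
  exact: measurable_dual_jumps (Vstar_dual VPsi) meta.
rewrite -[X in (_ + X)%E]fineK; last exact: integrable_fin_num (X_int t0 VPsi).
rewrite -EFinD => -[].
have -> : (Psi (X t w - x w) : R) = (Psi (X t w) : R) - Psi (x w) by rewrite linearB.
move=> <-; rewrite /Rintegral; ring.
Qed.

Let incr m : alpha m w < alpha m.+1 w.
Proof. exact: regular_path_lt wr (ltnSn m). Qed.

Lemma strong_solution_cell m t : X (alpha m w) w = y m ->
  alpha m w <= t < alpha m.+1 w -> X t w = T (t - alpha m w) (y m).
Proof.
move=> Xm; rewrite -Xm; have [_ [X_right _] X_dom X_W11] := X_reg.
have am0 := alpha_ge0 alpha_hit m w.
apply: (weak_solution_semigroup A_acc A_dense T_sg T_dom Ao_gen sepV Vstar_dual Vstar_sep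
  Vstar_neq0 (u := X ^~ w)) => //.
- move=> s /andP[ms sm]; apply: X_dom; first exact: le_lt_trans ms.
  move=> k sk; move: ms sm; rewrite sk !(regular_path_ltP _ _ wr) => mk.
  by rewrite ltnNge mk.
- by move=> s r ms sr rm; exact: (X_W11 m).
- move=> s r Psi ms sr rm VPsi.
  have s0 : 0 < s := le_lt_trans am0 ms.
  have r0 := lt_trans s0 sr.
  have ir : mu.-integrable `]0, r[ (EFin \o (fun r => Psi (Ao (X r w)) : R)).
    exact: X_int.
  have sr_sub : (`]s, r[%classic : set R) `<=` `]0, r[%classic.
    by move=> q; rewrite /= !in_itv/= => /andP[/(lt_trans s0) -> ->].
  split; first by apply: integrableS ir.
  rewrite (@weak_formulation Psi m r)//; last by rewrite rm (ltW (lt_trans ms sr)).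
  rewrite (@weak_formulation Psi m s)//; last by rewrite (lt_trans sr rm) ltW.
  by rewrite (Rintegral_itv_oo_join (ltW s0) sr ir); ring.
- exact: X_right.
Qed.

(** The weak formulation at [b] differs from its limit from the left by the one new term
    [Psi (e m.+1)]. The left limit of the path is known from the preceding cell, and [Vstar]
    separates points. *)
Lemma strong_solution_jump m : X (alpha m w) w = y m -> X (alpha m.+1 w) w = y m.+1.
Proof.
move=> Xm; set b := alpha m.+1 w.
have b0 : 0 < b := le_lt_trans (alpha_ge0 alpha_hit m w) (incr m).
have mb := incr m; rewrite -/b in mb.
have cX : X s w @[s --> b^'-] --> T (b - alpha m w) (y m).
  have c : s - alpha m w @[s --> b] --> b - alpha m w.
    by apply: cvgB; [exact: cvg_id | exact: cvg_cst].
  have cT : T (Num.max (s - alpha m w) 0) (y m) @[s --> b] -->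
      T (Num.max (b - alpha m w) 0) (y m).
    apply: (@continuous_comp R R V (fun s : R => s - alpha m w)
      (fun r : R => T (Num.max r 0) (y m)) b); first exact: c.
    exact: (semigroup_continuous A_acc A_dense T_sg).
  rewrite max_l ?subr_ge0 ?ltW// in cT.
  apply: (eq_cvg_at_left mb _ cT) => s /andP[ms sb].
  by rewrite max_l ?subr_ge0 ?ltW// (strong_solution_cell Xm)// ltW.
apply/eqP; rewrite -subr_eq0; apply/eqP/Vstar_sep => Psi VPsi.
pose f (r : R) : R := Psi (Ao (X r w)).
have ib : mu.-integrable `]0, b[ (EFin \o f) by exact: X_int.
have cPX : (Psi (X s w) : R^o) @[s --> b^'-] --> (Psi (T (b - alpha m w) (y m)) : R^o).
  apply: cvg_comp cX _; exact: (Vstar_dual VPsi).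
have cI : \int[mu]_(r in `[0, s]) f r @[s --> b^'-] --> \int[mu]_(r in `[0, b]) f r.
  exact: (parameterized_integral_cvg_at_left b0 (integrable_itv_cc ib)).
pose S := \sum_(k < m) (Psi (e k.+1) : R).
have : ((Psi (x w) : R) - \int[mu]_(r in `[0, s]) f r + S) @[s --> b^'-] -->
    ((Psi (x w) : R) - \int[mu]_(r in `[0, b]) f r + S).
  by apply: cvgD; [apply: cvgB => //; exact: cvg_cst|exact: cvg_cst].
move=> cR; have E : (Psi (T (b - alpha m w) (y m)) : R) =
    (Psi (x w) : R) - \int[mu]_(r in `[0, b]) f r + S.
  apply: (cvg_unique _ cPX) => //; apply: cvg_trans cR.
  apply: near_eq_cvg; near=> s.
  have ms : alpha m w < s by near: s; exact: nbhs_left_gt.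
  have sb : s < b by near: s; exact: nbhs_left_lt.
  have s0 : 0 < s := le_lt_trans (alpha_ge0 alpha_hit m w) ms.
  rewrite (@weak_formulation Psi m s)//; last by rewrite sb ltW.
  rewrite Rintegral_itv_oo_cc//.
  exact: X_int.
have -> : (Psi (X b w - y m.+1) : R) = (Psi (X b w) : R) -
    ((Psi (T (b - alpha m w) (y m)) : R) + Psi (e m.+1)).
  by rewrite linearB/= linearD.
rewrite (@weak_formulation Psi m.+1 b)//; last by rewrite lexx incr.
rewrite E big_ord_recr/= -/S Rintegral_itv_oo_cc//; ring.
Unshelve. all: by end_near. Qed.

Lemma strong_solution_path t : 0 <= t -> X t w = gen x eta t w.
Proof.
move=> t0; have Xy m : X (alpha m w) w = y m.
  elim: m => [|m IH]; last exact: strong_solution_jump.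
  have [-> _ _ _ _] := alpha_hit.
  by have [-> _ _ _] := X_reg.
have [m mt] := regular_path_cell alpha_hit wr t0.
by rewrite (strong_solution_cell (Xy m) mt) (generated_process_cell _ _ _ wr mt).
Qed.

End pathwise.
End uniqueness.

(** * From strong to mild solutions, and the norm bound *)

Section uniqueness_mild.
Context (R : realType) (V : completeNormedModType R) (A : V -> set V).
Hypotheses (A_acc : accretive A) (A_dense : densely_defined A).
Context (T : R -> V -> V) (Ao : V -> V).
Hypothesis T_sg : semigroup_of A T.
Hypothesis T_dom : domain_invariant A T.
Hypothesis Ao_gen : infinitesimal_generator A T Ao.
Hypothesis sepV : separable V.
Context (Vstar : set {linear V -> R^o}).
Hypothesis Vstar_dual : Vstar `<=` @dual R V.
Hypothesis Vstar_sep : separates_points Vstar.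
Context d (Omega : measurableType d) (P : probability Omega R).
Context dZ (Z : measurableType dZ).
Context (Theta : Omega -> point_function R Z) (alpha : nat -> Omega -> R).
Hypotheses (P_complete : measure_is_complete P) (Theta_pp : point_process Theta).
Hypothesis Theta_finite : finite_point_process P Theta.
Hypothesis alpha_hit : hitting_times P Theta alpha.
Implicit Types (x : Omega -> V) (eta : R -> Z -> Omega -> V).
Local Notation gen := (generated_process Theta alpha T).

Lemma strong_solution_generated x eta X : measurable_jumps eta ->
  strong_solution P Theta alpha A Ao Vstar x eta X ->
  indistinguishable P X (gen x eta).
Proof.
move=> meta [_ strong]; have [/set0P V0|Vstar0] := boolP (Vstar != set0).
  have ae_wr := ae_regular_path Theta_pp Theta_finite alpha_hit.
  move: strong ae_wr; apply: filterS2 => w [X_reg X_int X_weak] wr t t0.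
  exact: (strong_solution_path A_acc A_dense T_sg T_dom Ao_gen sepV Vstar_dual Vstar_sep
    alpha_hit V0 wr meta X_reg X_int X_weak).
(* An empty [Vstar] separates points only in the zero space. *)
have V0 (v : V) : v = 0.
  by apply: Vstar_sep => Psi; move: Vstar0; rewrite negbK => /eqP ->.
by apply: aeW => w t _; rewrite (V0 (X t w)) (V0 (gen x eta t w)).
Qed.

Lemma mild_solution_unique x eta Y : measurable_jumps eta ->
  mild_solution P Theta alpha A Ao Vstar x eta Y -> indistinguishable P Y (gen x eta).
Proof.
move=> meta [_ Y_reg [xs [etas [Xs [strong ae_lim]]]]].
have ae_wr := ae_regular_path Theta_pp Theta_finite alpha_hit.
have ae_gen : {ae P, forall w, forall m : nat, forall t, 0 <= t ->
    Xs m t w = gen (xs m) (etas m) t w}.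
  have Hm m : {ae P, forall w, forall t, 0 <= t -> Xs m t w = gen (xs m) (etas m) t w}.
    have [_ metam strongm] := strong m.
    exact: (strong_solution_generated metam strongm).
  exact: (@ae_foralln _ _ _ P (fun m w => forall t, 0 <= t -> Xs m t w = gen (xs m) (etas m) t w) Hm).
have ae_reg : {ae P, forall w,
    regular_path Theta alpha w /\ solution_regularity alpha A x Y w}.
  by move: ae_wr Y_reg; apply: filterS2.
move: ae_reg ae_lim ae_gen; apply: filterS3.
move=> w [wr [Y0 _ _ _]] lim_w gen_w t t0.
(* The limits are given at positive times only, while [t] may be [0]. *)
have t10 : 0 < t + 1 by lra.
have [lim1 lim2] := lim_w _ t10.
have [K tK] := regular_path_cell alpha_hit wr (ltW t10).
have /andP[Kt tK'] := tK.
set a := (fun m => ereal_sup _) in lim1.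
set b := (fun m => integral _ _ _) in lim2.
have aE m s : 0 <= s <= t + 1 -> (`|Xs m s w - Y s w|%:E <= a m)%E.
  by move=> st; apply: ereal_sup_ubound; exists s.
(* The supremum [a m] is used twice: at time [t], and at time [0], where it bounds the distance
   between the initial values [xs m] and [x]. The jumps are accounted for by [b m]. *)
have abE m : (`|Y t w - gen x eta t w|%:E <= a m + (a m + b m))%E.
  have at_ : (`|Xs m t w - Y t w|%:E <= a m)%E by apply: aE; lra.
  have a0 : (`|Xs m 0 w - Y 0 w|%:E <= a m)%E by apply: aE; lra.
  apply: (@le_trans _ _ (`|Xs m t w - Y t w|%:E +
      (`|Xs m 0 w - Y 0 w|%:E + b m))%E); last by rewrite leeD// leeD.
  have [_ metam _] := strong m.
  rewrite /b (integral_pf_count alpha_hit wr Kt tK'); last first.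
    by apply: measurable_norm_jumps => //; have [] := strong m.
  rewrite -!EFinD lee_fin Y0.
  have -> : Xs m 0 w = xs m w.
    rewrite gen_w//.
    have [-> _ _ _] := generated_process_regularity A_acc A_dense T_sg T_dom Ao_gen sepV
      alpha_hit (xs m) (etas m) wr.
    by [].
  have tt : 0 <= t <= t + 1 by lra.
  have := generated_process_dist A_acc A_dense T_sg alpha_hit (xs m) x (etas m) eta wr tt tK'.
  rewrite -gen_w//; have := ler_distD (Xs m t w) (Y t w) (gen x eta t w).
  rewrite (distrC (Y t w) (Xs m t w)) => H1 H2; apply: le_trans H1 _.
  by rewrite lerD2l.
have lim_ab : (a m + (a m + b m))%E @[m --> \oo] --> (0 + (0 + 0))%E.
  apply: cvgeD => //; apply: cvgeD => //.
have : (`|Y t w - gen x eta t w|%:E <= 0 + (0 + 0))%E.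
  apply: (cvge_to_ge lim_ab); near=> m; exact: abE.
by rewrite !adde0 lee_fin normr_le0 subr_eq0 => /eqP.
Unshelve. all: by end_near. Qed.

(** Comparison with the process generated by zero data, which vanishes because [0] is a fixed point
    of the semigroup. *)
Lemma generated_process_bound x eta : A 0 0 -> measurable_jumps eta ->
  {ae P, forall w, forall t : R, 0 <= t ->
    ((`|gen x eta t w|)%:E <= (`|x w|)%:E +
       \int[pf_count (Theta w)]_(p in `]0%R, t] `*` setT) (`|eta p.1 p.2 w|)%:E)%E}.
Proof.
move=> A00 meta; have ae_wr := ae_regular_path Theta_pp Theta_finite alpha_hit.
move: ae_wr; apply: filterS => w wr t t0.
have [K tK] := regular_path_cell alpha_hit wr t0.
have /andP[Kt tK'] := tK.
pose x0 (w : Omega) : V := 0; pose eta0 (t : R) (z : Z) (w : Omega) : V := 0.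
have meta0 : measurable_jumps eta0 by exact: measurable_cst.
have mnorm : measurable_fun (`]0, t] `*` setT)
    (fun p => `|eta p.1 p.2 w - eta0 p.1 p.2 w|) by exact: measurable_norm_jumps.
rewrite (eq_integral (fun p => (`|eta p.1 p.2 w - eta0 p.1 p.2 w|)%:E)); last first.
  by move=> p _; rewrite subr0.
rewrite (integral_pf_count alpha_hit wr Kt tK' mnorm) -EFinD lee_fin.
have tt : 0 <= t <= t by rewrite t0 lexx.
have := generated_process_dist A_acc A_dense T_sg alpha_hit x x0 eta eta0 wr tt tK'.
rewrite subr0 (_ : gen x0 eta0 t w = 0) ?subr0//.
have js0 m : jump_sequence Theta alpha T x0 eta0 m w = 0.
  elim: m => [//|m IH] /=; rewrite IH (semigroup_fix0 A_acc T_sg A00) ?addr0//.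
  by rewrite subr_ge0 ltW// (regular_path_lt wr).
rewrite (generated_process_cell _ _ _ wr tK) js0 (semigroup_fix0 A_acc T_sg A00)//.
by rewrite subr_ge0.
Qed.

End uniqueness_mild.

Theorem theorem0p3p13
  (R : realType)
  (d : measure_display) (Omega : measurableType d) (P : probability Omega R)
  (P_complete : measure_is_complete P)
  (dZ : measure_display) (Z : measurableType dZ)
  (Theta : Omega -> point_function R Z)
  (Theta_pp : point_process Theta)
  (Theta_finite : finite_point_process P Theta)
  (Theta_infinite : {ae P, forall w, infinite_set (pf_dom (Theta w))})
  (alpha : nat -> Omega -> R)
  (alpha_hit : hitting_times P Theta alpha)
  (V : completeNormedModType R)
  (V_separable : separable V)
  (A : V -> set V)
  (A_macc : m_accretive A)
  (A_dense : densely_defined A)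
  (T : R -> V -> V)
  (T_sg : semigroup_of A T)
  (T_dom : domain_invariant A T)
  (Ao : V -> V)
  (Ao_gen : infinitesimal_generator A T Ao)
  (W : set V)
  (W_subspace : submod_closed (mem W))
  (W_dense : closure W = setT)
  (Vstar : set {linear V -> R^o})
  (Vstar_dual : Vstar `<=` @dual R V)
  (Vstar_sep : separates_points Vstar)
  (x : Omega -> V) (x_meas : measurable_initial x)
  (eta : R -> Z -> Omega -> V) (eta_meas : measurable_jumps eta)
  (W_inv : invariant W T)
  (W_L1 : forall (t : R) u Psi, 0 < t -> W u -> Vstar Psi ->
     lebesgue_measure.-integrable `]0, t[
       (fun tau => (Psi (Ao (T tau u)) : R)%:E)) :
  let X := generated_process Theta alpha T x eta in
  (mild_solution P Theta alpha A Ao Vstar x eta X /\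
   forall Y, mild_solution P Theta alpha A Ao Vstar x eta Y ->
     indistinguishable P Y X) /\
  (A 0 0 ->
   {ae P, forall w, forall t : R, 0 <= t ->
     ((`|X t w|)%:E <= (`|x w|)%:E +
        \int[pf_count (Theta w)]_(p in `]0%R, t] `*` setT)
          (`|eta p.1 p.2 w|)%:E)%E}).
Proof.
move=> X; have [A_acc _] := A_macc.
have W_add u v : W u -> W v -> W (u + v).
  move=> Wu Wv; have [_ H] := W_subspace.
  by have := H 1 u v (mem_set Wu) (mem_set Wv); rewrite scale1r => /set_mem.
split; last by move=> A00; exact: (generated_process_bound A_acc A_dense T_sg).
split; last by move=> Y; exact: (mild_solution_unique A_acc A_dense T_sg T_dom Ao_gen).
exact: (generated_mild_solution A_acc A_dense T_sg T_dom Ao_gen V_separable Vstar_dual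
  W_L1 W_inv W_add W_dense P_complete Theta_pp Theta_finite alpha_hit).
Qed.
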